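(* Let $k\ge 3$, $s\ge 1$ with $s\le k$, and positive integers $n_1,\dots,n_k$ and $r\le\min\{n_1,\dots,n_k\}$. If $s=1$, assume in addition that $\sum_{i'=2}^k n_{i'}\ge n_1+k-1$ and $\sum_{i'=2}^k n_{i'}\ge n_{i''}+k$ for all $2\le i''\le k$. Then for a generic tensor $\mathcal A\in\mathbb R^{n_1}\otimes\cdots\otimes\mathbb R^{n_k}$, every sequence $\{U_{[p]}\}$ generated by the iAPD-ALS algorithm (described in the context) with input $\mathcal A$, $r$ and any $\epsilon>0$ converges $R$-linearly to a KKT point of problem $\mathrm{mLRPOTA}(t)$, $t$ being the eventual number of columns; i.e. there are $U^*$, $C>0$ and $q\in(0,1)$ with $\|U_{[p]}-U^*\|_F\le Cq^p$ for all sufficiently large $p$.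
   Context: ''Generic'' means: for all $\mathcal A$ outside a subset of Lebesgue measure zero of the tensor space. Notation. $\mathrm V(m,n)=\{U\in\mathbb R^{n\times m}:U^{\mathsf T}U=I_m\}$; $\mathrm B(m,n)$ is the set of $n\times m$ real matrices all of whose columns have Euclidean norm $1$. For $\mathbf u_i\in\mathbb R^{n_i}$, $\mathcal A\tau(\mathbf u_1,\dots,\mathbf u_k)=\langle\mathcal A,\mathbf u_1\otimes\cdots\otimes\mathbf u_k\rangle$ and $\mathcal A\tau_i(\mathbf u_1,\dots,\mathbf u_k)\in\mathbb R^{n_i}$ is the contraction of $\mathcal A$ with all $\mathbf u_l$, $l\ne i$. For $U=(U^{(1)},\dots,U^{(k)})$, $U^{(i)}\in\mathbb R^{n_i\times t}$ with columns $\mathbf u^{(i)}_j$: $\lambda_j(U)=\mathcal A\tau(\mathbf u^{(1)}_j,\dots,\mathbf u^{(k)}_j)$, $f(U)=\sum_j\lambda_j(U)^2$, $\|U\|_F^2=\sum_i\|U^{(i)}\|_F^2$. $\operatorname{Polar}(X)$, for $X\in\mathbb R^{n\times m}$, is the set of $Q\in\mathrm V(m,n)$ maximizing $\langle Q,X\rangle$. Problem $\mathrm{mLRPOTA}(t)$: maximize $f(U)$ over $\mathrm V(t,n_1)\times\cdots\times\mathrm V(t,n_s)\times\mathrm B(t,n_{s+1})\times\cdots\times\mathrm B(t,n_k)$; feasible $U$ is a KKT point iff there are symmetric $P_i\in\mathbb R^{t\times t}$ ($i\le s$) and $\mathbf p\in\mathbb R^t$ with $V^{(i)}\Lambda=U^{(i)}P_i$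 ($i\le s$), $V^{(i)}\Lambda=U^{(i)}\operatorname{diag}(\mathbf p)$ ($i>s$), where $V^{(i)}$ has columns $\mathcal A\tau_i(\mathbf u^{(1)}_j,\dots,\mathbf u^{(k)}_j)$ and $\Lambda=\operatorname{diag}(\lambda_j(U))$. iAPD-ALS algorithm. Choose $U_{[0]}\in\mathrm V(r,n_1)\times\cdots\times\mathrm V(r,n_s)\times\mathrm B(r,n_{s+1})\times\cdots\times\mathrm B(r,n_k)$ with $f(U_{[0]})>0$ and $\kappa\in(0,\sqrt{f(U_{[0]})/r})$. For $p=1,2,\dots$ ($t$ = current number of columns, $\mathbf u^{(i)}_{j,[q]}$ = $j$-th column of $U^{(i)}_{[q]}$), let $\mathbf x^i_{j,[p]}=(\mathbf u^{(1)}_{j,[p]},\dots,\mathbf u^{(i-1)}_{j,[p]},\mathbf u^{(i)}_{j,[p-1]},\dots,\mathbf u^{(k)}_{j,[p-1]})$, $\lambda^{i-1}_{j,[p]}=\mathcal A\tau(\mathbf x^i_{j,[p]})$, $\Lambda^{(i)}_{[p]}=\operatorname{diag}(\lambda^{i-1}_{j,[p]})_j$, $V^{(i)}_{[p]}=[\mathcal A\tau_i(\mathbf x^i_{j,[p]})]_j$. (1) For $i=1,\dots,s$ in turn pick $U^{(i)}_{[p]}\in\operatorname{Polar}(V^{(i)}_{[p]}\Lambda^{(i)}_{[p]})$, and if the smallest eigenvalue of $(U^{(i)}_{[p]})^{\mathsf T}V^{(i)}_{[p]}\Lambda^{(i)}_{[p]}$ is $<\epsilon$, instead pick $U^{(i)}_{[p]}\in\operatorname{Polar}(V^{(i)}_{[p]}\Lambda^{(i)}_{[p]}+\epsilon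 U^{(i)}_{[p-1]})$. (2) Truncation: with $J=\{j:|((U^{(s)}_{[p]})^{\mathsf T}V^{(s)}_{[p]})_{jj}|<\kappa\}$, delete columns in $J$ from $U^{(1)}_{[p]},\dots,U^{(s)}_{[p]}$ and $U^{(s+1)}_{[p-1]},\dots,U^{(k)}_{[p-1]}$ and set $t:=t-|J|$. (3) For $i=s+1,\dots,k$ in turn, $\mathbf u^{(i)}_{j,[p]}=\operatorname{sgn}(\lambda^{i-1}_{j,[p]})\mathcal A\tau_i(\mathbf x^i_{j,[p]})/\|\mathcal A\tau_i(\mathbf x^i_{j,[p]})\|$. Set $U_{[p]}=(U^{(1)}_{[p]},\dots,U^{(k)}_{[p]})$ and iterate indefinitely. *)

(* Defs.v *)
From HB Require Import structures.
From mathcomp Require Import all_boot all_order all_algebra.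
From mathcomp Require Import reals.
Set Implicit Arguments. Unset Strict Implicit. Unset Printing Implicit Defensive.
Import Order.TTheory GRing.Theory Num.Theory.
Local Open Scope ring_scope.

Section Defs.
Variables (R : realType) (k : nat) (n : 'I_k -> nat).

Definition idx := {dffun forall i : 'I_k, 'I_(n i)}.
Definition tensor := {ffun idx -> R}.

Definition tensor_null (N : tensor -> Prop) : Prop :=
  forall eps : R, 0 < eps ->
  exists a b : nat -> tensor,
    (forall l z, a l z <= b l z) /\
    (forall A, N A -> exists l, forall z, a l z <= A z <= b l z) /\
    (forall m, \sum_(l < m) \prod_(z : idx) (b l z - a l z) <= eps).

Definition vfam := forall i : 'I_k, 'cV[R]_(n i).

Definition Atau (A : tensor) (x : vfam) : R :=
  \sum_(z : idx) A z * \prod_(l : 'I_k) x l (z l) ord0.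

Definition Atau_i (A : tensor) (x : vfam) (i : 'I_k) : 'cV[R]_(n i) :=
  \col_(a < n i) \sum_(z : idx | z i == a) A z * \prod_(l : 'I_k | l != i) x l (z l) ord0.

Definition mats (t : nat) := forall i : 'I_k, 'M[R]_(n i, t).

Definition colfam t (U : mats t) (j : 'I_t) : vfam := fun l => col j (U l).

Definition lam (A : tensor) t (U : mats t) (j : 'I_t) : R := Atau A (colfam U j).

Definition fobj (A : tensor) t (U : mats t) : R := \sum_(j < t) lam A U j ^+ 2.

Definition Vmat (A : tensor) t (U : mats t) (i : 'I_k) : 'M[R]_(n i, t) :=
  \matrix_(a < n i, j < t) Atau_i A (colfam U j) i a ord0.

Definition Lam (A : tensor) t (U : mats t) : 'M[R]_t := diag_mx (\row_j lam A U j).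

Definition vnorm m (v : 'cV[R]_m) : R := Num.sqrt (\sum_(a < m) v a ord0 ^+ 2).

Definition frob t (U : mats t) : R :=
  Num.sqrt (\sum_(i : 'I_k) \sum_(a < n i) \sum_(j < t) U i a j ^+ 2).

End Defs.

Section Sets.
Variable R : realType.

Definition stiefel m t (Q : 'M[R]_(m, t)) : Prop := Q^T *m Q = 1%:M.
Definition oblique m t (Q : 'M[R]_(m, t)) : Prop := forall j, vnorm (col j Q) = 1.

Definition polar m t (Q X : 'M[R]_(m, t)) : Prop :=
  stiefel Q /\ forall Q' : 'M[R]_(m, t), stiefel Q' -> \tr (Q'^T *m X) <= \tr (Q^T *m X).

(* the smallest eigenvalue of M is < eps (all eigenvalues are real in our use) *)
Definition mineig_lt t (M : 'M[R]_t) (eps : R) : Prop :=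
  exists a : R, eigenvalue M a /\ a < eps.
End Sets.

Section Problem.
Variables (R : realType) (k : nat) (n : 'I_k -> nat).

(* feasible set V(t,n_1) x ... x V(t,n_s) x B(t,n_{s+1}) x ... x B(t,n_k);
   0-based index i corresponds to the paper's i+1, so "i+1 <= s" is (i < s) *)
Definition feasible (s : nat) t (U : mats R n t) : Prop :=
  forall i : 'I_k, ((i < s)%N -> stiefel (U i)) /\ (~ (i < s)%N -> oblique (U i)).

Definition KKT (A : tensor R n) (s : nat) t (U : mats R n t) : Prop :=
  feasible s U /\
  exists (P : 'I_k -> 'M[R]_t) (pv : 'rV[R]_t),
    (forall i : 'I_k, (i < s)%N ->
        (P i)^T = P i /\ Vmat A U i *m Lam A U = U i *m P i) /\
    (forall i : 'I_k, ~ (i < s)%N ->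
        Vmat A U i *m Lam A U = U i *m diag_mx pv).

Definition xmix t (Unew Uold : mats R n t) (i : 'I_k) (j : 'I_t) : vfam R n :=
  fun l => if (l < i)%N then col j (Unew l) else col j (Uold l).

Definition Vmix (A : tensor R n) t (Unew Uold : mats R n t) (i : 'I_k) : 'M[R]_(n i, t) :=
  \matrix_(a < n i, j < t) Atau_i A (xmix Unew Uold i j) i a ord0.

Definition Lmix (A : tensor R n) t (Unew Uold : mats R n t) (i : 'I_k) : 'M[R]_t :=
  diag_mx (\row_j Atau A (xmix Unew Uold i j)).

Definition iapd_step (A : tensor R n) (s : nat) (eps kappa : R)
    tX tY (X : mats R n tX) (Y : mats R n tY) : Prop :=
  exists W : mats R n tX,
    (* (1) polar steps for i = 1..s (W i = U^(i)_[p] before truncation) *)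
    (forall i : 'I_k, (i < s)%N ->
       exists Q : 'M[R]_(n i, tX),
         polar Q (Vmix A W X i *m Lmix A W X i) /\
         (mineig_lt (Q^T *m (Vmix A W X i *m Lmix A W X i)) eps ->
            polar (W i) (Vmix A W X i *m Lmix A W X i + eps *: X i)) /\
         (~ mineig_lt (Q^T *m (Vmix A W X i *m Lmix A W X i)) eps -> W i = Q)) /\
    exists f : 'I_tY -> 'I_tX,
      (forall a b : 'I_tY, (a < b)%N -> (f a < f b)%N) /\
      (forall j : 'I_tX, (exists j' : 'I_tY, f j' = j) <->
         ~ (exists i : 'I_k, i.+1 = s /\
              `|((W i)^T *m Vmix A W X i) j j| < kappa)) /\
      (forall i : 'I_k, (i < s)%N -> Y i = colsub f (W i)) /\
      (forall i : 'I_k, ~ (i < s)%N -> forall j : 'I_tY,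
         let y := xmix Y (fun l => colsub f (X l)) i j in
         col j (Y i) = Num.sg (Atau A y) *: ((vnorm (Atau_i A y i))^-1 *: Atau_i A y i)).

End Problem.

(* Main.v *)
(* Call a tensor generic if each coordinate is transcendental over the field
   generated by the others; the exceptional tensors form a null set. For a generic
   A and any tensor a there is a derivation d of the real field with d(A_z) = a_z.
   Applying d to the KKT equations at U shows that a tangent vector Z in the kernel
   of the Hessian is annihilated by the differential Theta of the map sending
   (U, lambda) to the sum of the rank-one tensors lambda_j u_j^1 (x) ... (x) u_j^k;
   this replaces Sard's theorem. It remains to see that Theta is injective on tangent
   vectors. With three orthonormal modes, rank-one test tensors decide. With
   one or two, a derivation d_a killing U and lambda has a orthogonal to the image
   of Theta, and counting the functionals that force d_a U = 0, d_a lambda = 0 or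
   Theta xi = 0 against the number of coordinates of (U, lambda) is contradictory
   unless the kernel is trivial. So KKT points with nonzero lambda are nondegenerate.

   Each step increases f by at least c |U_[p] - U_[p-1]|^2 and satisfies the KKT
   equations up to O(|U_[p] - U_[p-1]|). Near a nondegenerate KKT point V the
   residual bounds the distance to V, and f(V) - f(U) = O(|U - V|^2); hence
   f(V) - f(U_[p]) decreases geometrically. *)
Require Import Defs.
From HB Require Import structures.
From mathcomp Require Import all_boot all_order all_algebra.
From mathcomp Require Import reals boolp classical_sets filter topology normedtype sequences.
From mathcomp Require Import ring lra zify.
Set Implicit Arguments. Unset Strict Implicit. Unset Printing Implicit Defensive.
Import Order.TTheory GRing.Theory Num.Theory.
Import numFieldNormedType.Exports.
Local Open Scope ring_scope.

(** * Null sets of tensors *)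

(** Criticality is polynomial in [(A, U, lam, P)], but [U] and [P] are arbitrary reals. Extending
    the derivations to all of R by Zorn's lemma lets them be differentiated along with [A], with no
    implicit function theorem and no regularity of the critical set. The Hessian is symmetric, so
    pairing the differentiated equations with a kernel vector [Z] removes the unknown derivative of
    [U] and leaves [Theta Z = 0]. The exceptional set is a countable union over integer polynomials
    and depends on the tensor space alone; hence it serves every number of columns that truncation
    may leave. With fewer than three orthonormal modes [Theta] really can have a kernel, for
    instance when two columns are parallel in all remaining modes. Such coincidences are algebraic
    relations among the coordinates of [(U, lam)], and they make the derivatives of some columns
    determined by those of others. The count succeeds because these relations save more functionals
    than the kernel they create. With one orthonormal mode the trade is delicate, and the size
    conditions enter exactly there. *)

Section Null.
Variables (R : realType) (k : nat) (n : 'I_k -> nat).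
Implicit Types (S N : tensor R n -> Prop) (A : tensor R n).

Lemma sum_lt_const (c L : nat) (q : R) :
  \sum_(l < L) (if (l < c)%N then q else 0) = (minn L c)%:R * q.
Proof.
elim: L => [|L IH]; first by rewrite big_ord0 min0n mul0r.
rewrite big_ord_recr /= IH; case: ltnP => h.
  by rewrite !(minn_idPl _) ?(ltnW h) // -natr1 mulrDl mul1r.
by rewrite !(minn_idPr _) ?(leq_trans h) // addr0.
Qed.

(** One direction of the grid stays coarse, so the number of cells carries one power of [K] less
    than the volume of a box; a factor [1 / K] survives. *)
Lemma box_volume (c C M K : R) (N : nat) : K != 0 ->
  c * (2 * K) ^+ N * (2 * C * (2 * M / K)) ^+ N.+1 = c * 2 ^+ N * (4 * C * M) ^+ N.+1 / K.
Proof.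
move=> K0; have -> : 2 * C * (2 * M / K) = 4 * C * M / K by field.
rewrite expr_div_n [K ^+ N.+1]exprS exprMn.
have : K ^+ N != 0 by rewrite expf_neq0.
move: (_ ^+ N.+1) (2 ^+ N) (K ^+ N) => a b d d0.
by field; rewrite K0 d0.
Qed.

Lemma null_sub S N : (forall A, S A -> N A) -> tensor_null N -> tensor_null S.
Proof.
move=> SN nN e e0; have [a [b [ab [cov sm]]]] := nN e e0.
by exists a, b; split => //; split => // A /SN; exact: cov.
Qed.

(** A finite set of pairs sits inside a square of side [B], where the sum may be taken row by
    row. *)
Lemma sum_uniq_pairs (v : nat * nat -> R) (s : seq (nat * nat)) (c : nat -> R) (e : R) :
  (forall p, 0 <= v p) -> uniq s ->
  (forall m L, \sum_(l < L) v (m, (l : nat)) <= c m) ->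
  (forall L, \sum_(m < L) c m <= e) ->
  \sum_(p <- s) v p <= e.
Proof.
move=> v0 us vc ce.
pose B := (\max_(p <- s) maxn p.1 p.2).+1.
have sB p : p \in s -> (p.1 < B)%N && (p.2 < B)%N.
  move=> ps; have : (maxn p.1 p.2 <= \max_(p <- s) maxn p.1 p.2)%N.
    exact: (@leq_bigmax_seq _ _ _ (fun p : nat * nat => maxn p.1 p.2)).
  by rewrite geq_max /B !ltnS.
have -> : \sum_(p <- s) v p
    = \sum_(p <- allpairs pair (iota 0 B) (iota 0 B) | p \in s) v p.
  rewrite -[RHS]big_filter; apply: perm_big; apply: uniq_perm => //.
    by apply: filter_uniq; apply: allpairs_uniq; rewrite ?iota_uniq // => -[? ?] [? ?].
  move=> p; rewrite mem_filter; case: (boolP (p \in s)) => // ps.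
  have /andP[p1 p2] := sB _ ps; rewrite [p]surjective_pairing allpairs_f //.
    by rewrite mem_iota /= add0n.
  by rewrite mem_iota /= add0n.
apply: (@le_trans _ _ (\sum_(p <- allpairs pair (iota 0 B) (iota 0 B)) v p)).
  by rewrite [leLHS]big_mkcond; apply: ler_sum => p _; case: ifP.
rewrite big_allpairs_dep; apply: le_trans (ce B).
have -> : iota 0 B = index_iota 0 B by rewrite /index_iota subn0.
rewrite big_mkord.
by apply: ler_sum => m _; rewrite big_mkord.
Qed.

(** The [m]-th set is covered with total volume [e / 2 ^+ m.+1], and the double sequence of boxes is
    enumerated by pickling pairs. *)
Lemma null_bigcup (z0 : idx n) (S : nat -> tensor R n -> Prop) :
  (forall m, tensor_null (S m)) -> tensor_null (fun A => exists m, S m A).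
Proof.
move=> nS e e0.
have e2 m : 0 < e / 2 ^+ m.+1 :> R by rewrite divr_gt0 // exprn_gt0.
have /choice[a /choice[b ab]] := fun m => nS m _ (e2 m).
(* Codes that decode to no pair get the degenerate box at 0; it has volume 0 because the index type
   contains [z0]. *)
pose D l : tensor R n * tensor R n :=
  if pickle_inv l is Some p then (a p.1 p.2, b p.1 p.2) else ([ffun=> 0], [ffun=> 0]).
exists (fun l => (D l).1), (fun l => (D l).2); split; [|split].
- move=> l z; rewrite /D; case: (pickle_inv l) => [p|] /=; last by rewrite !ffunE.
  by have [+ _] := ab p.1; apply.
- move=> A [m SA]; have [_ [/(_ A SA)[l Al] _]] := ab m.
  exists (pickle (m, l)); rewrite /D pickleK_inv /=; exact: Al.
move=> L.
pose v (p : nat * nat) : R := \prod_(z : idx n) (b p.1 p.2 z - a p.1 p.2 z).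
have v0 p : 0 <= v p.
  by apply: prodr_ge0 => z _; rewrite subr_ge0; have [+ _] := ab p.1; apply.
rewrite (_ : \sum_(m < L) _ = \sum_(p <- pmap pickle_inv (iota 0 L)) v p); last first.
  rewrite -[LHS](big_mkord predT (fun l => \prod_(z : idx n) ((D l).2 z - (D l).1 z))).
  rewrite /index_iota subn0; elim: (iota 0 L) => [|l s IH]; first by rewrite !big_nil.
  rewrite big_cons IH /=; rewrite /D; case: (pickle_inv l) => [p|] /=.
    by rewrite big_cons.
  by rewrite (bigD1 z0) //= !ffunE subr0 mul0r add0r.
apply: (@sum_uniq_pairs v _ (fun m => e / 2 ^+ m.+1)) => //.
- by apply: (pmap_uniq (@pickle_invK _)); apply: iota_uniq.
- by move=> m M; have [_ [_ +]] := ab m; apply.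
move=> M; rewrite (_ : \sum_(m < M) _ = e * (1 - 2^-1 ^+ M)).
  by rewrite ger_pMr // gerBl exprn_ge0 // invr_ge0.
elim: M => [|M IH]; first by rewrite big_ord0 expr0 subrr mulr0.
by rewrite big_ord_recr /= IH -exprVn exprS; lra.
Qed.

Lemma null_bigcup_count (z0 : idx n) (I : countType) (S : I -> tensor R n -> Prop) :
  (forall i, tensor_null (S i)) -> tensor_null (fun A => exists i, S i A).
Proof.
move=> nS; apply: (@null_sub _ (fun A => exists m, exists i, pickle i = m /\ S i A)).
  by move=> A [i SA]; exists (pickle i), i.
apply: (null_bigcup z0) => m.
case E: (unpickle m : option I) => [i|].
  by apply: (@null_sub _ (S i)) => // A [j [jm SA]]; move: E; rewrite -jm pickleK => -[<-].
move=> e e0; exists (fun _ => [ffun=> 0]), (fun _ => [ffun=> 0]); split => //; split.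
  by move=> A [j [jm SA]]; move: E; rewrite -jm pickleK.
by move=> L; rewrite big1 ?ltW // => l _; rewrite (bigD1 z0) //= !ffunE subr0 mul0r.
Qed.

(* Around each point the coordinate [z0] is a Lipschitz function of the others,
   so a grid of mesh 1/K gives O(K^(N-1)) boxes of volume O(K^-N). *)
Lemma null_graph (z0 : idx n) S (M C rho : R) : 0 < M -> 0 < rho ->
  (forall A, S A -> forall z, `|A z| <= M) ->
  (forall A A', S A -> S A' -> (forall z, `|A z - A' z| <= rho) ->
     forall d, 0 <= d -> (forall z, z != z0 -> `|A z - A' z| <= d) -> `|A z0 - A' z0| <= C * d) ->
  tensor_null S.
Proof.
move=> M0 rho0 SM SC e e0.
pose cell (K : nat) (x : R) : nat := Num.truncn ((x + M) * K%:R / (2 * M)).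
have cellP K x : (0 < K)%N -> `|x| <= M -> (cell K x < K.+1)%N.
  move=> K0; rewrite ler_norml => /andP[x1 x2]; rewrite ltnS /cell.
  rewrite truncn_le_nat; apply: (@le_lt_trans _ _ K%:R); last by rewrite ltr_nat.
  rewrite ler_pdivrMr ?mulr_gt0 // mulrC ler_pM2l ?ltr0n //; lra.
have cellE K x y : (0 < K)%N -> `|x| <= M -> `|y| <= M -> cell K x = cell K y ->
    `|x - y| <= 2 * M / K%:R.
  move=> K0 xM yM E.
  have K0' : 0 < K%:R :> R by rewrite ltr0n.
  have h0 w : `|w| <= M -> 0 <= (w + M) * K%:R / (2 * M).
    rewrite ler_norml => /andP[w1 w2].
    by rewrite divr_ge0 ?mulr_ge0 ?ler0n //; lra.
  have /andP[a1 a2] := truncn_itv (h0 _ xM).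
  have /andP[b1 b2] := truncn_itv (h0 _ yM).
  rewrite -/(cell K x) -/(cell K y) -E -[(cell K x).+1%:R]natr1 in a1 a2 b1 b2.
  have : `|(x + M) * K%:R / (2 * M) - (y + M) * K%:R / (2 * M)| <= 1.
    by rewrite ler_norml; apply/andP; split; lra.
  rewrite (_ : _ - _ = (x - y) * (K%:R / (2 * M))); last by ring.
  have p0 : 0 < K%:R / (2 * M) by rewrite divr_gt0 ?mulr_gt0.
  by rewrite normrM (gtr0_norm p0) -ler_pdivlMr // mul1r invf_div.
pose N := #|{: idx n}|.
have N0 : (0 < N)%N by apply/card_gt0P; exists z0.
pose C' := Num.max 1 C.
have C'1 : 1 <= C' by rewrite le_max lexx.
have CC' : C <= C' by rewrite le_max lexx orbT.
(* [K0] makes a coarse cell no longer than [rho], so that two tensors in one cell are close enough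
   in the coordinate [z0] too. *)
pose K0 := (Num.truncn (2 * M / rho)).+1.
have K0rho : 2 * M / K0%:R <= rho.
  rewrite ler_pdivrMr ?ltr0n // [rho * _]mulrC -ler_pdivrMr //.
  by have /andP[_ /ltW] := truncn_itv (ltW (divr_gt0 (mulr_gt0 (ltr0Sn R 1) M0) rho0)).
pose c1 : R := K0.+1%:R * 2 ^+ N.-1 * (4 * C' * M) ^+ N.
pose K := maxn K0 (Num.truncn (c1 / e)).+1.
have K00 : (0 < K0)%N by [].
have Kgt : (0 < K)%N by rewrite leq_max.
have Kr : 0 < K%:R :> R by rewrite ltr0n.
have c1K : c1 / K%:R <= e.
  rewrite ler_pdivrMr // mulrC -ler_pdivrMr //.
  have c10 : 0 <= c1 / e.
    by rewrite divr_ge0 ?(ltW e0) // !mulr_ge0 ?exprn_ge0 ?mulr_ge0 ?ler0n ?(ltW M0) //; lra.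
  have /andP[_ /ltW h] := truncn_itv c10.
  by apply: le_trans h _; rewrite ler_nat leq_max leqnn orbT.
pose d := 2 * M / K%:R.
have d0 : 0 <= d by rewrite divr_ge0 ?mulr_ge0 ?ltW.
have drho : d <= rho.
  apply: le_trans K0rho; rewrite /d ler_pM2l ?mulr_gt0 // lef_pV2 ?posrE ?ltr0n //.
  by rewrite ler_nat leq_maxl.
(* Only [z0] is recorded at the fixed coarse scale. The other coordinates use the fine scale [K],
   and the Lipschitz bound then recovers [A z0] up to [C' * d]. *)
pose F : finType := ('I_K0.+1 * {ffun {z : idx n | z != z0} -> 'I_K.+1})%type.
pose code A : F := (inord (cell K0 (A z0)), [ffun z => inord (cell K (A (val z)))]).
have codeP A A' : S A -> S A' -> code A = code A' -> forall z, `|A z - A' z| <= C' * d.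
  move=> SA SA' [] E1 /ffunP E2.
  have h0 : `|A z0 - A' z0| <= rho.
    apply: le_trans K0rho; apply: cellE; rewrite ?SM //.
    by move/(congr1 val): E1; rewrite /= !inordK // cellP // SM.
  have h1 z : z != z0 -> `|A z - A' z| <= d.
    move=> zz0; have := E2 (exist _ z zz0); rewrite !ffunE /= => /(congr1 val).
    by rewrite /= !inordK ?cellP ?SM // => ?; apply: cellE; rewrite ?SM.
  move=> z; case: (eqVneq z z0) => [->|zz0]; last first.
    by apply: le_trans (h1 _ zz0) _; rewrite ler_peMl.
  have h z' : `|A z' - A' z'| <= rho.
    by case: (eqVneq z' z0) => [->//|/h1 ?]; apply: le_trans drho.
  by apply: le_trans (SC _ _ SA SA' h _ d0 h1) _; rewrite ler_wpM2r.
have /choice[rep repP] (c : F) : exists A, (exists2 A', S A' & code A' = c) -> S A /\ code A = c.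
  case: (pselect (exists2 A', S A' & code A' = c)) => [[A' SA' cA']|h]; first by exists A'.
  by exists [ffun=> 0].
pose D l : tensor R n * tensor R n :=
  if insub l is Some i then let A := rep (enum_val (i : 'I_#|F|)) in
     ([ffun z => A z - C' * d], [ffun z => A z + C' * d]) else ([ffun=> 0], [ffun=> 0]).
have C'd : 0 <= C' * d by rewrite mulr_ge0 // (le_trans _ C'1).
exists (fun l => (D l).1), (fun l => (D l).2); split; [|split].
- move=> l z; rewrite /D; case: insub => [i|] /=; rewrite !ffunE //.
  by lra.
- move=> A SA; exists (enum_rank (code A) : 'I_#|F|).
  rewrite /D valK enum_rankK /= => z; rewrite !ffunE.
  have [|SB cB] := repP (code A); first by exists A.
  have := codeP _ _ SA SB (esym cB) z; rewrite ler_norml => /andP[h1 h2].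
  by apply/andP; split; lra.
move=> L; apply: le_trans c1K.
pose v l : R := \prod_(z : idx n) ((D l).2 z - (D l).1 z).
have vle l : v l <= if (l < #|F|)%N then (2 * C' * d) ^+ N else 0.
  rewrite /v /D; case: insubP => [i li _|/negPf ->]; last first.
    by rewrite (bigD1 z0) //= !ffunE subr0 mul0r.
  rewrite li /= (eq_bigr (fun _ => 2 * C' * d)) ?prodr_const // => z _.
  by rewrite !ffunE; ring.
have q0 : 0 <= (2 * C' * d) ^+ N by rewrite exprn_ge0 // -mulrA mulr_ge0.
apply: (@le_trans _ _ (#|F|%:R * (2 * C' * d) ^+ N)).
  apply: le_trans (ler_sum _ (fun (l : 'I_L) _ => vle l)) _.
  by rewrite sum_lt_const ler_wpM2r // ler_nat geq_minr.
rewrite card_prod card_ord card_ffun card_ord card_sig.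
have -> : #|[pred z : idx n | z != z0]| = N.-1.
  by rewrite -(cardC1 z0); apply: eq_card => z.
rewrite natrM natrX.
apply: (@le_trans _ _ (K0.+1%:R * (2 * K%:R) ^+ N.-1 * (2 * C' * d) ^+ N)).
  rewrite ler_wpM2r // ler_wpM2l ?ler0n // lerXn2r ?nnegrE ?ler0n ?mulr_ge0 ?ler0n //.
  by rewrite -natrM ler_nat mul2n -addnn -addn1 leq_add2l.
have [m mE] : exists m, N = m.+1 by exists N.-1; rewrite prednK.
by rewrite /c1 /d mE /= box_volume ?gt_eqF.
Qed.

End Null.

(** * Tensors with an algebraically dependent coordinate *)

Lemma ex2_conj T (P Q : T -> Prop) : (exists2 x, P x & Q x) -> exists x, P x /\ Q x.
Proof. by case=> x Px Qx; exists x. Qed.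

Section Generic.
Variables (R : realType) (k : nat) (n : 'I_k -> nat).
Implicit Types (A : tensor R n).

(** Lipschitz dependence on the coordinates other than [z0], uniform on cubes; taking [d = 0] shows
    that [c] does not depend on [A z0]. *)
Definition lipz (z0 : idx n) (c : tensor R n -> R) := forall M, 0 <= M ->
  exists2 C, 0 <= C & forall A, (forall z, `|A z| <= M) -> `|c A| <= C /\
    forall A' d, 0 <= d -> (forall z, `|A' z| <= M) ->
      (forall z, z != z0 -> `|A z - A' z| <= d) -> `|c A - c A'| <= C * d.

Lemma lipz_cst z0 (c : R) : lipz z0 (fun=> c).
Proof.
move=> M M0; exists `|c| => // A AM; split=> // A' d d0 _ _.
by rewrite subrr normr0 mulr_ge0.
Qed.

Lemma lipz_var z0 z : z != z0 -> lipz z0 (fun A => A z).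
Proof.
move=> zz M M0; exists (M + 1); first by rewrite addr_ge0.
move=> A AM; split=> [|A' d d0 _ /(_ z zz) h]; first by rewrite (le_trans (AM z)) // lerDl.
by apply: le_trans h _; rewrite ler_peMl // lerDr.
Qed.

Lemma lipz_add z0 c1 c2 : lipz z0 c1 -> lipz z0 c2 -> lipz z0 (fun A => c1 A + c2 A).
Proof.
move=> h1 h2 M M0; have [C1 C10 {}h1] := h1 _ M0; have [C2 C20 {}h2] := h2 _ M0.
exists (C1 + C2); first exact: addr_ge0.
move=> A AM; have [b1 {}h1] := h1 _ AM; have [b2 {}h2] := h2 _ AM.
split=> [|A' d d0 A'M h]; first by rewrite (le_trans (ler_normD _ _)) // lerD.
rewrite opprD addrACA [leRHS]mulrDl; apply: le_trans (ler_normD _ _) _.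
by apply: lerD; [exact: h1|exact: h2].
Qed.

Lemma lipz_mul z0 c1 c2 : lipz z0 c1 -> lipz z0 c2 -> lipz z0 (fun A => c1 A * c2 A).
Proof.
move=> h1 h2 M M0; have [C1 C10 {}h1] := h1 _ M0; have [C2 C20 {}h2] := h2 _ M0.
exists (C1 * C2 + C1 * C2); first by rewrite addr_ge0 ?mulr_ge0.
move=> A AM; have [b1 {}h1] := h1 _ AM; have [b2 h2'] := h2 _ AM.
split=> [|A' d d0 A'M h].
  by rewrite normrM (@le_trans _ _ (C1 * C2)) ?ler_pM // lerDl mulr_ge0.
have [b2' _] := h2 _ A'M.
rewrite (_ : _ - _ = (c1 A - c1 A') * c2 A' + c1 A * (c2 A - c2 A')); last by ring.
rewrite [leRHS]mulrDl; apply: le_trans (ler_normD _ _) _; rewrite !normrM; apply: lerD.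
  by rewrite mulrAC ler_pM ?h1.
by rewrite -mulrA ler_pM ?h2'.
Qed.

Lemma lipz_prod z0 (I : Type) (r : seq I) (P : pred I) (F : I -> tensor R n -> R) :
  (forall i, P i -> lipz z0 (F i)) -> lipz z0 (fun A => \prod_(i <- r | P i) F i A).
Proof.
move=> hF; elim: r => [|i r IH].
  by under eq_fun do rewrite big_nil; apply: lipz_cst.
under eq_fun do rewrite big_cons.
by case Pi : (P i) => //; apply: lipz_mul => //; apply: hF.
Qed.

Lemma lipz_exp z0 c m : lipz z0 c -> lipz z0 (fun A => c A ^+ m).
Proof.
move=> h; elim: m => [|m IH]; first exact: lipz_cst.
by under eq_fun do rewrite exprS; apply: lipz_mul.
Qed.

Lemma pow_taylor (M : R) (e : nat) : 0 <= M -> exists2 C, 0 <= C & forall x h,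
  `|x| <= M -> `|x + h| <= M ->
  `|(x + h) ^+ e - x ^+ e - (x ^+ e.-1 *+ e) * h| <= C * h ^+ 2.
Proof.
move=> M0; elim: e => [|e [C C0 IH]].
  by exists 0 => // x h _ _; rewrite !expr0 mulr0n mul0r subrr subr0 normr0 mul0r.
exists (C * M + e%:R * M ^+ e.-1); first by rewrite addr_ge0 ?mulr_ge0 ?exprn_ge0.
move=> x h xM xhM.
set w := (x + h) ^+ e - x ^+ e - (x ^+ e.-1 *+ e) * h.
have -> : (x + h) ^+ e.+1 - x ^+ e.+1 - x ^+ e *+ e.+1 * h
    = w * (x + h) + (e%:R * x ^+ e.-1) * h ^+ 2.
  rewrite /w -!(mulr_natl (x ^+ _)) -(@natr1 _ e) !exprS; case: e {IH w} => [|e] /=.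
    by rewrite !expr0; ring.
  by rewrite !exprS; ring.
rewrite [leRHS]mulrDl; apply: le_trans (ler_normD _ _) _; apply: lerD.
  by rewrite normrM mulrAC ler_pM // IH.
rewrite normrM [`|h ^+ 2|]ger0_norm ?sqr_ge0 // ler_wpM2r ?sqr_ge0 //.
by rewrite normrM ger0_norm // ler_wpM2l // normrX lerXn2r // nnegrE.
Qed.

(** Bounding the entries by [m + 1] and the derivative below by [1 / (m + 1)] exhausts the set by
    countably many pieces. On each piece the linear term dominates the quadratic remainder, so the
    root is locally a Lipschitz function of the other coordinates and [null_graph] applies. *)
Lemma null_simple_root z0 (d : nat) (c : nat -> tensor R n -> R) :
  (forall e, lipz z0 (c e)) ->
  tensor_null (fun A => (\poly_(e < d) c e A).[A z0] = 0 /\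
                        (\poly_(e < d) c e A)^`().[A z0] <> 0).
Proof.
move=> hc.
pose g (m : nat) : R := m.+1%:R^-1.
apply: (@null_sub _ _ _ _ (fun A => exists m : nat, (forall z, `|A z| <= m.+1%:R) /\
  (\poly_(e < d) c e A).[A z0] = 0 /\ g m <= `|(\poly_(e < d) c e A)^`().[A z0]|)).
  move=> A [p0 /eqP p1].
  pose b := \sum_z `|A z| + `|(\poly_(e < d) c e A)^`().[A z0]|^-1.
  have b0 : 0 <= b by rewrite addr_ge0 ?sumr_ge0 ?invr_ge0.
  exists (Num.truncn b); have /andP[_ /ltW hb] := truncn_itv b0.
  split => [z|]; [|split => //].
    apply: le_trans hb; rewrite /b (bigD1 z) //= -addrA lerDl addr_ge0 ?sumr_ge0 //.
    by rewrite invr_ge0.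
  rewrite /g -[leRHS]invrK lef_pV2 ?posrE ?ltr0n ?invr_gt0 ?normr_gt0 //.
  by apply: le_trans hb; rewrite lerDr sumr_ge0.
apply: (null_bigcup z0) => m.
have M0 : 0 <= m.+1%:R :> R by [].
have /choice[C hC] := fun e => ex2_conj (hc e _ M0).
have /choice[D hD] := fun e => ex2_conj (pow_taylor e M0).
pose C1 := \sum_(e < d) C e * m.+1%:R ^+ e.
pose C2 := \sum_(e < d) C e * D e.
have C10 : 0 <= C1 by apply: sumr_ge0 => e _; rewrite mulr_ge0 ?exprn_ge0 //; case: (hC e).
have C20 : 0 <= C2.
  by apply: sumr_ge0 => e _; rewrite mulr_ge0 //; [case: (hC e)|case: (hD e)].
have g0 : 0 < g m by rewrite invr_gt0.
(* The radius is chosen so that the quadratic remainder is at most half of the linear term. *)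
apply: (@null_graph _ _ _ z0 _ m.+1%:R (2 * C1 / g m) (g m / (2 * (C2 + 1)))) => //.
- by rewrite divr_gt0 // mulr_gt0 //; lra.
- by move=> A [].
move=> A A' [AM [pA gA]] [A'M [pA' _]] hr dd dd0 hd.
set x := A z0; set h := A' z0 - A z0.
have xh : x + h = A' z0 by rewrite /x /h addrC subrK.
have hh : `|h| <= g m / (2 * (C2 + 1)) by rewrite /h distrC.
rewrite distrC -/h.
have e1 : `|(\poly_(e < d) c e A).[x + h] - (\poly_(e < d) c e A).[x]
    - (\poly_(e < d) c e A)^`().[x] * h| <= C2 * h ^+ 2.
  rewrite {3}poly_def raddf_sum /= horner_sum !horner_poly mulr_suml -!sumrB mulr_suml.
  apply: le_trans (ler_norm_sum _ _ _) _; apply: ler_sum => e _.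
  rewrite derivZ derivXn hornerZ hornerMn hornerXn.
  rewrite (_ : _ - _ = c e A * ((x + h) ^+ e - x ^+ e - x ^+ e.-1 *+ e * h)); last first.
    by rewrite !mulrBr !mulrA.
  rewrite normrM -mulrA.
  have [? /(_ _ AM)[? _]] := hC e; have [_ hD'] := hD e.
  by apply: ler_pM => //; apply: hD'; [exact: AM|rewrite xh; exact: A'M].
have e2 : `|(\poly_(e < d) c e A).[x + h] - (\poly_(e < d) c e A').[x + h]| <= C1 * dd.
  rewrite !horner_poly -sumrB mulr_suml.
  apply: le_trans (ler_norm_sum _ _ _) _; apply: ler_sum => e _.
  rewrite -mulrBl normrM mulrAC; have [Ce0 /(_ _ AM)[_ hce]] := hC e.
  by apply: ler_pM => //; [exact: hce|rewrite normrX lerXn2r ?nnegrE // xh; exact: A'M].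
have pAh : (\poly_(e < d) c e A').[x + h] = 0 by rewrite xh.
move: e1 e2; rewrite pAh pA !subr0.
set p := (\poly_(e < d) c e A).[x + h]; set q := (\poly_(e < d) c e A)^`().[x] => e1 e2.
have e3 : g m * `|h| <= C1 * dd + C2 * h ^+ 2.
  apply: (@le_trans _ _ (`|q * h|)); first by rewrite normrM ler_wpM2r.
  rewrite (_ : q * h = p - (p - q * h)); last by ring.
  by apply: le_trans (ler_normB _ _) _; apply: lerD.
have e4 : C2 * h ^+ 2 <= g m / 2 * `|h|.
  rewrite -[h ^+ 2]ger0_norm ?sqr_ge0 // normrX expr2 mulrA ler_wpM2r //.
  apply: le_trans (ler_wpM2l C20 hh) _.
  rewrite mulrA ler_pdivrMr; last by lra.
  rewrite (_ : g m / 2 * _ = g m * (C2 + 1)); last by field.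
  by rewrite mulrC ler_pM2l //; lra.
rewrite mulrAC ler_pdivlMr //; lra.
Qed.

Section Ev.
Variable z0 : idx n.
(** Integer polynomials in the coordinates other than [z0], as lists of monomials: this type is
    countable, and list operations realise the ring operations. *)
Definition ev (l : seq (int * {ffun idx n -> nat})) A : R :=
  \sum_(p <- l) p.1%:~R * \prod_(z | z != z0) A z ^+ p.2 z.

Lemma lipz_ev l : lipz z0 (ev l).
Proof.
elim: l => [|p l IH]; rewrite /ev.
  by under eq_fun do rewrite big_nil; apply: lipz_cst.
under eq_fun do rewrite big_cons.
apply: lipz_add => //; apply: lipz_mul; first exact: lipz_cst.
by apply: lipz_prod => z zz; apply: lipz_exp; apply: lipz_var.
Qed.

Lemma ev0 A : ev [::] A = 0. Proof. by rewrite /ev big_nil. Qed.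

Lemma ev1 A : ev [:: (1, [ffun=> 0%N])] A = 1.
Proof. by rewrite /ev big_seq1 mul1r big1 // => z _; rewrite ffunE expr0. Qed.

Lemma evX A z : z != z0 -> ev [:: (1, [ffun z' => (z' == z) : nat])] A = A z.
Proof.
move=> zz; rewrite /ev big_seq1 mul1r (bigD1 z) //= ffunE eqxx expr1 big1 ?mulr1 //.
by move=> z' /andP[_ /negPf h]; rewrite ffunE h expr0.
Qed.

Lemma evD l1 l2 A : ev (l1 ++ l2) A = ev l1 A + ev l2 A.
Proof. by rewrite /ev big_cat. Qed.

Definition oppm (p : int * {ffun idx n -> nat}) : int * {ffun idx n -> nat} := (- p.1, p.2).

Lemma evN l A : ev [seq oppm p | p <- l] A = - ev l A.
Proof. by rewrite /ev big_map -sumrN; apply: eq_bigr => p _; rewrite /= intrN mulNr. Qed.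

Definition mulm (p q : int * {ffun idx n -> nat}) : int * {ffun idx n -> nat} :=
  (p.1 * q.1, [ffun z => (p.2 z + q.2 z)%N]).

Lemma evM l1 l2 A : ev [seq mulm p q | p <- l1, q <- l2] A = ev l1 A * ev l2 A.
Proof.
rewrite /ev big_allpairs_dep mulr_suml; apply: eq_bigr => p _.
rewrite mulr_sumr; apply: eq_bigr => q _ /=.
rewrite intrM mulrACA -big_split /=; congr (_ * _).
by apply: eq_bigr => z _; rewrite ffunE exprD.
Qed.

Definition pol ll A : {poly R} := \poly_(e < size ll) ev (nth [::] ll e) A.

(** A multiple root is a simple root of the derivative just before the first nonvanishing one, and
    there are only countably many orders of derivation. *)
Lemma null_root ll : tensor_null (fun A => pol ll A != 0 /\ root (pol ll A) (A z0)).
Proof.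
pose c q e A := ev (nth [::] ll (q + e)) A *+ (q + e) ^_ q.
have derE q A : (pol ll A)^`(q) = \poly_(e < size ll) c q e A.
  apply/polyP => e; rewrite coef_derivn !coef_poly /c.
  case: ltnP => h1; case: ltnP => h2 //; rewrite ?mul0rn //; first by lia.
  by rewrite nth_default // ev0 mul0rn.
apply: (@null_sub _ _ _ _ (fun A => exists q, (\poly_(e < size ll) c q e A).[A z0] = 0 /\
                        (\poly_(e < size ll) c q e A)^`().[A z0] <> 0)).
  move=> A [p0 /rootP r0]; set p := pol ll A in p0 r0.
  have ex : exists q, p^`(q).[A z0] != 0.
    exists (size p).-1.
    have -> : p^`((size p).-1) = (lead_coef p *+ ((size p).-1)`!)%:P.
      apply/polyP => i; rewrite coef_derivn coefC; case: i => [|i].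
        by rewrite addn0 ffactnn lead_coefE.
      by rewrite nth_default ?mul0rn // addnS; case: (size p) => // m; rewrite ltnS leq_addr.
    by rewrite hornerC mulrn_eq0 negb_or -lt0n fact_gt0 lead_coef_eq0.
  case: (ex_minnP ex) => q; case: q => [|q]; first by rewrite derivn0 r0 eqxx.
  move=> hq qmin; exists q; rewrite -derE -/p; split.
    by apply/eqP/negPn/negP => /qmin; rewrite ltnn.
  by apply/eqP; rewrite -derivnS.
apply: (null_bigcup z0) => q; apply: null_simple_root => e.
have -> : c q e = fun A => ((q + e) ^_ q)%:R * ev (nth [::] ll (q + e)) A.
  by apply/funext => A; rewrite mulr_natl.
by apply: lipz_mul; [exact: lipz_cst|exact: lipz_ev].
Qed.

End Ev.

(* A coordinate of the tensor is algebraic over the field generated by the others. *)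
Definition special A := exists z0 ll, pol z0 ll A != 0 /\ root (pol z0 ll A) (A z0).

Lemma null_special (z0 : idx n) : tensor_null special.
Proof.
apply: (@null_sub _ _ _ _ (fun A => exists i : idx n * seq (seq (int * {ffun idx n -> nat})),
  pol i.1 i.2 A != 0 /\ root (pol i.1 i.2 A) (A i.1))).
  by move=> A [z [ll h]]; exists (z, ll).
apply: (null_bigcup_count z0) => -[z ll]; exact: null_root.
Qed.

End Generic.

(** * Derivations of the real field *)

Definition derivation (R : nzRingType) (d : R -> R) : Prop :=
  (forall x y, d (x + y) = d x + d y) /\ (forall x y, d (x * y) = d x * y + x * d y).

Section Extend.
Variable R : realType.
Implicit Types (G : set (R * R)).

(* [G (x, y)] reads [y = d x] for a derivation [d] defined on a subfield. *)
Definition dgraph G : Prop :=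
  [/\ G (1, 0),
      forall x y, G x -> G y -> G (x.1 - y.1, x.2 - y.2),
      forall x y, G x -> G y -> G (x.1 * y.1, x.2 * y.1 + x.1 * y.2),
      forall x, G x -> x.1 != 0 -> G (x.1^-1, - x.2 / x.1 ^+ 2) &
      forall x', G (0, x') -> x' = 0].

Section One.
Variable (G : set (R * R)) (hG : dgraph G).

Let G1 : G (1, 0). Proof. by case: hG. Qed.
Let GB x y : G x -> G y -> G (x.1 - y.1, x.2 - y.2). Proof. by case: hG => _ + _ _ _; apply. Qed.
Let GM x y : G x -> G y -> G (x.1 * y.1, x.2 * y.1 + x.1 * y.2).
Proof. by case: hG => _ _ + _ _; apply. Qed.
Let GV x : G x -> x.1 != 0 -> G (x.1^-1, - x.2 / x.1 ^+ 2).
Proof. by case: hG => _ _ _ + _; apply. Qed.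
Let GF x' : G (0, x') -> x' = 0. Proof. by case: hG => _ _ _ _; apply. Qed.

Let G0 : G (0, 0). Proof. by have := GB G1 G1; rewrite /= !subrr. Qed.
Let GN x : G x -> G (- x.1, - x.2). Proof. by move=> /(GB G0); rewrite /= !sub0r. Qed.
Let GD x y : G x -> G y -> G (x.1 + y.1, x.2 + y.2).
Proof. by move=> hx /GN hy; have := GB hx hy; rewrite /= !opprK. Qed.

Definition dpoly (p q : {poly R}) := forall i, G (p`_i, q`_i).

Let dpolyB p p' q q' : dpoly p p' -> dpoly q q' -> dpoly (p - q) (p' - q').
Proof. by move=> hp hq i; have := GB (hp i) (hq i); rewrite !coefB. Qed.

Let dpolyM p p' q q' : dpoly p p' -> dpoly q q' -> dpoly (p * q) (p' * q + p * q').
Proof.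
move=> hp hq i; rewrite coefD !coefM -big_split /=.
elim/big_ind2: _ => //= [x x' y y' h1 h2|j _]; first exact: GD h1 h2.
exact: GM (hp j) (hq (i - j)%N).
Qed.

Let dpolyZX (a a' : R) m : G (a, a') -> dpoly (a *: 'X^m) (a' *: 'X^m).
Proof.
move=> h i; rewrite !coefZ coefXn; case: eqP => _; last by rewrite !mulr0.
by rewrite !mulr1.
Qed.

Let dpolyC (a a' : R) : G (a, a') -> dpoly a%:P a'%:P.
Proof. by move=> /(@dpolyZX _ _ 0); rewrite expr0 !alg_polyC. Qed.

Let dpoly_deriv p p' : dpoly p p' -> dpoly p^`() p'^`().
Proof.
move=> h i; rewrite !coef_deriv; elim: {2 4}i => [|j IH]; first exact: h.
by rewrite !(mulrSr _ j.+1); exact: GD IH (h _).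
Qed.

Variable y : R.
(** With [p'] the coefficientwise derivative of [p], this is the value that the derivative of
    [p.[y]] must take if [y] has derivative [c]; [kerD c] says that this choice is consistent. *)
Let D (c : R) (p p' : {poly R}) := p'.[y] + p^`().[y] * c.
Let kerD c := forall p p', dpoly p p' -> p.[y] = 0 -> D c p p' = 0.

Let D_mul c p p' q q' :
  D c (p * q) (p' * q + p * q') = D c p p' * q.[y] + p.[y] * D c q q'.
Proof. by rewrite /D derivM !hornerE; ring. Qed.

Let D_sub c p p' q q' : D c (p - q) (p' - q') = D c p p' - D c q q'.
Proof. by rewrite /D derivB !hornerE; ring. Qed.

(** The quotient rule on fractions [p.[y] / q.[y]] defines the extension to the field generated by
    [y]; [kerD c] provides single-valuedness at 0. *)
Let dext c : kerD c -> exists G', [/\ dgraph G', (G `<=` G')%classic & G' (y, c)].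
Proof.
move=> hc.
pose G' : set (R * R) := fun x => exists p p' q q', [/\ dpoly p p', dpoly q q', q.[y] != 0,
  x.1 = p.[y] / q.[y] & x.2 = (D c p p' * q.[y] - p.[y] * D c q q') / q.[y] ^+ 2].
have d1 : dpoly 1 0 by move=> i; have := dpolyC G1 i; rewrite polyC0 polyC1.
have D1 : D c 1 0 = 0 by rewrite /D -polyC1 derivC !hornerE.
exists G'; split.
- split.
  + by exists 1, 0, 1, 0; rewrite D1 !hornerE oner_eq0; split => //=; field.
  + move=> [x x'] [z z'] [p [p' [q [q' [hp hq qy /= -> ->]]]]] [r [r' [s [s' [hr hs sy /= -> ->]]]]].
    exists (p * s - r * q), ((p' * s + p * s') - (r' * q + r * q')), (q * s), (q' * s + q * s').
    split => /=; [by apply: dpolyB; apply: dpolyM|exact: dpolyM| | |].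
    * by rewrite hornerM mulf_neq0.
    * by rewrite !hornerE; field; rewrite qy sy.
    * rewrite D_sub !D_mul !hornerM hornerD hornerN !hornerM.
      move: (D c p p') (D c q q') (D c r r') (D c s s') => dp dq dr ds.
      by field; rewrite qy sy.
  + move=> [x x'] [z z'] [p [p' [q [q' [hp hq qy /= -> ->]]]]] [r [r' [s [s' [hr hs sy /= -> ->]]]]].
    exists (p * r), (p' * r + p * r'), (q * s), (q' * s + q * s').
    split => /=; [exact: dpolyM|exact: dpolyM| | |].
    * by rewrite hornerM mulf_neq0.
    * by rewrite !hornerM; field; rewrite qy sy.
    * rewrite !D_mul !hornerM.
      move: (D c p p') (D c q q') (D c r r') (D c s s') => dp dq dr ds.
      by field; rewrite qy sy.
  + move=> [x x'] [p [p' [q [q' [hp hq qy /= -> ->]]]]] xy.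
    have py : p.[y] != 0 by apply: contraNneq xy => ->; rewrite mul0r.
    exists q, q', p, p'; split => //=; first by rewrite invf_div.
    move: (D c p p') (D c q q') => dp dq.
    by field; rewrite py qy.
  + move=> x' [p [p' [q [q' [hp hq qy /= /esym/eqP + ->]]]]].
    rewrite mulf_eq0 invr_eq0 (negPf qy) orbF => /eqP py.
    by rewrite (hc _ _ hp py) py !mul0r subrr mul0r.
- move=> [x x'] hx; exists x%:P, x'%:P, 1, 0; rewrite D1 /D derivC !hornerE oner_eq0.
  by split => //=; [exact: dpolyC|field|field].
- exists 'X, 0, 1, 0; rewrite D1 /D derivX !hornerE oner_eq0; split => //=; [|by field|by field].
  by move=> i; rewrite coefX coef0; case: eqP.
Qed.

Lemma dgraph_ext_trans c : (forall p p', dpoly p p' -> p.[y] = 0 -> p = 0) ->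
  exists G', [/\ dgraph G', (G `<=` G')%classic & G' (y, c)].
Proof.
move=> htr; apply: dext => p p' hp /(htr _ _ hp) p0.
rewrite /D p0 deriv0 !hornerE.
have -> : p' = 0 by apply/polyP => i; rewrite coef0; apply: GF; have := hp i; rewrite p0 coef0.
by rewrite horner0.
Qed.

(** If [y] is algebraic, [c] is forced by differentiating a vanishing polynomial [p] of least
    degree; its formal derivative does not vanish at [y], by minimality and characteristic 0.
    Cancelling leading terms with multiples of [p] carries consistency to every polynomial vanishing
    at [y]. *)
Lemma dgraph_ext : exists c G', [/\ dgraph G', (G `<=` G')%classic & G' (y, c)].
Proof.
case: (pselect (forall p p', dpoly p p' -> p.[y] = 0 -> p = 0)) => [h|].
  by exists 0; apply: dgraph_ext_trans.
move=> hn.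
have ex : exists m, `[< exists p p', [/\ dpoly p p', p.[y] = 0, p != 0 & size p = m] >].
  apply/not_existsP => h; apply: hn => p p' hp py; apply/eqP/negPn/negP => p0.
  by apply: (h (size p)); apply/asboolP; exists p, p'.
case: (ex_minnP ex) => m /asboolP[p [p' [hp py p0 sp]]] pmin.
have pm q q' : dpoly q q' -> q.[y] = 0 -> (size q < m)%N -> q = 0.
  move=> hq qy sq; apply/eqP/negPn/negP => q0; move: sq; rewrite ltnNge => /negP; apply.
  by apply: pmin; apply/asboolP; exists q, q'.
have p1 : p^`().[y] != 0.
  apply/negP => /eqP dpy.
  have sp1 : (1 < size p)%N.
    rewrite ltnNge; apply/negP => /size1_polyC pC; move: py p0.
    by rewrite pC hornerC polyC_eq0 => ->; rewrite eqxx.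
  have := pm _ _ (dpoly_deriv hp) dpy; rewrite -sp lt_size_deriv // => /(_ isT).
  move=> /polyP/(_ (size p).-2); rewrite coef_deriv coef0 => /eqP.
  by rewrite mulrn_eq0 /= prednK ?ltn_predRL // -lead_coefE lead_coef_eq0 (negPf p0).
pose c := - p'.[y] / p^`().[y].
have Dp : D c p p' = 0 by rewrite /D /c; field.
exists c; apply: dext => q q' hq qy.
have [N] := ubnP (size q); elim: N q q' hq qy => // N IH q q' hq qy sq.
have [q0|q0] := eqVneq q 0.
  have -> : q' = 0 by apply/polyP => i; rewrite coef0; apply: GF; have := hq i; rewrite q0 coef0.
  by rewrite /D q0 deriv0 !hornerE.
have sqp : (size p <= size q)%N.
  by rewrite leqNgt; apply/negP; rewrite sp => /(pm _ _ hq qy)/eqP; rewrite (negPf q0).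
have lp : lead_coef p != 0 by rewrite lead_coef_eq0.
have [a' ha] : exists a', G (lead_coef q / lead_coef p, a').
  have h1 := hq (size q).-1; have h2 := GV (hp (size p).-1).
  by have := GM h1 (h2 _); rewrite /= -!lead_coefE => /(_ lp) h; eexists; exact: h.
have := dpolyZX (size q - size p) ha.
set M := _ *: 'X^_; set M' := _ *: 'X^_ => hM.
have hr := dpolyB hq (dpolyM hM hp).
have ry : (q - M * p).[y] = 0 by rewrite hornerD hornerN hornerM qy py mulr0 subrr.
suff sr : (size (q - M * p)%R < size q)%N.
  have := IH _ _ hr ry (leq_trans sr _); rewrite D_sub D_mul py Dp !mulr0 addr0 subr0.
  by apply; rewrite -ltnS.
have q1 : (0 < size q)%N by rewrite size_poly_gt0.
rewrite -[X in (_ < X)%N](prednK q1) ltnS; apply/leq_sizeP => j hj.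
rewrite coefB /M -scalerAl coefZ coefXnM.
have [->|jq] := eqVneq j (size q).-1.
  have p2 : (0 < size p)%N by rewrite size_poly_gt0.
  rewrite ifF; last by lia.
  rewrite (_ : (_ - _)%N = (size p).-1); last by lia.
  by rewrite -!lead_coefE; field.
have hj' : (size q <= j)%N by rewrite -(prednK q1) ltn_neqAle eq_sym jq hj.
rewrite [q`_j]nth_default //.
case: ltnP => hs; first by rewrite mulr0 subr0.
rewrite nth_default ?mulr0 ?subr0 // leq_subRL //.
by rewrite subnK.
Qed.

End One.

Lemma dgraph_total G : dgraph G -> exists2 d, derivation d & forall x, G x -> d x.1 = x.2.
Proof.
move=> hG.
(* The disjunct [H = set0] is there for the empty chain, whose union is empty. *)
pose P (H : set (R * R)) := (G `|` H)%classic = H /\ dgraph H \/ H = set0.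
have [H [PH maxH]] : exists A, P A /\ forall B, (A `<` B)%classic -> ~ P B.
  apply: Zorn_bigcup => F FP Ftot.
  case: (pselect (exists2 X, F X & X <> set0)) => [[X FX X0]|nX]; last first.
    right; rewrite -subset0 => x [X FX Xx]; have [[h _]|] := FP _ FX; last by move=> h; rewrite -h.
    by apply: nX; exists X => // X0; move: Xx; rewrite X0.
  have FP' Y y : F Y -> Y y -> dgraph Y.
    by move=> FY Yy; have [[_ //]|Y0] := FP _ FY; move: Yy; rewrite Y0.
  have two x y : (\bigcup_(X in F) X)%classic x -> (\bigcup_(X in F) X)%classic y ->
      exists Y, [/\ F Y, Y x & Y y].
    move=> [Y FY Yx] [Z FZ Zy]; have [YZ|ZY] := Ftot _ _ FY FZ.
      by exists Z; split => //; apply: YZ.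
    by exists Y; split => //; apply: ZY.
  have [[GX dX]|//] := FP _ FX.
  left; split.
    apply/seteqP; split => x; last by right.
    by case=> // Gx; exists X => //; rewrite -GX; left.
  split.
  - by exists X => //; case: dX.
  - move=> x y hx hy; have [Y [FY Yx Yy]] := two _ _ hx hy; exists Y => //.
    by case: (FP' _ _ FY Yx) => _ + _ _ _; apply.
  - move=> x y hx hy; have [Y [FY Yx Yy]] := two _ _ hx hy; exists Y => //.
    by case: (FP' _ _ FY Yx) => _ _ + _ _; apply.
  - move=> x [Y FY Yx] x0; exists Y => //.
    by case: (FP' _ _ FY Yx) => _ _ _ + _; apply.
  - by move=> x [Y FY Yx]; case: (FP' _ _ FY Yx) => _ _ _ _; apply.
have [GH dH] : (G `<=` H)%classic /\ dgraph H.
  case: PH => [[GH dH]|H0]; first by split => // x Gx; rewrite -GH; left.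
  have PG : P G by left; rewrite setUid.
  case: (maxH _ _ PG); rewrite H0; split; first by move=> x [].
  by move=> h; have [/h] := hG.
have tot y : exists c, H (y, c).
  have [c [H' [dH' HH' H'y]]] := dgraph_ext dH y.
  exists c; apply: contrapT => Hy; apply: (maxH H'); last first.
    left; split => //; apply/seteqP; split => x; last by right.
    by case=> // /GH/HH'.
  by split => // /(_ _ H'y).
have [d hd] := choice tot.
case: (dH) => _ HB HM _ HF.
have uniq x a b : H (x, a) -> H (x, b) -> a = b.
  by move=> ha hb; apply/eqP; rewrite -subr_eq0; apply/eqP/HF; have := HB _ _ ha hb; rewrite /= subrr.
have h0 : d 0 = 0 by exact/HF/hd.
have hN y : d (- y) = - d y.
  apply: uniq (hd _) _; have := HB _ _ (hd 0) (hd y); by rewrite /= h0 !sub0r.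
exists d; last by move=> [x x'] Gx /=; apply: uniq (hd _) (GH _ Gx).
split=> x y.
  by apply: uniq (hd _) _; have := HB _ _ (hd x) (hd (- y)); rewrite /= hN !opprK.
by apply: uniq (hd _) _; exact: HM (hd x) (hd y).
Qed.

End Extend.

Section Generic.
Variables (R : realType) (k : nat) (n : 'I_k -> nat).
Implicit Types (A : tensor R n).

Lemma derivation_coord A (z0 : idx n) : ~ special A ->
  exists2 d, derivation d & forall z, d (A z) = (z == z0)%:R.
Proof.
move=> gA.
(* The zero derivation on the field generated by the coordinates other than [z0], written as
   fractions of integer polynomials. *)
pose G : set (R * R) := fun x => x.2 = 0 /\
  exists l1 l2, ev z0 l2 A != 0 /\ x.1 = ev z0 l1 A / ev z0 l2 A.
have hG : dgraph G.
  split.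
  - by split=> //; exists [:: (1, [ffun=> 0%N])], [:: (1, [ffun=> 0%N])]; rewrite !ev1 oner_eq0 divr1.
  - move=> [x x'] [y y'] [/= -> [l1 [l2 [n2 ->]]]] [/= -> [m1 [m2 [k2 ->]]]].
    split; first exact: subrr.
    exists ([seq mulm p q | p <- l1, q <- m2] ++ [seq oppm p | p <- [seq mulm p q | p <- m1, q <- l2]]),
      [seq mulm p q | p <- l2, q <- m2].
    by rewrite evD evN !evM mulf_neq0 //; split => //=; field; rewrite n2 k2.
  - move=> [x x'] [y y'] [/= -> [l1 [l2 [n2 ->]]]] [/= -> [m1 [m2 [k2 ->]]]].
    split; first by rewrite mul0r mulr0 addr0.
    exists [seq mulm p q | p <- l1, q <- m1], [seq mulm p q | p <- l2, q <- m2].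
    by rewrite !evM mulf_neq0 //; split => //=; field; rewrite n2 k2.
  - move=> [x x'] [/= -> [l1 [l2 [n2 ->]]]] x0; split; first by rewrite oppr0 mul0r.
    exists l2, l1; rewrite invf_div; split => //.
    by apply: contraNneq x0 => ->; rewrite mul0r.
  - by move=> x' [].
have trans p p' : dpoly G p p' -> p.[A z0] = 0 -> p = 0.
  move=> hp py; apply/eqP/negPn/negP => p0; apply: gA; exists z0.
  (* Clearing denominators: a common denominator [L] turns [p] into a polynomial whose coefficients
     are values of [ev], which would make [A] special. *)
  have [L L0 [ll Lp]] : exists2 L, ev z0 L A != 0 &
      exists ll, forall i, (i < size p)%N -> p`_i * ev z0 L A = ev z0 (nth [::] ll i) A.
    elim: (size p) => [|m [L L0 [ll hL]]].
      by exists [:: (1, [ffun=> 0%N])]; rewrite ?ev1 ?oner_eq0 //; exists [::].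
    have [/= _ [l1 [l2 [n2 pE]]]] := hp m.
    exists [seq mulm p q | p <- L, q <- l2]; first by rewrite evM mulf_neq0.
    exists (mkseq (fun i => if (i < m)%N then [seq mulm p q | p <- nth [::] ll i, q <- l2]
                       else [seq mulm p q | p <- l1, q <- L]) m.+1).
    move=> i im; rewrite nth_mkseq // evM mulrA; case: ltnP => h; first by rewrite hL // evM.
    have -> : i = m by lia.
    by rewrite evM pE; field.
  exists (take (size p) (ll ++ nseq (size p) [::])).
  have E : pol z0 (take (size p) (ll ++ nseq (size p) [::])) A = ev z0 L A *: p.
    apply/polyP => i; rewrite coefZ coef_poly size_take size_cat size_nseq.
    rewrite (_ : (if _ then _ else _) = size p); last by case: ltnP; lia.
    case: ltnP => h; last by rewrite [p`_i]nth_default // mulr0.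
    rewrite mulrC Lp // nth_take // nth_cat; case: ltnP => // h'.
    by rewrite nth_nseq; case: ltnP => _; rewrite ?ev0 // nth_default // ev0.
  by rewrite E scaler_eq0 negb_or L0 p0 /root hornerZ py mulr0.
have [G1 [hG1 GG1 G1y]] := dgraph_ext_trans hG 1 trans.
have [d dd dG] := dgraph_total hG1.
exists d => // z; case: eqVneq => [->|zz]; first exact: dG G1y.
apply: (dG (A z, 0)); apply: GG1; split => //=.
exists [:: (1, [ffun z' => (z' == z) : nat])], [:: (1, [ffun=> 0%N])].
by rewrite evX // ev1 oner_eq0 divr1.
Qed.

(* For a generic tensor the derivations of the real field realize every tangent
   direction [a], so polynomial identities satisfied by [A] may be differentiated. *)
Lemma derivation_family A : ~ special A ->
  exists d : tensor R n -> R -> R, [/\ forall a, derivation (d a), forall a z, d a (A z) = a z &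
    forall c (a b : tensor R n) x, d [ffun z => c * a z + b z] x = c * d a x + d b x].
Proof.
move=> gA; have [e he] := choice (fun z => ex2_conj (derivation_coord z gA)).
exists (fun a x => \sum_z a z * e z x); split.
- move=> a; split=> x y.
    by rewrite -big_split /=; apply: eq_bigr => z _; have [[-> _] _] := he z; rewrite mulrDr.
  rewrite mulr_suml mulr_sumr -big_split /=; apply: eq_bigr => z _.
  by have [[_ ->] _] := he z; ring.
- move=> a z; rewrite (bigD1 z) //= big1 ?addr0; last first.
    by move=> z' zz; have [_ ->] := he z'; rewrite eq_sym (negPf zz) mulr0.
  by have [_ ->] := he z; rewrite eqxx mulr1.
- move=> c a b x; rewrite mulr_sumr -big_split; apply: eq_bigr => z _ /=.
  by rewrite ffunE; ring.
Qed.
End Generic.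

(** * Multilinear forms and their derivatives *)

Section Frobenius.
Variable R : realType.

Definition ip m (u v : 'cV[R]_m) : R := \sum_a u a ord0 * v a ord0.

Lemma ipC m (u v : 'cV[R]_m) : ip u v = ip v u.
Proof. by apply: eq_bigr => a _; rewrite mulrC. Qed.

Lemma ipDl m (u v w : 'cV[R]_m) : ip (u + v) w = ip u w + ip v w.
Proof. by rewrite -big_split; apply: eq_bigr => a _; rewrite mxE mulrDl. Qed.

Lemma ipZl m c (u w : 'cV[R]_m) : ip (c *: u) w = c * ip u w.
Proof. by rewrite mulr_sumr; apply: eq_bigr => a _; rewrite mxE mulrA. Qed.

Lemma ipDr m (u v w : 'cV[R]_m) : ip u (v + w) = ip u v + ip u w.
Proof. by rewrite ipC ipDl !(ipC u). Qed.

Lemma ipZr m c (u w : 'cV[R]_m) : ip u (c *: w) = c * ip u w.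
Proof. by rewrite ipC ipZl ipC. Qed.

Lemma ipNl m (u w : 'cV[R]_m) : ip (- u) w = - ip u w.
Proof. by rewrite -scaleN1r ipZl mulN1r. Qed.

Lemma ipNr m (u w : 'cV[R]_m) : ip u (- w) = - ip u w.
Proof. by rewrite -scaleN1r ipZr mulN1r. Qed.

Lemma ip0l m (w : 'cV[R]_m) : ip 0 w = 0.
Proof. by rewrite -(scale0r 0) ipZl mul0r. Qed.

Lemma ip0r m (w : 'cV[R]_m) : ip w 0 = 0.
Proof. by rewrite ipC ip0l. Qed.

Lemma ip_ge0 m (u : 'cV[R]_m) : 0 <= ip u u.
Proof. by apply: sumr_ge0 => a _; rewrite -expr2 sqr_ge0. Qed.

Lemma ip_eq0 m (u : 'cV[R]_m) : ip u u = 0 -> u = 0.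
Proof.
move=> /eqP; rewrite psumr_eq0 => [/allP h|a _]; last by rewrite -expr2 sqr_ge0.
apply/matrixP => a b; rewrite ord1 mxE; have := h a (mem_index_enum _).
by rewrite -expr2 sqrf_eq0 => /eqP.
Qed.

Lemma ipE m (u v : 'cV[R]_m) : u^T *m v = (ip u v)%:M.
Proof.
apply/matrixP => a b; rewrite !ord1 !mxE /= mulr1n; apply: eq_bigr => c _; by rewrite !mxE.
Qed.

Lemma vnorm_ip m (u : 'cV[R]_m) : vnorm u = Num.sqrt (ip u u).
Proof. by congr Num.sqrt; apply: eq_bigr => a _; rewrite expr2. Qed.

Lemma vnorm1 m (u : 'cV[R]_m) : vnorm u = 1 <-> ip u u = 1.
Proof.
rewrite vnorm_ip; split=> [h|->]; last exact: sqrtr1.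
by rewrite -[LHS]sqr_sqrtr ?ip_ge0 // h expr1n.
Qed.

Lemma unit_parallel m (u v : 'cV[R]_m) : ip u u = 1 -> ip v v = 1 ->
  ip u v ^+ 2 = 1 -> u = ip u v *: v.
Proof.
move=> hu hv h; apply/eqP; rewrite -subr_eq0; apply/eqP/ip_eq0.
rewrite !(ipDl, ipDr, ipNl, ipNr, ipZl, ipZr) (ipC v u) hu hv.
move: h; rewrite expr2; lra.
Qed.

Lemma ip_unit_le1 m (u v : 'cV[R]_m) : ip u u = 1 -> ip v v = 1 -> ip u v ^+ 2 <= 1.
Proof.
move=> hu hv; have := ip_ge0 (u - ip u v *: v).
rewrite !(ipDl, ipDr, ipNl, ipNr, ipZl, ipZr) (ipC v u) hu hv expr2; lra.
Qed.

Definition mip m t (M N : 'M[R]_(m, t)) : R := \tr (M^T *m N).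

Lemma mip_col m t (M N : 'M[R]_(m, t)) : mip M N = \sum_j ip (col j M) (col j N).
Proof.
by apply: eq_bigr => j _; rewrite mxE; apply: eq_bigr => a _; rewrite !mxE.
Qed.

Lemma mipDl m t (M M' N : 'M[R]_(m, t)) : mip (M + M') N = mip M N + mip M' N.
Proof. by rewrite /mip linearD mulmxDl mxtraceD. Qed.

Lemma mipZl m t c (M N : 'M[R]_(m, t)) : mip (c *: M) N = c * mip M N.
Proof. by rewrite /mip linearZ -scalemxAl mxtraceZ. Qed.

Lemma mipC m t (M N : 'M[R]_(m, t)) : mip M N = mip N M.
Proof. by rewrite /mip -mxtrace_tr trmx_mul trmxK. Qed.

Lemma mipDr m t (M N N' : 'M[R]_(m, t)) : mip M (N + N') = mip M N + mip M N'.
Proof. by rewrite mipC mipDl !(mipC _ M). Qed.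

Lemma mipZr m t c (M N : 'M[R]_(m, t)) : mip M (c *: N) = c * mip M N.
Proof. by rewrite mipC mipZl mipC. Qed.

Lemma mipNl m t (M N : 'M[R]_(m, t)) : mip (- M) N = - mip M N.
Proof. by rewrite -scaleN1r mipZl mulN1r. Qed.

Lemma mipNr m t (M N : 'M[R]_(m, t)) : mip M (- N) = - mip M N.
Proof. by rewrite mipC mipNl mipC. Qed.

Lemma mip_ge0 m t (M : 'M[R]_(m, t)) : 0 <= mip M M.
Proof. by rewrite mip_col; apply: sumr_ge0 => j _; apply: ip_ge0. Qed.

Lemma mip_mulr m t (M : 'M[R]_(m, t)) (P : 'M[R]_t) (N : 'M[R]_(m, t)) :
  mip (M *m P) N = \tr (P^T *m (M^T *m N)).
Proof. by rewrite /mip trmx_mul mulmxA. Qed.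

Lemma tr_sym_skew t (P S : 'M[R]_t) : P^T = P -> S + S^T = 0 -> \tr (P *m S) = 0.
Proof.
move=> hP /eqP; rewrite addr_eq0 => /eqP hS.
have h : \tr (P *m S) = - \tr (P *m S).
  by rewrite -{1}mxtrace_tr trmx_mul hP mxtrace_mulC {2}hS mulmxN raddfN opprK.
by apply/eqP; rewrite -[_ == 0](mulrn_eq0 _ 2) mulr2n {2}h subrr.
Qed.

Lemma tr_diag_mul t (p : 'rV[R]_t) (S : 'M[R]_t) :
  \tr (diag_mx p *m S) = \sum_j p ord0 j * S j j.
Proof. by apply: eq_bigr => j _; rewrite mul_diag_mx mxE. Qed.

End Frobenius.

Section Multilinear.
Variables (R : realType) (k : nat) (n : 'I_k -> nat).
Implicit Types (A a : tensor R n) (x y h : vfam R n).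

Definition rep x h (i : 'I_k) : vfam R n := fun l => if l == i then h l else x l.
Definition rho x : tensor R n := [ffun z : idx n => \prod_l x l (z l) ord0].

Lemma rep_same x h i : rep x h i i = h i. Proof. by rewrite /rep eqxx. Qed.
Lemma rep_other x h i l : l != i -> rep x h i l = x l.
Proof. by rewrite /rep => /negPf ->. Qed.

Lemma rho_ext x y : (forall l, x l = y l) -> rho x = rho y.
Proof. by move=> h; apply/ffunP => z; rewrite !ffunE; apply: eq_bigr => l _; rewrite h. Qed.

Lemma AtauE A x : Atau A x = \sum_z A z * rho x z.
Proof. by apply: eq_bigr => z _; rewrite ffunE. Qed.

Lemma Atau_ext A x y : (forall l, x l = y l) -> Atau A x = Atau A y.
Proof. by move=> h; rewrite !AtauE (rho_ext h). Qed.

Lemma Atau_i_ext A x y i : (forall l, l != i -> x l = y l) -> Atau_i A x i = Atau_i A y i.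
Proof.
move=> h; apply/matrixP => a b; rewrite !mxE; apply: eq_bigr => z _.
by congr (_ * _); apply: eq_bigr => l /h ->.
Qed.

Lemma Atau_slot A x i : Atau A x = ip (Atau_i A x i) (x i).
Proof.
rewrite /Atau (partition_big (fun z : idx n => z i) predT) //=; apply: eq_bigr => a _.
rewrite mxE mulr_suml; apply: eq_bigr => z /eqP zi.
by rewrite (bigD1 i) //= zi [x i a ord0 * _]mulrC mulrA.
Qed.

Lemma Atau_rep A x h i : Atau A (rep x h i) = ip (Atau_i A x i) (h i).
Proof.
rewrite (Atau_slot _ _ i) rep_same; congr ip.
by apply: Atau_i_ext => l li; rewrite rep_other.
Qed.

(** Expansion of a product of sums over the dependent index type, done through tagged functions.
    Every later test against a rank-one tensor rests on it. *)
Lemma rho_ip x y : \sum_z rho x z * rho y z = \prod_l ip (x l) (y l).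
Proof.
pose F l : {ffun 'I_(n l) -> R} := [ffun a => x l a ord0 * y l a ord0].
transitivity (\sum_(z : idx n) \prod_l F l (z l)).
  by apply: eq_bigr => z _; rewrite !ffunE -big_split /=; apply: eq_bigr => l _; rewrite ffunE.
transitivity (\prod_l \sum_a F l a); last first.
  by apply: eq_bigr => l _; apply: eq_bigr => a _; rewrite ffunE.
transitivity (\sum_(z : fprod (fun l => 'I_(n l))) \prod_(l in 'I_k) F l (z l)).
  rewrite (reindex (@dffun_of_fprod _ _)) /=; last exact/onW_bij/dffun_of_fprod_bij.
  by apply: eq_bigr => z _; apply: eq_bigr => l _; rewrite /dffun_of_fprod [in LHS](ffunE _ l).
rewrite (@big_fprod _ 0 1 *%R +%R).
transitivity (\prod_i \sum_(j in tagged_with (fun l => 'I_(n l)) i) untag 0 (F i) j).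
  by rewrite bigA_distr_big_dep; apply: eq_bigl => g; apply/familyP/familyP.
apply: eq_bigr => l _; apply/esym; exact: (@big_tag R 0 +%R _ (fun l => 'I_(n l)) (fun l => F l) l).
Qed.

Lemma Atau_rho x y : Atau (rho y) x = \prod_l ip (x l) (y l).
Proof. by rewrite AtauE -rho_ip; apply: eq_bigr => z _; rewrite mulrC. Qed.

Lemma Atau_lin A a c x : Atau [ffun z => c * A z + a z] x = c * Atau A x + Atau a x.
Proof.
rewrite mulr_sumr -big_split; apply: eq_bigr => z _ /=.
by rewrite ffunE mulrDl mulrA.
Qed.

Lemma Atau_lin_slot A x h h' c i :
  Atau A (rep x (fun l => c *: h l + h' l) i) = c * Atau A (rep x h i) + Atau A (rep x h' i).
Proof. by rewrite !Atau_rep ipDr ipZr. Qed.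

Lemma Atau_slot0 A x i : x i = 0 -> Atau A x = 0.
Proof. by move=> h; rewrite (Atau_slot _ _ i) h ip0r. Qed.

Lemma rep_rep_comm x h h' i l : i != l -> forall m, rep (rep x h i) h' l m = rep (rep x h' l) h i m.
Proof.
move=> il m; rewrite /rep; case: eqP => [->|]; case: eqP => // ml.
by move: il; rewrite -ml eqxx.
Qed.

End Multilinear.

Section DerivationCalculus.
Variables (R : realType) (d : R -> R) (hd : derivation d).

Lemma derD x y : d (x + y) = d x + d y. Proof. by case: hd. Qed.
Lemma derM x y : d (x * y) = d x * y + x * d y. Proof. by case: hd. Qed.
Lemma der0 : d 0 = 0.
Proof. by apply: (addrI (d 0)); rewrite -derD !addr0. Qed.
Lemma der1 : d 1 = 0.
Proof. by apply: (addrI (d 1)); rewrite addr0 -{3}[1]mulr1 derM mulr1 mul1r. Qed.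
Lemma derN x : d (- x) = - d x.
Proof. by apply: (addrI (d x)); rewrite -derD !subrr der0. Qed.
Lemma der_nat m : d m%:R = 0.
Proof. by elim: m => [|m IH]; rewrite ?der0 // -natr1 derD IH der1 addr0. Qed.

Lemma der_sum I (r : seq I) (P : pred I) F :
  d (\sum_(i <- r | P i) F i) = \sum_(i <- r | P i) d (F i).
Proof. exact: (big_morph d derD der0). Qed.

Lemma der_prod (I : finType) (F : I -> R) :
  d (\prod_i F i) = \sum_i \prod_l (if l == i then d (F l) else F l).
Proof.
have gen (r : seq I) : uniq r -> d (\prod_(i <- r) F i) =
    \sum_(i <- r) \prod_(l <- r) (if l == i then d (F l) else F l).
  elim: r => [|i r IH] /=; first by rewrite !big_nil der1.
  move=> /andP[ir ur]; rewrite !big_cons derM IH // eqxx; congr (_ + _).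
    by congr (_ * _); apply: eq_big_seq => l lr; rewrite ifN //; apply: contraNneq ir => <-.
  rewrite mulr_sumr; apply: eq_big_seq => l lr; rewrite big_cons ifN //.
  by apply: contraNneq ir => ->.
exact/gen/index_enum_uniq.
Qed.

Lemma der_mulmx m p q (M : 'M[R]_(m, p)) (N : 'M_(p, q)) :
  map_mx d (M *m N) = map_mx d M *m N + M *m map_mx d N.
Proof.
apply/matrixP => a b; rewrite !mxE der_sum -big_split; apply: eq_bigr => c _ /=.
by rewrite derM !mxE.
Qed.

Lemma der_ip m (u v : 'cV[R]_m) : d (ip u v) = ip (map_mx d u) v + ip u (map_mx d v).
Proof.
rewrite der_sum -big_split; apply: eq_bigr => c _ /=.
by rewrite derM !mxE.
Qed.

Lemma der_unit m (u : 'cV[R]_m) : ip u u = 1 -> ip u (map_mx d u) = 0.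
Proof.
move=> /(congr1 d); rewrite der_ip der1 (ipC (map_mx d u)) -mulr2n => /eqP.
by rewrite mulrn_eq0 => /eqP.
Qed.

Variables (k : nat) (n : 'I_k -> nat).
Implicit Types (A : tensor R n) (x y h : vfam R n).

Definition dfam x : vfam R n := fun l => map_mx d (x l).

Lemma der_rho x z : d (rho x z) = \sum_i rho (rep x (dfam x) i) z.
Proof.
rewrite ffunE der_prod; apply: eq_bigr => i _; rewrite ffunE; apply: eq_bigr => l _.
by rewrite /rep; case: eqP => //; rewrite mxE.
Qed.

Lemma der_Atau A x :
  d (Atau A x) = Atau [ffun z => d (A z)] x + \sum_i Atau A (rep x (dfam x) i).
Proof.
rewrite AtauE der_sum.
under eq_bigr => z _ do rewrite derM der_rho.
rewrite big_split /=; congr (_ + _).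
  by rewrite AtauE; apply: eq_bigr => z _; rewrite [in RHS]ffunE.
under eq_bigr => z _ do rewrite mulr_sumr.
by rewrite exchange_big; apply: eq_bigr => i _; rewrite AtauE.
Qed.

Lemma der_Atau_i A x i h : ip (map_mx d (Atau_i A x i)) (h i) =
  Atau [ffun z => d (A z)] (rep x h i) + \sum_(l | l != i) Atau A (rep (rep x (dfam x) l) h i).
Proof.
(* Pairing with the constant vectors [bas e] reads off entries; their derivatives vanish, which
   reduces the claim to [der_Atau]. *)
pose bas (e : 'I_(n i)) : vfam R n := fun l => \col_a (nat_of_ord a == e)%:R.
have ipb (v : 'cV[R]_(n i)) e : ip v (bas e i) = v e ord0.
  rewrite /ip (bigD1 e) //= mxE eqxx mulr1 big1 ?addr0 // => a ae.
  by rewrite mxE (_ : (nat_of_ord a == e) = false) ?mulr0 //; exact/negbTE.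
have E e : d (Atau_i A x i e ord0) = (Atau_i [ffun z => d (A z)] x i e ord0)
   + \sum_(l | l != i) Atau_i A (rep x (dfam x) l) i e ord0.
  rewrite -ipb -Atau_rep der_Atau Atau_rep ipb; congr (_ + _).
  rewrite (bigD1 i) //= (@Atau_slot0 _ _ _ _ _ i) ?add0r.
    apply: eq_bigr => l li; rewrite -ipb -Atau_rep; apply: Atau_ext => m.
    rewrite /dfam /rep; case: (eqVneq m l) => [->|]; last by case: eqP.
    by rewrite (negPf li).
  rewrite rep_same /dfam rep_same; apply/matrixP => a b; rewrite !mxE.
  exact: der_nat.
rewrite Atau_rep /ip.
under eq_bigr => e _ do rewrite mxE E mulrDl mulr_suml.
rewrite big_split /= exchange_big /=; congr (_ + _).
by apply: eq_bigr => l _; rewrite Atau_rep.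
Qed.

End DerivationCalculus.

(** * The Hessian at a critical point *)

Lemma map_mx_tr (R : Type) (d : R -> R) m p (M : 'M[R]_(m, p)) : map_mx d M^T = (map_mx d M)^T.
Proof. by apply/matrixP => e f; rewrite !mxE. Qed.

Section Critical.
Variables (R : realType) (k : nat) (n : 'I_k -> nat) (s t : nat).
Implicit Types (A a : tensor R n) (x y h : vfam R n) (U H : mats R n t).

Definition tangent U H : Prop := forall i : 'I_k,
  ((i < s)%N -> (U i)^T *m H i + (H i)^T *m U i = 0) /\
  (~ (i < s)%N -> forall j, ip (col j (U i)) (col j (H i)) = 0).

Definition multiplier (P : 'I_k -> 'M[R]_t) : Prop := forall i : 'I_k,
  ((i < s)%N -> (P i)^T = P i) /\ (~ (i < s)%N -> exists p, P i = diag_mx p).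

Lemma mulmx_diag_entry U H (i : 'I_k) j :
  ((U i)^T *m H i) j j = ip (col j (U i)) (col j (H i)).
Proof. by rewrite mxE; apply: eq_bigr => a _; rewrite !mxE. Qed.

(** The vectors [U P] are normal to the feasible set: a symmetric matrix is trace-orthogonal to the
    skew matrix [U^T H], and a diagonal one sees only its vanishing diagonal. *)
Lemma mip_multiplier U H P i : tangent U H -> multiplier P -> mip (U i *m P i) (H i) = 0.
Proof.
move=> hH hP; have [H1 H2] := hH i; have [P1 P2] := hP i.
rewrite mip_mulr; case: (boolP (i < s)%N) => [is_|/negP is_].
  by rewrite P1 // tr_sym_skew ?P1 // trmx_mul trmxK H1.
have [p ->] := P2 is_; rewrite tr_diag_mx tr_diag_mul big1 // => j _.
by rewrite mulmx_diag_entry H2 // mulr0.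
Qed.

Definition Dtau A x h : R := \sum_i Atau A (rep x h i).

(* Pairing of [a] with the differential, at [(U, lam)] in direction [(H, b)], of
   the map sending [(U, lam)] to [\sum_j lam_j u_j^1 (x) ... (x) u_j^k]. *)
Definition Theta U (lm : 'I_t -> R) H (b : 'I_t -> R) a : R :=
  \sum_j (lm j * Dtau a (colfam U j) (colfam H j) + b j * Atau a (colfam U j)).

(** Hessian of the Lagrangian of [f / 2]; the term with [P] is the curvature of the constraints. *)
Definition Hess A U (P : 'I_k -> 'M[R]_t) (D H : mats R n t) : R :=
  \sum_j (Dtau A (colfam U j) (colfam D j) * Dtau A (colfam U j) (colfam H j) +
    lam A U j * \sum_i \sum_(l | l != i)
      Atau A (rep (rep (colfam U j) (colfam D j) l) (colfam H j) i))
  - \sum_i mip (D i *m P i) (H i).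

Lemma Hess_sym A U P D H : multiplier P -> Hess A U P D H = Hess A U P H D.
Proof.
move=> hP; rewrite /Hess; congr (_ - _).
  apply: eq_bigr => j _; rewrite mulrC; congr (_ + _ * _).
  rewrite (exchange_big_dep predT) //=; apply: eq_bigr => l _.
  rewrite (eq_bigl (fun i => i != l)); last by move=> i; rewrite eq_sym.
  apply: eq_bigr => i il; apply: Atau_ext => m; by apply: rep_rep_comm; rewrite eq_sym.
apply: eq_bigr => i _; rewrite !mip_mulr.
have hPT : (P i)^T = P i.
  have [P1 P2] := hP i; case: (boolP (i < s)%N) => [/P1 //|/negP /P2[p ->]].
  exact: tr_diag_mx.
by rewrite -[LHS]mxtrace_tr !trmx_mul trmxK mxtrace_mulC !hPT.
Qed.

Section KKTpoint.
Variables (A : tensor R n) (U : mats R n t) (P : 'I_k -> 'M[R]_t).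
Hypothesis hP : multiplier P.
Hypothesis hK : forall i, Vmat A U i *m Lam A U = U i *m P i.

Lemma col_VLam j i : col j (Vmat A U i *m Lam A U) = lam A U j *: Atau_i A (colfam U j) i.
Proof.
apply/matrixP => a b; rewrite /Lam mul_mx_diag !mxE !ord1 /= mulrC; congr (_ * _).
Qed.

Lemma mip_VLam H : \sum_i mip (Vmat A U i *m Lam A U) (H i)
  = \sum_j lam A U j * Dtau A (colfam U j) (colfam H j).
Proof.
under eq_bigr => i _ do rewrite mip_col.
rewrite exchange_big; apply: eq_bigr => j _ /=.
rewrite mulr_sumr; apply: eq_bigr => i _; rewrite col_VLam ipZl Atau_rep.
by [].
Qed.

Section Der.
Variables (d : R -> R) (hd : derivation d) (a : tensor R n).
Hypothesis da : forall z, d (A z) = a z.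
Let dU : mats R n t := fun i => map_mx d (U i).

Let dA : [ffun z => d (A z)] = a :> tensor R n.
Proof. by apply/ffunP => z; rewrite ffunE da. Qed.

Let colfam_der j l : dfam d (colfam U j) l = colfam dU j l.
Proof. by rewrite /dfam /colfam /dU map_col. Qed.

Lemma der_lam j : d (lam A U j) = Atau a (colfam U j) + Dtau A (colfam U j) (colfam dU j).
Proof.
rewrite /lam der_Atau // dA; congr (_ + _); apply: eq_bigr => i _.
by apply: Atau_ext => l; rewrite /rep colfam_der.
Qed.

Lemma tangent_der : feasible s U -> tangent U dU.
Proof.
move=> hU i; have [U1 U2] := hU i; split=> [/U1 h|/U2 h j].
  have := congr1 (map_mx d) h; rewrite der_mulmx //.
  have -> : map_mx d 1%:M = 0 :> 'M_t.
    by apply/matrixP => a0 b; rewrite !mxE der_nat.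
  by rewrite addrC map_mx_tr.
have /vnorm1/(der_unit hd) := h j.
by rewrite map_col.
Qed.

Lemma multiplier_der : multiplier (fun i => map_mx d (P i)).
Proof.
move=> i; have [P1 P2] := hP i; split=> [/P1 h|/P2[p ->]].
  by rewrite -map_mx_tr h.
exists (map_mx d p); apply/matrixP => e f; rewrite !mxE.
by case: eqP => _; rewrite ?mulr1n // !mulr0n der0.
Qed.

(** Apply [d] to [V Lam = U P] and pair with [H]. The derivative of [P] is again a multiplier, hence
    invisible to [H]; the part where [d] falls on [A] assembles into [Theta]. *)
Lemma der_KKT H : tangent U H ->
  Hess A U P dU H + Theta U (lam A U) H (fun j => Dtau A (colfam U j) (colfam H j)) a = 0.
Proof.
move=> hH.
have E : \sum_i mip (map_mx d (Vmat A U i *m Lam A U)) (H i) = \sum_i mip (dU i *m P i) (H i).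
  apply: eq_bigr => i _; rewrite hK der_mulmx // mipDl.
  by rewrite (mip_multiplier i hH multiplier_der) addr0.
rewrite /Hess -E /Theta.
rewrite (_ : \sum_i mip (map_mx d _) (H i) = \sum_j (d (lam A U j) * Dtau A (colfam U j) (colfam H j)
  + lam A U j * \sum_i ip (map_mx d (Atau_i A (colfam U j) i)) (colfam H j i))); last first.
  under eq_bigr => i _ do rewrite mip_col.
  rewrite exchange_big; apply: eq_bigr => j _ /=.
  rewrite !mulr_sumr -big_split; apply: eq_bigr => i _ /=.
  rewrite Atau_rep -map_col col_VLam -!ipZl -ipDl; congr ip.
  by apply/matrixP => e f; rewrite !mxE derM.
rewrite -sumrB -big_split big1 // => j _ /=.
rewrite der_lam.
have -> : \sum_i ip (map_mx d (Atau_i A (colfam U j) i)) (colfam H j i)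
   = Dtau a (colfam U j) (colfam H j) + \sum_i \sum_(l | l != i)
      Atau A (rep (rep (colfam U j) (colfam dU j) l) (colfam H j) i).
  rewrite -big_split; apply: eq_bigr => i _ /=; rewrite der_Atau_i // dA; congr (_ + _).
  by apply: eq_bigr => l _; apply: Atau_ext => m; rewrite /rep colfam_der.
ring.
Qed.

End Der.

(* Kernel vectors of the Hessian are killed by the differential of the
   parametrization: the algebraic counterpart of Sard's theorem. *)
Lemma Hess_kernel (d : tensor R n -> R -> R) Z : feasible s U ->
  (forall a, derivation (d a)) -> (forall a z, d a (A z) = a z) ->
  tangent U Z -> (forall H, tangent U H -> Hess A U P Z H = 0) ->
  forall a, Theta U (lam A U) Z (fun j => Dtau A (colfam U j) (colfam Z j)) a = 0.
Proof.
move=> fU hd da tZ hZ a; have := der_KKT (hd a) (da a) tZ.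
by rewrite Hess_sym // hZ ?add0r //; apply: tangent_der.
Qed.

(** When the derivatives of [U] and [lam] vanish, [der_lam] gives [Atau a = 0] at every column, so
    [b] drops out, and [der_KKT] has no Hessian term left. *)
Lemma Theta_orth (d : tensor R n -> R -> R) a :
  (forall a, derivation (d a)) -> (forall a z, d a (A z) = a z) ->
  (forall i, map_mx (d a) (U i) = 0) -> (forall j, d a (lam A U j) = 0) ->
  forall H b, tangent U H -> Theta U (lam A U) H b a = 0.
Proof.
move=> hd da dU0 dl0 H b tH.
have C0 j l : colfam (fun i => map_mx (d a) (U i)) j l = 0.
  by rewrite /colfam dU0; apply/matrixP => e f; rewrite !mxE.
have D0 j : Dtau A (colfam U j) (colfam (fun i => map_mx (d a) (U i)) j) = 0.
  by apply: big1 => i _; apply: (@Atau_slot0 _ _ _ _ _ i); rewrite rep_same C0.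
have A0 j : Atau a (colfam U j) = 0.
  by have := der_lam (hd a) (da a) j; rewrite dl0 D0 addr0.
have := der_KKT (hd a) (da a) tH; rewrite /Hess.
rewrite big1 => [|j _]; last first.
  rewrite D0 mul0r add0r big1 ?mulr0 // => i _; rewrite big1 // => l li.
  by apply: (@Atau_slot0 _ _ _ _ _ l); rewrite rep_other // rep_same C0.
rewrite big1 ?subr0 ?add0r => [<-|i _]; last first.
  by rewrite dU0 mul0mx /mip trmx0 mul0mx mxtrace0.
by apply: eq_bigr => j _; rewrite A0 !mulr0.
Qed.

End KKTpoint.
End Critical.

(** * Counting linear functionals *)

Lemma mulmx_col (R : nzRingType) m p q (M : 'M[R]_(m, p)) (N : 'M[R]_(p, q)) j a b :
  (M *m col j N) a b = (M *m N) a j.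
Proof. by rewrite !mxE; apply: eq_bigr => e _; rewrite !mxE. Qed.

Section Kill.
Variables (R : realType) (X : lmodType R).
Implicit Types (H Q : X -> Prop).

Definition slin (phi : X -> R) := forall c x y, phi (c *: x + y) = c * phi x + phi y.

(* Under [H], the vanishing of [m] suitable linear functionals forces [Q]. *)
Definition kill m H Q := exists2 phi : 'I_m -> X -> R,
  (forall i, slin (phi i)) & forall x, H x -> (forall i, phi i x = 0) -> Q x.

Lemma slin0 : slin (fun=> 0).
Proof. by move=> c x y; rewrite mulr0 addr0. Qed.

Lemma slinZ a f : slin f -> slin (fun x => a * f x).
Proof. by move=> hf c x y; rewrite hf; ring. Qed.

Lemma slinB f g : slin f -> slin g -> slin (fun x => f x - g x).
Proof. by move=> hf hg c x y; rewrite hf hg; ring. Qed.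

Lemma kill_weaken m H H' Q Q' : (forall x, H' x -> H x) ->
  (forall x, H' x -> Q x -> Q' x) -> kill m H Q -> kill m H' Q'.
Proof. by move=> hH hQ [phi l h]; exists phi => // x /[dup] /hH Hx /hQ h' ?; exact/h'/h. Qed.

Lemma kill0 H Q : (forall x, H x -> Q x) -> kill 0 H Q.
Proof. by move=> h; exists (fun _ _ => 0) => [i|x /h //]; exact: slin0. Qed.

Lemma kill_seq m m' H Q Q' : kill m H Q -> kill m' (fun x => H x /\ Q x) Q' ->
  kill (m + m') H (fun x => Q x /\ Q' x).
Proof.
move=> [phi l h] [phi' l' h'].
exists (fun i => match split i with inl j => phi j | inr j => phi' j end).
  by move=> i; case: (split i).
move=> x Hx h0.
have Qx : Q x.
  by apply: h => // i; have := h0 (unsplit (inl i)); rewrite unsplitK.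
by split=> //; apply: h' => // i; have := h0 (unsplit (inr i)); rewrite unsplitK.
Qed.

Lemma kill_le m m' H Q : (m <= m')%N -> kill m H Q -> kill m' H Q.
Proof.
move=> /subnKC <- h; apply: (@kill_weaken _ H _ (fun x => Q x /\ True)) => // [x _ []//|].
apply: kill_seq => //; exists (fun _ _ => 0) => // i; exact: slin0.
Qed.

Lemma kill_fin (I : finType) (P : pred I) (phi : I -> X -> R) H :
  (forall i, slin (phi i)) -> kill #|P| H (fun x => forall i, P i -> phi i x = 0).
Proof.
move=> l; exists (fun j => phi (enum_val (A := P) j)) => [j|x _ h i Pi]; first exact: l.
by have := h (enum_rank_in Pi i); rewrite enum_rankK_in.
Qed.

Lemma kill1 phi H : slin phi -> kill 1 H (fun x => phi x = 0).
Proof. by move=> l; exists (fun=> phi) => // x _ /(_ ord0). Qed.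

(** The functionals for [j] may presuppose the conclusion for earlier indices; this is how a column
    determined by earlier ones costs nothing. *)
Lemma kill_ord t (c : 'I_t -> nat) (Q : 'I_t -> X -> Prop) H :
  (forall j, kill (c j) (fun x => H x /\ forall l : 'I_t, (l < j)%N -> Q l x) (Q j)) ->
  kill (\sum_j c j) H (fun x => forall j, Q j x).
Proof.
move=> h.
suff gen m : kill (\sum_(j < t | (j < m)%N) c j) H (fun x => forall j : 'I_t, (j < m)%N -> Q j x).
  have -> : \sum_j c j = \sum_(j < t | (j < t)%N) c j by apply: eq_bigl => j; rewrite ltn_ord.
  have := gen t.
  by apply: kill_weaken => // x _ hx j; apply: hx.
elim: m => [|m IH]; first by rewrite big_pred0 //; apply: kill0.
have [mt|mt] := ltnP m t; last first.
  rewrite (eq_bigl (fun j : 'I_t => (j < m)%N)).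
    apply: kill_weaken IH => // x _ hx j _; apply: hx; exact: leq_trans (ltn_ord j) mt.
  by move=> j; rewrite !(leq_trans (ltn_ord j)) // leqW.
pose m0 := Ordinal mt.
rewrite (bigD1 m0) //= addnC.
rewrite (eq_bigl (fun j : 'I_t => (j < m)%N)) => [|j]; last first.
  by rewrite ltnS -val_eqE /= [RHS]ltn_neqAle andbC.
apply: (@kill_weaken _ H _ (fun x => (forall j : 'I_t, (j < m)%N -> Q j x) /\ Q m0 x)) => //.
  move=> x _ [h1 h2] j; rewrite ltnS leq_eqVlt => /orP[/eqP jm|/h1 //].
  by have -> : j = m0 by exact: val_inj.
by apply: kill_seq IH _; apply: h.
Qed.

Lemma kill_family t (c : 'I_t -> nat) (Q : 'I_t -> X -> Prop) H :
  (forall j, kill (c j) H (Q j)) -> kill (\sum_j c j) H (fun x => forall j, Q j x).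
Proof.
by move=> h; apply: kill_ord => j; apply: kill_weaken (h j) => // x [].
Qed.

Lemma kill_family_cond t (P : pred 'I_t) (c : 'I_t -> nat) (Q : 'I_t -> X -> Prop) H :
  (forall j, P j -> kill (c j) H (Q j)) ->
  kill (\sum_(j | P j) c j) H (fun x => forall j, P j -> Q j x).
Proof.
move=> h; rewrite big_mkcond; apply: kill_family => j; case: ifP => Pj; last exact: kill0.
by apply: kill_weaken (h _ Pj).
Qed.

(** A vector orthogonal to [u] is determined by its entries away from one nonzero coordinate of
    [u]. *)
Lemma unit_kill m (u : 'cV[R]_m) (g : X -> 'cV[R]_m) H :
  ip u u = 1 -> (forall a, slin (fun x => g x a ord0)) ->
  (forall x, H x -> ip u (g x) = 0) -> kill m.-1 H (fun x => g x = 0).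
Proof.
move=> u1 lg hg.
have [c uc] : exists c, u c ord0 != 0.
  apply: contrapT => /forallNP h; have : ip u u = 0.
    by apply: big1 => c _; have /negP := h c; rewrite negbK => /eqP ->; rewrite mul0r.
  by rewrite u1 => /eqP; rewrite oner_eq0.
have <- : #|[pred a | a != c]| = m.-1.
  by have := cardC1 c; rewrite card_ord => <-; apply: eq_card => a; rewrite !inE.
have := @kill_fin _ [pred a | a != c] (fun a x => g x a ord0) H lg.
apply: kill_weaken => // x Hx h; have := hg _ Hx.
rewrite /ip (bigD1 c) //= big1 ?addr0 => [/eqP|a ac]; last by rewrite h // mulr0.
rewrite mulf_eq0 (negPf uc) /= => /eqP gc; apply/matrixP => a b; rewrite ord1 mxE.
by have [->//|ac] := eqVneq a c; apply: h.
Qed.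

(** Dimension of the skew-symmetric matrices; [nle] below is that of the symmetric ones. *)
Definition nlt t := #|[pred p : 'I_t * 'I_t | (p.1 < p.2)%N]|.
Definition nle t := #|[pred p : 'I_t * 'I_t | (p.2 <= p.1)%N]|.

Lemma nlt_nle t : (nle t + nlt t = t * t)%N.
Proof.
rewrite -[in RHS](card_ord t) -card_prod -(cardC [pred p : 'I_t * 'I_t | (p.2 <= p.1)%N]).
by congr addn; apply: eq_card => p; rewrite !inE -ltnNge.
Qed.

(** [W] holds a basis of the orthogonal complement of the column space, read off from the kernel of
    [Q]. *)
Lemma complement_mx m t (Q : 'M[R]_(m, t)) : stiefel Q ->
  exists2 W : 'M[R]_(m, m - t), W^T *m Q = 0 &
    forall v : 'cV[R]_m, Q^T *m v = 0 -> W^T *m v = 0 -> v = 0.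
Proof.
move=> hQ.
have rQ : \rank Q = t.
  apply/eqP; rewrite eqn_leq rank_leq_col /=.
  have : \rank (Q^T *m Q) = t by rewrite hQ mxrank1.
  by move=> {1}<-; apply: mxrankM_maxr.
have rk : \rank (kermx Q) = (m - t)%N by rewrite mxrank_ker rQ.
exists (castmx (rk, erefl) (row_base (kermx Q)))^T.
  rewrite trmxK; case: _ / rk; rewrite castmx_id; apply/sub_kermxP.
  by rewrite eq_row_base.
move=> v /(congr1 trmx); rewrite trmx_mul trmxK trmx0 => /sub_kermxP.
rewrite -(eq_row_base (kermx Q)) => /submxP[x vx]; rewrite trmxK => h.
have h' : row_base (kermx Q) *m v = 0.
  by move: h; case: _ / rk; rewrite castmx_id.
have : v^T *m v = 0 by rewrite vx -mulmxA h' mulmx0.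
rewrite ipE => /matrixP/(_ ord0 ord0); rewrite !mxE /= mulr1n; exact: ip_eq0.
Qed.

(** The count is the dimension of the Stiefel manifold: the skew matrix [Q^T g], and the component
    of [g] in the orthogonal complement. *)
Lemma stiefel_kill m t (Q : 'M[R]_(m, t)) (g : X -> 'M[R]_(m, t)) H :
  stiefel Q -> (forall a b, slin (fun x => g x a b)) ->
  (forall x, H x -> Q^T *m g x + (g x)^T *m Q = 0) ->
  kill (nlt t + (m - t) * t) H (fun x => g x = 0).
Proof.
move=> hQ lg hg; have [W _ hW] := complement_mx hQ.
have lm p (N : 'M[R]_(m, p)) a b : slin (fun x => (N^T *m g x) a b).
  move=> c x y; rewrite !mxE mulr_sumr -big_split; apply: eq_bigr => e _ /=.
  by rewrite lg; ring.
have K1 := @kill_fin _ [pred p : 'I_t * 'I_t | (p.1 < p.2)%N] (fun p x => (Q^T *m g x) p.1 p.2) H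
  (fun p => lm _ Q p.1 p.2).
have K2 := @kill_fin _ predT (fun p x => (W^T *m g x) p.1 p.2)
  (fun x => H x /\ forall i : 'I_t * 'I_t, (i.1 < i.2)%N -> (Q^T *m g x) i.1 i.2 = 0)
  (fun p => lm _ W p.1 p.2).
have := kill_seq K1 K2; rewrite card_prod !card_ord.
apply: kill_weaken => // x Hx [h1 h2].
have sk a b : (Q^T *m g x) a b = - (Q^T *m g x) b a.
  have /matrixP/(_ a b) := hg _ Hx; rewrite mxE [X in _ + X](_ : _ = (Q^T *m g x) b a).
    by rewrite [(0 : 'M[R]_t) a b]mxE => /eqP; rewrite addr_eq0 => /eqP.
  by rewrite !mxE; apply: eq_bigr => e _; rewrite !mxE mulrC.
suff hc j : col j (g x) = 0.
  by apply/matrixP => e j; have /matrixP/(_ e ord0) := hc j; rewrite !mxE.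
apply: hW; apply/matrixP => a b; rewrite ord1 [RHS]mxE.
  rewrite mulmx_col; case: (ltngtP a j) => aj; first exact: (h1 (a, j)).
    by rewrite sk (h1 (j, a)) // oppr0.
  have -> : a = j by exact: val_inj.
  by apply/eqP; have := sk j j => /eqP; rewrite -addr_eq0 -mulr2n mulrn_eq0.
by rewrite mulmx_col (h2 (a, j)).
Qed.

End Kill.

Lemma kill_dim (R : realType) (F : finType) m :
  @kill R {ffun F -> R^o} m (fun=> True) (fun x => x = 0) -> (#|F| <= m)%N.
Proof.
move=> [phi l h]; rewrite leqNgt; apply/negP => mF.
pose dl (a : 'I_#|F|) : {ffun F -> R^o} := [ffun f => (f == enum_val a)%:R].
pose M : 'M[R]_(#|F|, m) := \matrix_(a, i) phi i (dl a).
have : kermx M != 0.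
  by rewrite -mxrank_eq0 mxrank_ker -lt0n subn_gt0 (leq_ltn_trans (rank_leq_col M)).
move=> /rowV0Pn[v /sub_kermxP vM v0].
have x0 : \sum_a v ord0 a *: dl a = 0.
  apply: h => // i; rewrite (_ : phi i _ = \sum_a v ord0 a * phi i (dl a)).
    have /matrixP/(_ ord0 i) := vM; rewrite !mxE => e; rewrite -[RHS]e.
    by apply: eq_bigr => a _; rewrite mxE.
  have p0 : phi i 0 = 0.
    by have := l i 1 0 0; rewrite scale1r addr0 mul1r => /eqP; rewrite -subr_eq0 opprD addrA subrr sub0r oppr_eq0 => /eqP.
  elim: (index_enum _) => [|a r IH]; first by rewrite !big_nil.
  by rewrite !big_cons l IH.
case/eqP: v0; apply/matrixP => b a; rewrite ord1 mxE.
have /ffunP/(_ (enum_val a)) := x0; rewrite sum_ffunE (bigD1 a) //= big1 => [|c ca].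
  by rewrite !ffunE eqxx addr0 => /eqP; rewrite mulf_eq0 oner_eq0 orbF => /eqP.
by rewrite !ffunE (inj_eq enum_val_inj) eq_sym (negPf ca); exact: mulr0.
Qed.

(** * Nondegeneracy with at least three orthonormal modes *)

Section ThetaLinear.
Variables (R : realType) (k : nat) (n : 'I_k -> nat) (t : nat).
Variables (U : mats R n t) (lm : 'I_t -> R).
Implicit Types (a : tensor R n) (x y : vfam R n).

(** One coordinate for each entry of each [U i] and one for each [lam j], so that the directions
    [(H, b)] form a plain coordinate space of known dimension. *)
Definition coord : finType := ({i : 'I_k & ('I_(n i) * 'I_t)%type} + 'I_t)%type.
Definition dirs := {ffun coord -> R^o}.
Definition Hof (xi : dirs) : mats R n t :=
  fun i => \matrix_(a, j) xi (inl (existT (fun i => ('I_(n i) * 'I_t)%type) i (a, j))).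
Definition bof (xi : dirs) (j : 'I_t) : R := xi (inr j).
Definition dlt (z : idx n) : tensor R n := [ffun z' => (z' == z)%:R].

Lemma card_coord : #|coord| = (\sum_i n i * t + t)%N.
Proof.
rewrite card_sum card_ord card_tagged sumnE big_map big_enum /=; congr addn.
by apply: eq_bigr => i _; rewrite card_prod !card_ord.
Qed.

Lemma Hof_lin c xi eta i : Hof (c *: xi + eta) i = c *: Hof xi i + Hof eta i.
Proof. by apply/matrixP => a j; rewrite !mxE !ffunE. Qed.

Lemma dirs_eq0 xi : (forall i, Hof xi i = 0) -> (forall j, bof xi j = 0) -> xi = 0.
Proof.
move=> hH hb; apply/ffunP => -[[i [a j]]|j]; rewrite [RHS]ffunE; last exact: hb.
by have /matrixP/(_ a j) := hH i; rewrite !mxE.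
Qed.

Lemma Atau_dlt z x : Atau (dlt z) x = rho x z.
Proof.
rewrite AtauE (bigD1 z) //= [dlt z z]ffunE eqxx mul1r big1 ?addr0 // => z' /negPf h.
by rewrite ffunE h mul0r.
Qed.

Lemma ThetaE H b a : Theta U lm H b a = \sum_z a z * Theta U lm H b (dlt z).
Proof.
have AE x : Atau a x = \sum_z a z * Atau (dlt z) x.
  by rewrite AtauE; apply: eq_bigr => z _; rewrite Atau_dlt.
under [RHS]eq_bigr => z _ do rewrite mulr_sumr.
rewrite exchange_big; apply: eq_bigr => j _ /=.
under [RHS]eq_bigr => z _ do rewrite mulrDr.
rewrite big_split /=; congr (_ + _).
  rewrite /Dtau mulr_sumr.
  under [RHS]eq_bigr => z _ do rewrite !mulr_sumr.
  rewrite exchange_big; apply: eq_bigr => i _ /=.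
  by rewrite AE mulr_sumr; apply: eq_bigr => z _; ring.
by rewrite AE mulr_sumr; apply: eq_bigr => z _; ring.
Qed.

Lemma Theta_lin c xi eta a :
  Theta U lm (Hof (c *: xi + eta)) (bof (c *: xi + eta)) a =
  c * Theta U lm (Hof xi) (bof xi) a + Theta U lm (Hof eta) (bof eta) a.
Proof.
rewrite /Theta mulr_sumr -big_split; apply: eq_bigr => j _ /=.
have -> : bof (c *: xi + eta) j = c * bof xi j + bof eta j by rewrite /bof !ffunE.
have -> : Dtau a (colfam U j) (colfam (Hof (c *: xi + eta)) j) =
   c * Dtau a (colfam U j) (colfam (Hof xi) j) + Dtau a (colfam U j) (colfam (Hof eta) j).
  rewrite /Dtau mulr_sumr -big_split; apply: eq_bigr => i _ /=.
  rewrite -Atau_lin_slot; apply: Atau_ext => l; rewrite /rep; case: eqP => // _.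
  by rewrite /colfam Hof_lin; apply/matrixP => e f; rewrite !mxE.
ring.
Qed.

(** The tensor representing the functional [Theta xi], that is, the image of [xi] under the
    differential of the parametrization. *)
Definition aof (xi : dirs) : tensor R n := [ffun z => Theta U lm (Hof xi) (bof xi) (dlt z)].

Lemma aof_lin c xi eta : aof (c *: xi + eta) = [ffun z => c * aof xi z + aof eta z].
Proof. by apply/ffunP => z; rewrite !ffunE Theta_lin. Qed.

(** The hypothesis says that the squared norm of [aof xi] vanishes. *)
Lemma Theta_aof xi : Theta U lm (Hof xi) (bof xi) (aof xi) = 0 ->
  forall a, Theta U lm (Hof xi) (bof xi) a = 0.
Proof.
rewrite ThetaE => /eqP h a; rewrite ThetaE big1 // => z _.
have : aof xi z = 0.
  move: h; rewrite (eq_bigr (fun z => aof xi z ^+ 2)) => [|z' _]; last first.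
    by rewrite [in X in _ * X](_ : Theta _ _ _ _ _ = aof xi z') ?expr2 // ffunE.
  rewrite psumr_eq0 => [/allP/(_ z (mem_index_enum _))|z' _]; last exact: sqr_ge0.
  by rewrite sqrf_eq0 => /eqP.
by rewrite ffunE => ->; rewrite mulr0.
Qed.

Lemma Theta_rho H b y : Theta U lm H b (rho y) = \sum_j (lm j *
    \sum_i \prod_l ip (rep (colfam U j) (colfam H j) i l) (y l)
    + b j * \prod_l ip (colfam U j l) (y l)).
Proof.
apply: eq_bigr => j _; rewrite Atau_rho; congr (_ * _ + _).
by apply: eq_bigr => i _; rewrite Atau_rho.
Qed.

End ThetaLinear.

Section Nondeg.
Variables (R : realType) (k : nat) (n : 'I_k -> nat) (s t : nat).
Variables (U : mats R n t) (lm : 'I_t -> R) (d : tensor R n -> R -> R).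
Hypothesis k3 : (3 <= k)%N.
Hypothesis fU : feasible s U.
Hypothesis lm0 : forall j, lm j != 0.
Hypothesis tn : forall i, (t <= n i)%N.
Hypothesis dd : forall a, derivation (d a).
Hypothesis dl : forall c (a b : tensor R n) x, d [ffun z => c * a z + b z] x = c * d a x + d b x.
Hypothesis horth : forall a, (forall i, map_mx (d a) (U i) = 0) -> (forall j, d a (lm j) = 0) ->
  forall H b, tangent s U H -> Theta U lm H b a = 0.

Notation X := (dirs R n t).
Notation u j := (colfam U j).
Notation h xi j := (colfam (Hof xi) j).
Notation "'da' xi" := (d (aof U lm xi)) (at level 10, xi at level 8).
Notation Tan xi := (tangent s U (Hof xi)).
Notation Ker xi := (Tan xi /\ forall a, Theta U lm (Hof xi) (bof xi) a = 0).

Lemma slin_da x : slin (fun xi : X => da xi x).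
Proof. by move=> c xi eta; rewrite aof_lin dl. Qed.

Lemma uu j i : ip (u j i) (u j i) = 1.
Proof.
have [h1 h2] := fU i; case: (boolP (i < s)%N) => [/h1|/negP/h2 hh]; last exact/vnorm1/hh.
by move=> /matrixP/(_ j j); rewrite mulmx_diag_entry mxE eqxx.
Qed.

Lemma ip_colE (V W : mats R n t) i j l : ip (colfam V j i) (colfam W l i) = ((V i)^T *m W i) j l.
Proof. by rewrite mxE; apply: eq_bigr => a _; rewrite !mxE. Qed.

Lemma uo (i : 'I_k) j l : (i < s)%N -> j != l -> ip (u j i) (u l i) = 0.
Proof.
have [h1 _] := fU i => /h1 /matrixP/(_ j l) + /negPf jl.
by rewrite ip_colE => ->; rewrite mxE jl.
Qed.

Lemma tan_skew xi (i : 'I_k) j l : Tan xi -> (i < s)%N ->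
  ip (u j i) (h xi l i) = - ip (u l i) (h xi j i).
Proof.
move=> T is_; have [/(_ is_) /matrixP/(_ j l) + _] := T i.
rewrite [(0 : 'M[R]_t) j l]mxE mxE => /eqP; rewrite addr_eq0 => /eqP.
by rewrite -(ip_colE (Hof xi) U) -(ip_colE U (Hof xi)) => ->; rewrite ipC.
Qed.

Lemma tan_diag xi i j : Tan xi -> ip (u j i) (h xi j i) = 0.
Proof.
move=> T; case: (boolP (i < s)%N) => [is_|/negP is_].
  by have /eqP := tan_skew j j T is_; rewrite -addr_eq0 -mulr2n mulrn_eq0 => /eqP.
by have [_ /(_ is_) hh] := T i; apply: hh.
Qed.

Lemma prod_ip0 (x y : vfam R n) l : ip (x l) (y l) = 0 -> \prod_l ip (x l) (y l) = 0.
Proof. by move=> e; rewrite (bigD1 l) //= e mul0r. Qed.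

(** The test tensor is column [j0] with mode [i0] replaced by [w]. Tangency makes a column
    orthogonal to its own variation, so column [j0] contributes only through mode [i0] and [bof]. *)
Lemma test_column xi j0 i0 (w : vfam R n) : Tan xi ->
  Theta U lm (Hof xi) (bof xi) (rho (rep (u j0) w i0)) =
  lm j0 * ip (h xi j0 i0) (w i0) + bof xi j0 * ip (u j0 i0) (w i0) +
  \sum_(j | j != j0) (lm j * \sum_i \prod_l ip (rep (u j) (h xi j) i l) (rep (u j0) w i0 l)
    + bof xi j * \prod_l ip (u j l) (rep (u j0) w i0 l)).
Proof.
move=> T; rewrite Theta_rho (bigD1 j0) //=; congr (_ * _ + _ * _ + _).
  rewrite (bigD1 i0) //= [X in _ + X]big1 ?addr0 => [|i ii0].
    rewrite (bigD1 i0) //= !rep_same big1 ?mulr1 // => l li.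
    by rewrite !rep_other // uu.
  by apply: (@prod_ip0 _ _ i); rewrite rep_same rep_other // ipC tan_diag.
rewrite (bigD1 i0) //= rep_same big1 ?mulr1 // => l li.
by rewrite rep_other // uu.
Qed.

(* Two further orthonormal modes isolate one column. *)
Lemma ker_isolated xi j0 i0 (l1 l2 : 'I_k) : Ker xi -> l1 != l2 -> l1 != i0 -> l2 != i0 ->
  (l1 < s)%N -> (l2 < s)%N -> h xi j0 i0 = 0 /\ bof xi j0 = 0.
Proof.
move=> [T K] l12 l1i l2i l1s l2s.
have E w : lm j0 * ip (h xi j0 i0) (w i0) + bof xi j0 * ip (u j0 i0) (w i0) = 0.
  have := K (rho (rep (u j0) w i0)); rewrite test_column // [X in _ + X]big1 ?addr0 // => j jj.
  rewrite (@prod_ip0 _ _ l1) ?mulr0 ?addr0; last by rewrite rep_other // uo.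
  rewrite big1 ?mulr0 // => i _.
  have [il|il] := eqVneq l1 i.
    by apply: (@prod_ip0 _ _ l2); rewrite !rep_other // ?uo // -il eq_sym.
  by apply: (@prod_ip0 _ _ l1); rewrite !rep_other // uo.
have b0 : bof xi j0 = 0.
  by have := E (u j0); rewrite uu ipC tan_diag // mulr0 add0r mulr1.
split=> //; have /eqP := E (h xi j0); rewrite b0 mul0r addr0 mulf_eq0 (negPf (lm0 j0)).
by move=> /eqP/ip_eq0.
Qed.

Lemma ker_zero (xi : X) : (forall j i, h xi j i = 0) -> (forall j, bof xi j = 0) -> xi = 0.
Proof.
move=> hh hb; apply: dirs_eq0 => // i; apply/matrixP => a j.
by have /matrixP/(_ a ord0) := hh j i; rewrite !mxE.
Qed.

Lemma ker_trivial_ge3 xi : (3 <= s <= k)%N -> Ker xi -> xi = 0.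
Proof.
move=> /andP[s3 sk] K.
have P i0 : exists l1 l2 : 'I_k, [/\ l1 != l2, l1 != i0, l2 != i0, (l1 < s)%N & (l2 < s)%N].
  have k0 : (0 < k)%N by exact: leq_trans k3.
  have k1 : (1 < k)%N by exact: leq_trans k3.
  have k2 : (2 < k)%N by exact: leq_trans k3.
  have [e0|e0] := eqVneq (val i0) 0%N.
    exists (Ordinal k1), (Ordinal k2); rewrite -!val_eqE /= e0; split => //; exact: leq_trans s3.
  have [e1|e1] := eqVneq (val i0) 1%N.
    exists (Ordinal k0), (Ordinal k2); rewrite -!val_eqE /= e1; split => //; exact: leq_trans s3.
  exists (Ordinal k0), (Ordinal k1).
  by rewrite -!val_eqE /= ![_ == val i0]eq_sym e0 e1; split => //; exact: leq_trans s3.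
apply: ker_zero => [j i|j].
  by have [l1 [l2 [a b c e f]]] := P i; have [] := ker_isolated j K a b c e f.
have [l1 [l2 [a b c e f]]] := P (Ordinal (leq_trans (ltn0Sn 2) k3)).
by have [] := ker_isolated j K a b c e f.
Qed.

Definition dUzero xi (i : 'I_k) := map_mx (da xi) (U i) = 0.

(** [U^T H + H^T U] is symmetric, so its entries on and below the diagonal suffice. *)
Lemma kill_tangent : kill (\sum_(i : 'I_k) (if (i < s)%N then nle t else t)) (fun=> True) (fun xi : X => Tan xi).
Proof.
apply: (@kill_family _ _ _ _ (fun i (xi : X) =>
    ((i < s)%N -> (U i)^T *m Hof xi i + (Hof xi i)^T *m U i = 0) /\
  (~ (i < s)%N -> forall j, ip (col j (U i)) (col j (Hof xi i)) = 0))) => i.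
case: ifP => is_.
  have L (p : 'I_t * 'I_t) :
      slin (fun xi : X => ((U i)^T *m Hof xi i + (Hof xi i)^T *m U i) p.1 p.2).
    move=> c x y; have -> : (Hof (c *: x + y) i)^T = c *: (Hof x i)^T + (Hof y i)^T.
      by rewrite Hof_lin; apply/matrixP => a b; rewrite !mxE.
    rewrite Hof_lin mulmxDr -scalemxAr mulmxDl -scalemxAl.
    by rewrite !mxE; ring.
  have := @kill_fin _ _ _ [pred p : 'I_t * 'I_t | (p.2 <= p.1)%N] _ (fun=> True) L.
  apply: kill_weaken => // xi _ hx; split => // _; apply/matrixP => a b; rewrite [RHS]mxE.
  have [ab|ba] := leqP b a; first exact: (hx (a, b)).
  rewrite -[RHS](hx (b, a)) /=; last exact: ltnW.
  rewrite !mxE addrC; congr (_ + _); apply: eq_bigr => e _; rewrite !mxE mulrC //.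
have L j : slin (fun xi : X => ip (col j (U i)) (col j (Hof xi i))).
  move=> c x y; rewrite Hof_lin -ipZr -ipDr; congr ip; apply/matrixP => e f; by rewrite !mxE.
have := @kill_fin _ _ _ predT _ (fun=> True) L; rewrite card_ord.
by apply: kill_weaken => // xi _ hx; split => // _ j; apply: hx.
Qed.

Lemma slin_map_da p q (M : 'M[R]_(p, q)) a b : slin (fun xi : X => (map_mx (da xi) M) a b).
Proof. by move=> c x y; rewrite !mxE slin_da. Qed.

Lemma kill_dU_stiefel : kill (\sum_(i : 'I_k | (i < s)%N) (nlt t + (n i - t) * t)) (fun=> True)
   (fun xi : X => forall i : 'I_k, (i < s)%N -> dUzero xi i).
Proof.
apply: (@kill_family_cond _ _ _ _ _ (fun i xi => dUzero xi i)) => i is_.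
have [/(_ is_) st _] := fU i.
apply: (stiefel_kill st); first exact: slin_map_da.
move=> xi _; have := congr1 (map_mx (da xi)) st; rewrite der_mulmx // map_mx_tr addrC => ->.
by apply/matrixP => a b; rewrite !mxE der_nat.
Qed.

(* If the directions on which the derivatives of [U] and [lm] vanish are cut out by
   too few functionals, some [a = aof xi <> 0] is orthogonal to itself. *)
Lemma counting m g :
  kill m (fun=> True) (fun xi : X => (forall i : 'I_k, ~ (i < s)%N -> dUzero xi i) /\
                                     forall j, da xi (lm j) = 0) ->
  kill g (fun xi : X => Ker xi) (fun xi => xi = 0) ->
  (\sum_(i : 'I_k | ~~ (i < s)%N) (n i).-1 * t + t <= m + g)%N.
Proof.
move=> Km Kg.
have K : kill (\sum_(i : 'I_k) (if (i < s)%N then nle t else t) +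
    (\sum_(i : 'I_k | (i < s)%N) (nlt t + (n i - t) * t) + (m + g))) (fun=> True) (fun xi : X => xi = 0).
  apply: (@kill_weaken _ _ _ (fun=> True) _ (fun xi => Tan xi /\
    ((forall i : 'I_k, (i < s)%N -> dUzero xi i) /\ ((((forall i : 'I_k, ~ (i < s)%N -> dUzero xi i) /\
                                     forall j, da xi (lm j) = 0)) /\ xi = 0)))) => //.
    by move=> xi _ [_ [_ [_ ->]]].
  apply: kill_seq; first exact: kill_tangent.
  apply: kill_seq; first by apply: kill_weaken kill_dU_stiefel.
  apply: kill_seq; first by apply: kill_weaken Km.
  apply: kill_weaken Kg => // xi [[[_ T] hs] [hns hl]]; split => //.
  apply: Theta_aof; apply: horth => // i.
  by case: (boolP (i < s)%N) => [/hs|/negP/hns].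
(* An orthonormal block has [n i * t] entries, exactly used up by its tangency equations and its own
   derivatives; only the other modes and [lm] remain to be compared. *)
have := kill_dim K; rewrite card_coord.
have -> : (\sum_(i < k) (if (i < s)%N then nle t else t) =
    \sum_(i < k | (i < s)%N) nle t + \sum_(i < k | ~~ (i < s)%N) t)%N.
  rewrite (bigID (fun i : 'I_k => (i < s)%N)) /=.
  by congr addn; apply: eq_bigr => i; [move=> ->|move=> /negPf ->].
rewrite (bigID (fun i : 'I_k => (i < s)%N)) /=.
have -> : (\sum_(i < k | (i < s)%N) n i * t = \sum_(i < k | (i < s)%N) nle t +
    \sum_(i < k | (i < s)%N) (nlt t + (n i - t) * t))%N.
  rewrite -big_split; apply: eq_bigr => i _ /=.
  by rewrite addnA nlt_nle -mulnDl subnKC.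
have -> : (\sum_(i < k | ~~ (i < s)%N) n i * t = \sum_(i < k | ~~ (i < s)%N) t +
    \sum_(i < k | ~~ (i < s)%N) (n i).-1 * t)%N.
  rewrite -big_split; apply: eq_bigr => i _ /=.
  have := tn i; case: (n i) => [|m']; last by rewrite /= mulSn.
  by rewrite leqn0 => /eqP ->.
have arith a b c e p q : (a + b + (c + e) + p <= a + c + (b + q) -> e + p <= q)%N by lia.
exact: arith.
Qed.

End Nondeg.

(** * Nondegeneracy with two orthonormal modes *)

Lemma kill0_inv (R : realType) (X : lmodType R) (H Q : X -> Prop) :
  kill 0 H Q -> forall x, H x -> Q x.
Proof. by move=> [phi _ h] x Hx; apply: h => // -[]. Qed.

Lemma prod_sqr_eq1 (R : realDomainType) (I : finType) (P : pred I) (F : I -> R) :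
  (forall i, P i -> F i ^+ 2 <= 1) -> (\prod_(i | P i) F i) ^+ 2 = 1 ->
  forall i, P i -> F i ^+ 2 = 1.
Proof.
move=> h1 + i Pi; rewrite -prodrXl (bigD1 i) //= => e.
have h2 : \prod_(j | P j && (j != i)) F j ^+ 2 <= 1.
  apply: (@proj2 (0 <= \prod_(j | P j && (j != i)) F j ^+ 2)).
  elim/big_ind: _ => [//|x y [x0 x1] [y0 y1]|j /andP[/h1 ? _]]; last by rewrite sqr_ge0.
  by rewrite mulr_ge0 // mulr_ile1.
have h3 := h1 _ Pi.
apply/eqP; rewrite eq_le h3 /= -e ger_pMr //.
rewrite lt_def sqr_ge0 andbT; apply/negP => /eqP z; move: e; rewrite z mul0r => /eqP.
by rewrite eq_sym oner_eq0.
Qed.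

Section Two.
Variables (R : realType) (k : nat) (n : 'I_k -> nat) (t : nat).
Variables (U : mats R n t) (lm : 'I_t -> R) (d : tensor R n -> R -> R).
Hypothesis k3 : (3 <= k)%N.
Hypothesis fU : feasible 2 U.
Hypothesis lm0 : forall j, lm j != 0.
Hypothesis tn : forall i, (t <= n i)%N.
Hypothesis dd : forall a, derivation (d a).
Hypothesis dl : forall c (a b : tensor R n) x, d [ffun z => c * a z + b z] x = c * d a x + d b x.
Hypothesis horth : forall a, (forall i, map_mx (d a) (U i) = 0) -> (forall j, d a (lm j) = 0) ->
  forall H b, tangent 2 U H -> Theta U lm H b a = 0.

Notation X := (dirs R n t).
Notation u j := (colfam U j).
Notation h xi j := (colfam (Hof xi) j).
Notation "'da' xi" := (d (aof U lm xi)) (at level 10, xi at level 8).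
Notation Tan xi := (tangent 2 U (Hof xi)).
Notation Ker xi := (Tan xi /\ forall a, Theta U lm (Hof xi) (bof xi) a = 0).

Let m0 : 'I_k := Ordinal (leq_trans (isT : (0 < 3)%N) k3).
Let m1 : 'I_k := Ordinal (leq_trans (isT : (1 < 3)%N) k3).
Let m2 : 'I_k := Ordinal (leq_trans (isT : (2 < 3)%N) k3).

Definition cc l j := \prod_(i : 'I_k | ~~ (i < 2)%N) ip (u l i) (u j i).
(** For unit columns, [cc ^+ 2 = 1] forces columns [l] and [j] to be parallel in every mode beyond
    the first two. Similar pairs are the only ones along which [Theta] can degenerate. *)
Definition sim l j := (lm l ^+ 2 == lm j ^+ 2) && (cc l j ^+ 2 == 1).

Lemma other_modes (p q l : 'I_k) : (p < 2)%N -> (q < 2)%N -> p != q ->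
  (l != p) && (l != q) = ~~ (l < 2)%N.
Proof. by rewrite -!val_eqE /=; lia. Qed.

(** The test tensor agrees with column [j0] outside mode [p]. Another column [j] is orthogonal to it
    in mode [q], so only its variation in mode [q] survives. *)
Lemma ker_pair xi j0 (p q : 'I_k) (w : vfam R n) : Ker xi -> (forall j, bof xi j = 0) ->
  (p < 2)%N -> (q < 2)%N -> p != q ->
  lm j0 * ip (h xi j0 p) (w p) + \sum_(j | j != j0) lm j *
    (ip (u j p) (w p) * ip (h xi j q) (u j0 q) * cc j j0) = 0.
Proof.
move=> [T K] b0 p2 q2 pq.
rewrite -[RHS](K (rho (rep (u j0) w p))) (test_column lm fU) // b0 mul0r addr0; congr (_ + _).
apply: eq_bigr => j jj; rewrite b0 mul0r addr0; congr (_ * _).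
rewrite (bigD1 q) //= [X in _ + X]big1 ?addr0 => [|i iq]; last first.
  by apply: (@prod_ip0 _ _ _ _ _ q); rewrite !rep_other ?(uo fU) // eq_sym.
rewrite (bigD1 p) //= (bigD1 q) /=; last by rewrite eq_sym.
rewrite rep_other // !rep_same [rep (u j0) w p q]rep_other; last by rewrite eq_sym.
rewrite mulrA; congr (_ * _).
apply: eq_big => [l|l]; first by rewrite other_modes.
by move=> l2; have := other_modes l p2 q2 pq; rewrite l2 => /andP[lp lq]; rewrite !rep_other.
Qed.

(** [a] and [b] stand for the rotation rates of a pair of columns in the two orthonormal modes. The
    homogeneous system linking them allows a nonzero rate only for a similar pair. *)
Lemma sim_algebra (x y a b c : R) : x != 0 -> ~~ ((x ^+ 2 == y ^+ 2) && (c ^+ 2 == 1)) ->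
  y * a = x * (b * c) -> x * a = y * (b * c) -> y * b = x * (a * c) -> a = 0.
Proof.
move=> x0 hn e1 e2 e3; apply/eqP/negPn/negP => a0; case/negP: hn.
have xy : x ^+ 2 = y ^+ 2.
  apply: (mulIf a0); rewrite !expr2 -!mulrA e2 e1; ring.
rewrite xy eqxx /=.
have : y ^+ 2 * a * (c ^+ 2 - 1) = 0.
  have -> : y ^+ 2 * a * (c ^+ 2 - 1) = x ^+ 2 * a * c ^+ 2 - y * (y * a) by rewrite xy; ring.
  have -> : x ^+ 2 * a * c ^+ 2 = x * c * (x * (a * c)) by ring.
  by rewrite -e3 e1; ring.
move/eqP; rewrite -xy mulf_eq0 mulf_eq0 expf_eq0 /= (negPf x0) (negPf a0) /= subr_eq0 => /eqP ->.
by [].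
Qed.

Lemma cc_sym l j : cc l j = cc j l.
Proof. by apply: eq_bigr => i _; rewrite ipC. Qed.

Definition simpairs := [pred p : 'I_t * 'I_t | (p.1 < p.2)%N && sim p.1 p.2].

(** The modes beyond the first two and [bof] vanish by [ker_isolated]. What is left are two skew
    matrices coupled entry by entry, and at most one entry per similar pair stays free. *)
Lemma kill_ker2 : kill #|simpairs| (fun xi : X => Ker xi) (fun xi => xi = 0).
Proof.
have L (p : 'I_t * 'I_t) : slin (fun xi : X => ip (u p.1 m0) (h xi p.2 m0)).
  move=> c x y; rewrite -ipZr -ipDr; congr ip; rewrite /colfam Hof_lin.
  by apply/matrixP => e f; rewrite !mxE.
have := @kill_fin _ _ _ simpairs _ (fun xi : X => Ker xi) L.
apply: kill_weaken => // xi K hs.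
have [T _] := K.
have iso j (i : 'I_k) : ~~ (i < 2)%N -> h xi j i = 0 /\ bof xi j = 0.
  by move=> i2; apply: (@ker_isolated _ _ _ _ _ _ _ fU lm0 xi j i m0 m1 K) => //;
     rewrite -val_eqE /=; move: i2; lia.
have b0 j : bof xi j = 0 by have [] := iso j m2 isT.
have PE (p q : 'I_k) l j : (p < 2)%N -> (q < 2)%N -> p != q -> l != j ->
    lm j * ip (u l p) (h xi j p) = lm l * (ip (u l q) (h xi j q) * cc l j).
  move=> p2 q2 pq lj; have := ker_pair j (u l) K b0 p2 q2 pq.
  rewrite (bigD1 l) //= (uu fU) mul1r [X in _ + (_ + X)]big1 ?addr0; last first.
    by move=> j' /andP[_ jl]; rewrite (uo fU) // !mul0r mulr0.
  rewrite ipC => /eqP; rewrite addr_eq0 => /eqP ->.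
  by rewrite [ip (h xi l q) _]ipC (tan_skew j l T q2) mulNr mulrN opprK.
have sk (p : 'I_k) l j : (p < 2)%N -> ip (u j p) (h xi l p) = - ip (u l p) (h xi j p).
  by move=> p2; rewrite (tan_skew j l T p2).
have a0 l j : l != j -> ip (u l m0) (h xi j m0) = 0.
  move=> lj; have jl : j != l by rewrite eq_sym.
  case: (boolP (sim l j)) => hlj.
    case: (ltngtP l j) => [lt|lt|/val_inj e]; last by rewrite e eqxx in lj.
      by apply: (hs (l, j)); rewrite /= lt.
    rewrite sk // [ip _ _](hs (j, l)) ?oppr0 //= lt /= /sim eq_sym cc_sym.
    exact: hlj.
  apply: (@sim_algebra (lm l) (lm j) _ (ip (u l m1) (h xi j m1)) (cc l j)) => //.
  - exact: PE.
  - have := PE m0 m1 j l isT isT isT jl; rewrite (sk m0 l j isT) (sk m1 l j isT) cc_sym.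
    by rewrite mulrN mulNr mulrN => /oppr_inj.
  - exact: PE.
have a1 l j : l != j -> ip (u l m1) (h xi j m1) = 0.
  move=> lj; have := PE m1 m0 l j isT isT isT lj; rewrite a0 // mul0r mulr0 => /eqP.
  by rewrite mulf_eq0 (negPf (lm0 j)) => /eqP.
have aa (p : 'I_k) l j : (p < 2)%N -> ip (u l p) (h xi j p) = 0.
  have [->|lj] := eqVneq l j; first by move=> _; apply: (tan_diag _ _ T).
  move=> p2; have [p0|p0] := eqVneq p m0; first by rewrite p0 a0.
  have -> : p = m1 by apply: val_inj => /=; move: p2 p0; rewrite -val_eqE /=; lia.
  exact: a1.
apply: ker_zero => // j i.
case: (boolP (i < 2)%N) => [i2|/(iso j)[] //].
have [q [q2 iq]] : exists q : 'I_k, (q < 2)%N /\ i != q.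
  have [->|?] := eqVneq i m0; first by exists m1.
  by exists m0.
have := ker_pair j (h xi j) K b0 i2 q2 iq.
rewrite big1 ?addr0 => [/eqP|l lj]; last by rewrite aa // !mul0r mulr0.
by rewrite mulf_eq0 (negPf (lm0 j)) => /eqP/ip_eq0.
Qed.

Let D2 := (\sum_(i : 'I_k | ~~ (i < 2)%N) (n i).-1)%N.

(** A column similar to an earlier one equals it up to sign in each of the modes counted here, and
    so does its [lm]; its derivatives then vanish for free. *)
Lemma kill_param2 :
  kill (\sum_(j < t) (if [exists l : 'I_t, (l < j)%N && sim l j] then 0 else D2 + 1)) (fun=> True)
    (fun xi : X => (forall i : 'I_k, ~ (i < 2)%N -> dUzero U lm d xi i) /\
                                     forall j, da xi (lm j) = 0).
Proof.
pose Q j (xi : X) := (forall i : 'I_k, ~~ (i < 2)%N -> map_mx (da xi) (u j i) = 0) /\ da xi (lm j) = 0.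
apply: (@kill_weaken _ _ _ (fun=> True) _ (fun xi => forall j, Q j xi)) => //.
  move=> xi _ hQ; split=> [i /negP i2|j]; last by case: (hQ j).
  apply/matrixP => a j; have [/(_ i i2)/matrixP/(_ a ord0) + _] := hQ j.
  by rewrite !mxE.
apply: kill_ord => j; case: ifP => [/existsP[l /andP[lj /andP[/eqP e1 /eqP e2]]]|_].
  apply: kill0 => xi [_ /(_ l lj)[h1 h2]]; split=> [i i2|].
    have ci : ip (u l i) (u j i) ^+ 2 = 1.
      apply: (prod_sqr_eq1 _ e2) => // i' _.
      by apply: ip_unit_le1; apply: (uu fU).
    have e3 : u j i = ip (u j i) (u l i) *: u l i.
      by apply: unit_parallel; rewrite ?(uu fU) // ipC.
    rewrite ipC in ci; move/eqP: ci; rewrite sqrf_eq1 => /orP[] /eqP ci.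
      by rewrite e3 ci scale1r h1.
    rewrite e3 ci scaleN1r; apply/matrixP => a b.
    have /matrixP/(_ a b) := h1 i i2; rewrite !mxE => e4.
    by rewrite derN // e4 oppr0.
  move/eqP: e1; rewrite eqf_sqr => /orP[/eqP <- //|/eqP e].
  by rewrite -[lm j]opprK -e derN // h2 oppr0.
apply: kill_seq; last by rewrite -[1%N]/(1%N); apply: kill1; exact: slin_da.
apply: (@kill_family_cond _ _ _ _ _ (fun i (xi : X) => map_mx (da xi) (u j i) = 0)) => i i2.
apply: unit_kill; [exact: (uu fU)|by move=> a; apply: slin_map_da|].
by move=> xi _; apply: der_unit => //; apply: (uu fU).
Qed.

(** A column with similar predecessors saves [D2 + 1] functionals and adds at most its index, which
    is less than [t <= D2 + 1], to the kernel bound. One similar pair would therefore make the count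
    too small. *)
Lemma ker_trivial_2 xi : Ker xi -> xi = 0.
Proof.
have cnt := counting k3 fU tn dd dl horth kill_param2 kill_ker2.
case: (posnP #|simpairs|) => [e|/card_gt0P[[l1 j1] /andP[/= lj1 sj1]]].
  by have := kill_ker2; rewrite e => /kill0_inv; apply.
exfalso.
have tpos : (0 < t)%N by exact: leq_ltn_trans (ltn_ord l1).
have D2t : (t <= D2 + 1)%N.
  rewrite /D2 (bigD1 m2) //=; have := tn m2; lia.
have cE : #|simpairs| = (\sum_(j < t) #|[pred l : 'I_t | (l < j)%N && sim l j]|)%N.
  rewrite -sum1_card (eq_bigl (fun p : 'I_t * 'I_t => (p.1 < p.2)%N && sim p.1 p.2)) //.
  rewrite -(pair_big_dep predT (fun l j : 'I_t => (l < j)%N && sim l j) (fun _ _ => 1%N)) /=.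
  rewrite (exchange_big_dep predT) //=; apply: eq_bigr => j _.
  by rewrite sum1_card.
have lt_j (j : 'I_t) : (#|[pred l : 'I_t | (l < j)%N && sim l j]| <= j)%N.
  apply: (@leq_trans #|[pred l : 'I_t | (l < j)%N]|).
    by apply: subset_leq_card; apply/fintype.subsetP => l; rewrite !inE => /andP[].
  rewrite -sum1_card (eq_bigl (fun l : 'I_t => (l < j)%N)) //.
  by rewrite (big_ord_narrow (ltnW (ltn_ord j))) sum_nat_const card_ord muln1.
suff : (\sum_(j < t) (if [exists l : 'I_t, (l < j)%N && sim l j] then 0 else D2 + 1) + #|simpairs|
   < \sum_(j < t) (D2 + 1))%N.
  rewrite sum_nat_const card_ord; move: cnt; rewrite -big_distrl /= -/D2.
  move=> h1 h2; have := leq_ltn_trans h1 h2; rewrite mulnDr muln1 mulnC; lia.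
rewrite cE -big_split /= (bigD1 j1) //= [X in (_ < X)%N](bigD1 j1) //= -addSn.
apply: leq_add.
  have -> : [exists l : 'I_t, (l < j1)%N && sim l j1] by apply/existsP; exists l1; rewrite lj1.
  rewrite add0n; apply: leq_ltn_trans (lt_j j1) _; exact: leq_trans (ltn_ord j1) D2t.
apply: leq_sum => j _; case: ifP => [_|/negbT/existsPn h0].
  by rewrite add0n (leq_trans (lt_j j)) // (leq_trans _ D2t) // ltnW.
by rewrite eq_card0 ?addn0 // => l; rewrite !inE; apply/negbTE.
Qed.

End Two.

(** * Nondegeneracy with one orthonormal mode *)

(** Take a matrix of maximal rank among those with all rows in [S]. *)
Lemma subspace_matrix (R : fieldType) m (S : 'rV[R]_m -> Prop) :
  S 0 -> (forall c x y, S x -> S y -> S (c *: x + y)) ->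
  exists B : 'M[R]_m, forall x, S x <-> (x <= B)%MS.
Proof.
move=> S0 Slin.
have Ssub (B : 'M[R]_m) : (forall i, S (row i B)) -> forall x, (x <= B)%MS -> S x.
  move=> hB x /submxP[v ->]; rewrite mulmx_sum_row.
  elim: (index_enum _) => [|i r IH]; first by rewrite big_nil.
  by rewrite big_cons; apply: Slin.
pose P r := `[< exists B : 'M[R]_m, (forall i, S (row i B)) /\ \rank B = r >].
have ex : exists r, P r.
  by exists 0%N; apply/asboolP; exists 0; rewrite mxrank0; split => // i; rewrite row0.
have ub r : P r -> (r <= m)%N by move=> /asboolP[B [_ <-]]; exact: rank_leq_row.
case: (ex_maxnP ex ub) => r /asboolP[B [SB rB]] rmax.
exists B => x; split=> [Sx|]; last exact: Ssub.
apply/negPn/negP => xB.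
have SD : forall i, S (row i (B + x)%MS).
  move=> i; have : (row i (B + x)%MS <= B + x)%MS by exact: row_sub.
  move=> /sub_addsmxP[[v w] /= ->]; rewrite -[v *m B]scale1r; apply: (Slin).
    by apply: Ssub SB _ _; apply: submxMl.
  by rewrite [w]mx11_scalar mul_scalar_mx -[_ *: x]addr0; apply: (Slin).
have : (\rank (B + x)%MS <= r)%N by apply: rmax; apply/asboolP; exists (B + x)%MS.
rewrite leqNgt -rB => /negP; apply.
have : (B < B + x)%MS by rewrite ltmxE addsmxSl addsmx_sub submx_refl (negPf xB).
by rewrite ltmxErank => /andP[].
Qed.

Section KillMatrix.
Variables (R : realType) (X : lmodType R) (t : nat).
Lemma kill_rowspace (B : 'M[R]_t) (g : X -> 'rV[R]_t) (H : X -> Prop) :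
  (forall a, slin (fun x => g x ord0 a)) -> (forall x, H x -> (g x <= B)%MS) ->
  kill (\rank B) H (fun x => g x = 0).
Proof.
move=> lg hg.
exists (fun i x => (g x *m pinvmx (row_base B)) ord0 i).
  move=> i c x y; rewrite !mxE mulr_sumr -big_split; apply: eq_bigr => e _ /=.
  by rewrite lg; ring.
move=> x /hg; rewrite -(eq_row_base B) => /submxP[v e] h0.
rewrite e (_ : v = 0) ?mul0mx //; apply/matrixP => a b; rewrite ord1 [RHS]mxE -(h0 b) e.
by rewrite -mulmxA mulmxVp ?row_base_free // mulmx1.
Qed.
End KillMatrix.

Section One.
Variables (R : realType) (k : nat) (n : 'I_k -> nat) (t : nat).
Variables (U : mats R n t) (lm : 'I_t -> R) (d : tensor R n -> R -> R).
Hypothesis k3 : (3 <= k)%N.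
Hypothesis fU : feasible 1 U.
Hypothesis lm0 : forall j, lm j != 0.
Hypothesis tn : forall i, (t <= n i)%N.
Hypothesis t0 : (0 < t)%N.
Hypothesis dd : forall a, derivation (d a).
Hypothesis dl : forall c (a b : tensor R n) x, d [ffun z => c * a z + b z] x = c * d a x + d b x.
Hypothesis horth : forall a, (forall i, map_mx (d a) (U i) = 0) -> (forall j, d a (lm j) = 0) ->
  forall H b, tangent 1 U H -> Theta U lm H b a = 0.

Notation X := (dirs R n t).
Notation u j := (colfam U j).
Notation h xi j := (colfam (Hof xi) j).
Notation "'da' xi" := (d (aof U lm xi)) (at level 10, xi at level 8).
Notation Tan xi := (tangent 1 U (Hof xi)).
Notation Ker xi := (Tan xi /\ forall a, Theta U lm (Hof xi) (bof xi) a = 0).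

Let m0 : 'I_k := Ordinal (leq_trans (isT : (0 < 3)%N) k3).
Let m1 : 'I_k := Ordinal (leq_trans (isT : (1 < 3)%N) k3).
Let m2 : 'I_k := Ordinal (leq_trans (isT : (2 < 3)%N) k3).

Lemma mode0 (i : 'I_k) : (i < 1)%N = (i == m0).
Proof. by rewrite -val_eqE /=; lia. Qed.

(* The slot of the orthonormal mode is frozen to a rational unit vector, so that
   [xx j] encodes the tensor product of the columns [j] of the other modes. *)
Definition e0 : vfam R n := fun l => \col_a (nat_of_ord a == 0)%:R.
Definition xx j : vfam R n := rep (u j) e0 m0.
(** The tangent vector, at [xx o], to the cone of rank-one tensors, with velocity [p] in the modes
    other than [m0]. *)
Definition TM o (p : vfam R n) (a : tensor R n) : R :=
  \sum_(i | i != m0) Atau a (rep (xx o) p i).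

Lemma ip_e0 : ip (e0 m0) (e0 m0) = 1.
Proof.
have n0 : (0 < n m0)%N by exact: leq_trans t0 (tn m0).
rewrite /ip (bigD1 (Ordinal n0)) //= mxE /= mulr1 big1 ?addr0 // => a ae.
rewrite mxE (_ : (nat_of_ord a == 0%N) = false) ?mulr0 //.
by apply: contra_neqF ae => /eqP a0; apply: val_inj.
Qed.

Lemma xx1 j i : ip (xx j i) (xx j i) = 1.
Proof.
rewrite /xx; have [->|im] := eqVneq i m0; first by rewrite rep_same ip_e0.
by rewrite rep_other // (uu fU).
Qed.

Lemma xxE j i : i != m0 -> xx j i = u j i.
Proof. by move=> im; rewrite /xx rep_other. Qed.

Definition tlin (F : tensor R n -> R) :=
  forall c (a b : tensor R n), F [ffun z => c * a z + b z] = c * F a + F b.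

(** The coordinate tensors are themselves of rank one. *)
Lemma Atau_basis (F : tensor R n -> R) (G : tensor R n -> R) :
  tlin F -> tlin G -> (forall y, F (rho y) = G (rho y)) -> forall a, F a = G a.
Proof.
move=> lF lG FG a.
have z0 (K : tensor R n -> R) : tlin K -> K [ffun=> 0] = 0.
  move=> lK; have := lK (-1) [ffun=> 0] [ffun=> 0]; rewrite mulN1r addNr => e.
  by rewrite -[RHS]e; congr K; apply/ffunP => z; rewrite !ffunE mulr0 addr0.
have expand (K : tensor R n -> R) : tlin K ->
    K a = \sum_z a z * K (dlt R z).
  move=> lK; have gen (r : seq (idx n)) : K [ffun z => \sum_(z' <- r) a z' * dlt R z' z] = \sum_(z <- r) a z * K (dlt R z).
    elim: r => [|z r IH].
      rewrite big_nil -[RHS](z0 K lK); congr K; apply/ffunP => z; by rewrite !ffunE big_nil.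
    rewrite big_cons -IH -lK; congr K; apply/ffunP => z'; by rewrite !ffunE big_cons !ffunE.
  rewrite -gen; congr K; apply/ffunP => z; rewrite ffunE (bigD1 z) //= ffunE eqxx mulr1.
  by rewrite big1 ?addr0 // => z' zz; rewrite ffunE eq_sym (negPf zz) mulr0.
rewrite (expand F lF) (expand G lG); apply: eq_bigr => z _; congr (_ * _).
have -> : dlt R z = rho (fun l => \col_a (a == z l)%:R); last exact: FG.
apply/ffunP => z'; rewrite !ffunE; have [->|zz] := eqVneq z' z.
  by rewrite big1 // => l _; rewrite mxE eqxx.
have [l zl] : exists l, z' l != z l.
  by apply: contrapT => /forallNP hz; case/eqP: zz; apply/ffunP => l; apply/eqP/negPn/negP/hz.
by rewrite (bigD1 l) //= mxE (negPf zl) mul0r.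
Qed.

Lemma TM_lin o p c (a b : tensor R n) : TM o p [ffun z => c * a z + b z] = c * TM o p a + TM o p b.
Proof.
by rewrite /TM mulr_sumr -big_split; apply: eq_bigr => i _; rewrite Atau_lin.
Qed.

Lemma TM_plin o (p q : vfam R n) c a : TM o (fun l => c *: p l + q l) a = c * TM o p a + TM o q a.
Proof.
by rewrite /TM mulr_sumr -big_split; apply: eq_bigr => i _; rewrite Atau_lin_slot.
Qed.

(* [L o x]: the combination with coefficients [x] of the rank-one tensors [xx j]
   lies in the tangent space, at [xx o], of the cone of rank-one tensors. *)
Definition comb (x : 'rV[R]_t) (a : tensor R n) : R := \sum_j x ord0 j * Atau a (xx j).
Definition L o (x : 'rV[R]_t) : Prop := exists p, forall a, comb x a = TM o p a.

Lemma comb_lin x c (a b : tensor R n) : comb x [ffun z => c * a z + b z] = c * comb x a + comb x b.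
Proof.
rewrite /comb mulr_sumr -big_split; apply: eq_bigr => j _ /=; rewrite Atau_lin; ring.
Qed.

Lemma combD c x y a : comb (c *: x + y) a = c * comb x a + comb y a.
Proof.
rewrite /comb mulr_sumr -big_split; apply: eq_bigr => j _ /=; rewrite !mxE; ring.
Qed.

Lemma comb0 a : comb 0 a = 0.
Proof. by apply: big1 => j _; rewrite mxE mul0r. Qed.

Lemma comb_delta j a : comb (delta_mx ord0 j) a = Atau a (xx j).
Proof.
rewrite /comb (bigD1 j) //= mxE !eqxx mul1r big1 ?addr0 // => l lj.
by rewrite mxE (negPf lj) andbF mul0r.
Qed.

Lemma TM_self o a c : TM o (fun l => if l == m1 then c *: u o l else 0) a = c * Atau a (xx o).
Proof.
rewrite /TM (bigD1 m1) //= [X in _ + X]big1 ?addr0; last first.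
  by move=> i /andP[_ i1]; apply: (@Atau_slot0 _ _ _ _ _ i); rewrite rep_same (negPf i1).
rewrite Atau_rep eqxx ipZr; congr (_ * _).
by rewrite (Atau_slot _ _ m1) /xx rep_other.
Qed.

Lemma L_lin o c x y : L o x -> L o y -> L o (c *: x + y).
Proof.
move=> [p hp] [q hq]; exists (fun l => c *: p l + q l) => a.
by rewrite combD TM_plin hp hq.
Qed.

Lemma L_0 o : L o 0.
Proof.
exists (fun=> 0) => a; rewrite comb0 /TM big1 // => i _.
by apply: (@Atau_slot0 _ _ _ _ _ i); rewrite rep_same.
Qed.

Lemma L_delta o : L o (delta_mx ord0 o).
Proof.
exists (fun l => if l == m1 then 1 *: u o l else 0) => a.
by rewrite TM_self mul1r comb_delta.
Qed.

Lemma test_xx j (y : vfam R n) : Atau (rho y) (xx j) = ip (e0 m0) (y m0) * \prod_(l | l != m0) ip (u j l) (y l).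
Proof.
rewrite Atau_rho (bigD1 m0) //= /xx rep_same; congr (_ * _).
by apply: eq_bigr => l lm'; rewrite rep_other.
Qed.

(* The equation [Theta xi = 0] contracted with [w] in the orthonormal mode. *)
Lemma ker_contract xi (w : 'cV[R]_(n m0)) a : Ker xi ->
  comb (\row_j (lm j * ip (h xi j m0) w)) a +
  \sum_j ip (u j m0) w * (lm j * TM j (h xi j) a + bof xi j * Atau a (xx j)) = 0.
Proof.
move=> [T K]; move: a.
pose F a := comb (\row_j (lm j * ip (h xi j m0) w)) a +
  \sum_j ip (u j m0) w * (lm j * TM j (h xi j) a + bof xi j * Atau a (xx j)).
apply: (@Atau_basis F (fun=> 0)) => [c a b|c a b|y].
- rewrite /F comb_lin mulrDr mulr_sumr addrACA -big_split; congr (_ + _); apply: eq_bigr => j _ /=.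
  by rewrite TM_lin Atau_lin; ring.
- by rewrite mulr0 addr0.
have [w' ww'] : exists w' : vfam R n, w' m0 = w.
  by exists (@dfwith _ (fun i => 'cV[R]_(n i)) (fun=> 0) m0 w); rewrite dfwith_in.
have E0 := K (rho (rep y w' m0)); rewrite Theta_rho in E0.
rewrite /F; apply: etrans (etrans (congr1 ( *%R (ip (e0 m0) (y m0))) E0) (mulr0 _)).
rewrite /comb -big_split mulr_sumr.
have PA (x : vfam R n) : \prod_l ip (x l) (rep y w' m0 l) =
    ip (x m0) w * \prod_(l | l != m0) ip (x l) (y l).
  rewrite (bigD1 m0) //= rep_same ww'; congr (_ * _).
  by apply: eq_bigr => l lm'; rewrite rep_other.
apply: eq_bigr => j _ /=; rewrite mxE test_xx PA.
set PJ := \prod_(l | l != m0) ip (u j l) (y l).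
rewrite [\sum_i \prod_l _](bigD1 m0) //= PA rep_same.
have -> : \prod_(l | l != m0) ip (rep (u j) (h xi j) m0 l) (y l) = PJ.
  by apply: eq_bigr => l lm'; rewrite rep_other.
have -> : \sum_(i | i != m0) \prod_l ip (rep (u j) (h xi j) i l) (rep y w' m0 l) =
    ip (u j m0) w * \sum_(i | i != m0) \prod_(l | l != m0) ip (rep (u j) (h xi j) i l) (y l).
  rewrite mulr_sumr; apply: eq_bigr => i im; rewrite PA rep_other //.
  by rewrite eq_sym.
have -> : TM j (h xi j) (rho y) = ip (e0 m0) (y m0) *
    \sum_(i | i != m0) \prod_(l | l != m0) ip (rep (u j) (h xi j) i l) (y l).
  rewrite mulr_sumr; apply: eq_bigr => i im; rewrite Atau_rho (bigD1 m0) //= rep_other; last by rewrite eq_sym.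
  rewrite /xx rep_same; congr (_ * _); apply: eq_bigr => l lm'.
  by congr ip; rewrite /rep (negPf lm').
ring.
Qed.

(** The matrix [U^T H] of the orthonormal mode, skew on tangent vectors. *)
Definition om (xi : X) (l j : 'I_t) : R := ip (u l m0) (h xi j m0).
Definition rw (xi : X) l : 'rV[R]_t := \row_j (lm j * om xi l j).

Lemma slin_h (w : vfam R n) j i : slin (fun xi : X => ip (w i) (h xi j i)).
Proof.
move=> c x y; rewrite -ipZr -ipDr; congr ip; rewrite /colfam Hof_lin.
by apply/matrixP => e f; rewrite !mxE.
Qed.

Lemma slin_rw l j : slin (fun xi : X => rw xi l ord0 j).
Proof. by move=> c x y; rewrite !mxE /om slin_h; ring. Qed.

(** Contracting [Theta xi = 0] with [u l] in the orthonormal mode leaves only column [l] in the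
    second sum, and this is a tangent vector at [xx l]. *)
Lemma row_L xi l : Ker xi -> L l (rw xi l).
Proof.
move=> K; exists (fun i => - lm l *: h xi l i + (if i == m1 then - bof xi l *: u l i else 0)) => a.
rewrite TM_plin TM_self; have := ker_contract (u l m0) a K.
rewrite (bigD1 l) //= (uu fU) mul1r [X in _ + (_ + X)]big1 ?addr0 => [|j jl]; last first.
  by rewrite (uo fU) ?mul0r // mode0.
have -> : rw xi l = \row_j (lm j * ip (h xi j m0) (u l m0)).
  by apply/rowP => j; rewrite !mxE /om ipC.
by move=> /eqP; rewrite addr_eq0 => /eqP ->; ring.
Qed.

Lemma om_skew xi l j : Tan xi -> om xi l j = - om xi j l.
Proof. by move=> T; rewrite /om (tan_skew l j T) // mode0. Qed.

Lemma normal_rel xi (w : 'cV[R]_(n m0)) : Ker xi -> (forall j, ip (u j m0) w = 0) ->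
  forall a, comb (\row_j (lm j * ip (h xi j m0) w)) a = 0.
Proof.
move=> K hw a; have := ker_contract w a K; rewrite big1 ?addr0 // => j _.
by rewrite hw mul0r.
Qed.

(** Orthogonality of [v] makes [TM l v] orthogonal to [xx l], which gives [mu = 0]; testing with one
    slot of [xx l] replaced by [v] then isolates [v i]. *)
Lemma TM_self_zero l (v : vfam R n) mu : (forall i, i != m0 -> ip (u l i) (v i) = 0) ->
  (forall a, TM l v a = mu * Atau a (xx l)) -> mu = 0 /\ forall i, i != m0 -> v i = 0.
Proof.
move=> hv E.
have mu0 : mu = 0.
  have := E (rho (xx l)); rewrite Atau_rho big1 ?mulr1 => [<-|i _]; last exact: xx1.
  apply: big1 => i im; rewrite Atau_rho; apply: (@prod_ip0 _ _ _ _ _ i).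
  by rewrite rep_same xxE // ipC hv.
split=> // i im.
have := E (rho (rep (xx l) v i)); rewrite mu0 mul0r /TM (bigD1 i) //= [X in _ + X]big1 ?addr0; last first.
  move=> i' /andP[im' ii']; rewrite Atau_rho; apply: (@prod_ip0 _ _ _ _ _ i).
  by rewrite rep_same rep_other ?xxE ?hv // eq_sym.
rewrite Atau_rho (bigD1 i) //= !rep_same big1 ?mulr1 => [/ip_eq0 //|l' li].
by rewrite !rep_other // xx1.
Qed.

Lemma ker_zero1 xi : Ker xi -> (forall j, h xi j m0 = 0) -> xi = 0.
Proof.
move=> K h0.
have R0 l a : lm l * TM l (h xi l) a + bof xi l * Atau a (xx l) = 0.
  have := ker_contract (u l m0) a K; rewrite (bigD1 l) //= (uu fU) mul1r.
  rewrite [X in _ + (_ + X)]big1 ?addr0 => [|j jl]; last by rewrite (uo fU) ?mul0r // mode0.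
  by rewrite [comb _ _]big1 ?add0r // => j _; rewrite mxE h0 ip0l mulr0 mul0r.
have [T _] := K.
have z l : - (bof xi l) / lm l = 0 /\ forall i, i != m0 -> h xi l i = 0.
  apply: TM_self_zero => [i _|a]; first exact: tan_diag.
  apply: (mulfI (lm0 l)); move/eqP: (R0 l a); rewrite addr_eq0 => /eqP ->.
  by field; exact: lm0.
apply: ker_zero => [j i|j].
  by have [->|im] := eqVneq i m0; [exact: h0|have [_ +] := z j; apply].
have [/eqP + _] := z j; rewrite mulf_eq0 invr_eq0 (negPf (lm0 j)) orbF oppr_eq0.
by move/eqP.
Qed.

Definition dm (xi : X) (l : 'I_t) := forall i : 'I_k, i != m0 -> map_mx (da xi) (u l i) = 0.

Lemma der_xx xi l i : dfam (da xi) (xx l) i = if i == m0 then 0 else map_mx (da xi) (u l i).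
Proof.
rewrite /dfam /xx; have [->|im] := eqVneq i m0; last by rewrite rep_other.
rewrite rep_same; apply/matrixP => a b; rewrite !mxE; exact: der_nat.
Qed.

Lemma der_comb1 xi l a : da xi (Atau a (xx l)) =
  Atau [ffun z => da xi (a z)] (xx l) + TM l (dfam (da xi) (u l)) a.
Proof.
rewrite der_Atau //; congr (_ + _); rewrite (bigD1 m0) //= (@Atau_slot0 _ _ _ _ _ m0) ?add0r; last first.
  by rewrite rep_same der_xx eqxx.
apply: eq_bigr => i im; apply: Atau_ext => l'; rewrite /rep; case: eqP => // ->.
by rewrite der_xx (negPf im).
Qed.

Lemma der_TM xi o p a : dm xi o -> da xi (TM o p a) =
  TM o p [ffun z => da xi (a z)] + TM o (dfam (da xi) p) a.
Proof.
move=> h0; rewrite /TM der_sum // -big_split; apply: eq_bigr => i im /=.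
rewrite der_Atau //; congr (_ + _).
rewrite (bigD1 i) //= [X in _ + X]big1 ?addr0 => [|l li].
  by apply: Atau_ext => l'; rewrite /rep /dfam; case: (eqVneq l' i) => // ->; rewrite eqxx.
apply: (@Atau_slot0 _ _ _ _ _ l); rewrite rep_same /dfam rep_other //.
rewrite -/(dfam _ _ _) -[LHS]/(dfam (da xi) (xx o) l) der_xx; case: eqP => // /eqP lm'.
exact: h0.
Qed.

(** The terms in which the derivation falls on the test tensor cancel by the relation itself. The
    columns in [S] and [o] are constant, so only the coefficients, [p] and column [l] get
    differentiated. *)
Lemma der_relation xi l (S : {set 'I_t}) (c : 'rV[R]_t) o p :
  (forall j, j \in S -> dm xi j) -> dm xi o ->
  (forall a, Atau a (xx l) = \sum_(j in S) c ord0 j * Atau a (xx j) + TM o p a) ->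
  forall a, TM l (dfam (da xi) (u l)) a =
     \sum_(j in S) da xi (c ord0 j) * Atau a (xx j) + TM o (dfam (da xi) p) a.
Proof.
move=> hS ho E a.
have := congr1 (da xi) (E a).
rewrite der_comb1 (derD (dd _)) der_TM // (der_sum (dd _)).
have -> : \sum_(j in S) da xi (c ord0 j * Atau a (xx j)) = \sum_(j in S)
    (da xi (c ord0 j) * Atau a (xx j) + c ord0 j * Atau [ffun z => da xi (a z)] (xx j)).
  apply: eq_bigr => j jS; rewrite (derM (dd _)) der_comb1; congr (_ + _ * _).
  rewrite [X in _ + X]big1 ?addr0 // => i im; apply: (@Atau_slot0 _ _ _ _ _ i).
  by rewrite rep_same; apply: hS.
rewrite big_split /= E; lra.
Qed.

Lemma du_orth xi l i : ip (u l i) (dfam (da xi) (u l) i) = 0.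
Proof. by apply: der_unit => //; apply: (uu fU). Qed.

Lemma slin_dc (c c' x y : R) : slin (fun xi : X => da xi x * c - c' * da xi y).
Proof.
apply: slinB; last exact/slinZ/(slin_da _ _ dl).
by move=> a xi eta; rewrite slin_da //; ring.
Qed.

(** The coefficients [c] need to be constant only up to a common factor, which spares one
    functional: if their derivatives are proportional to [c], the differentiated relation makes
    [TM l] of the derivative a multiple of [xx l], and [TM_self_zero] applies. *)
Lemma dep_kill l (S : {set 'I_t}) (c : 'rV[R]_t) :
  (forall a, Atau a (xx l) = \sum_(j in S) c ord0 j * Atau a (xx j)) ->
  kill #|S|.-1 (fun xi : X => forall j, j \in S -> dm xi j) (fun xi => dm xi l).
Proof.
move=> E.
have [j0 j0S cj0] : exists2 j, j \in S & c ord0 j != 0.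
  apply: contrapT => hn; have := E (rho (xx l)).
  rewrite Atau_rho big1 => [|i _]; last exact: xx1.
  rewrite big1 => [/eqP|j jS]; first by rewrite oner_eq0.
  by apply/eqP; rewrite mulf_eq0; apply/orP; left; apply/negPn/negP => cj; apply: hn; exists j.
have := @kill_fin _ _ _ (mem (S :\ j0)) (fun j xi => da xi (c ord0 j) * c ord0 j0 - c ord0 j * da xi (c ord0 j0))
   (fun xi : X => forall j, j \in S -> dm xi j) (fun j => slin_dc _ _ _ _).
rewrite (cardsD1 j0 S) j0S add1n /=.
apply: kill_weaken => // xi hS hc.
set mu := da xi (c ord0 j0) / c ord0 j0.
have Ec j : j \in S -> da xi (c ord0 j) = mu * c ord0 j.
  move=> jS; have [->|jj] := eqVneq j j0; first by rewrite /mu divfK.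
  have /eqP : da xi (c ord0 j) * c ord0 j0 - c ord0 j * da xi (c ord0 j0) = 0.
    by apply: hc; rewrite !inE jj jS.
  rewrite subr_eq0 => /eqP e.
  by apply: (mulIf cj0); rewrite e /mu; field.
have [_ hv] : mu = 0 /\ forall i, i != m0 -> dfam (da xi) (u l) i = 0.
  apply: TM_self_zero => [i im|a]; first exact: du_orth.
  have Eo a' : Atau a' (xx l) = \sum_(j in S) c ord0 j * Atau a' (xx j) + TM j0 (fun=> 0) a'.
    rewrite E [TM _ _ _]big1 ?addr0 // => i im; apply: (@Atau_slot0 _ _ _ _ _ i).
    by rewrite rep_same.
  rewrite (der_relation hS (hS _ j0S) Eo) [TM _ _ _]big1 ?addr0; last first.
    move=> i im; apply: (@Atau_slot0 _ _ _ _ _ i); rewrite rep_same /dfam.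
    by apply/matrixP => e f; rewrite !mxE der0.
  by rewrite E mulr_sumr; apply: eq_bigr => j jS; rewrite Ec // mulrA.
by move=> i im; apply: hv.
Qed.

(** Each term alters a single mode, so one of the two orthogonality relations survives. *)
Lemma TM_rho0 o p (y : vfam R n) (i i' : 'I_k) : i != m0 -> i' != m0 -> i != i' ->
  ip (u o i) (y i) = 0 -> ip (u o i') (y i') = 0 -> TM o p (rho y) = 0.
Proof.
move=> im im' ii' e1 e2; apply: big1 => r rm; rewrite Atau_rho.
have [ri|ri] := eqVneq r i.
  by apply: (@prod_ip0 _ _ _ _ _ i'); rewrite rep_other ?xxE // ri eq_sym.
by apply: (@prod_ip0 _ _ _ _ _ i); rewrite rep_other ?xxE // eq_sym.
Qed.

Definition perp o l : vfam R n := fun i => u l i - ip (u o i) (u l i) *: u o i.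

Lemma perp_o o l i : ip (u o i) (perp o l i) = 0.
Proof. by rewrite /perp ipDr ipNr ipZr (uu fU) mulr1 subrr. Qed.

Lemma perp_l o l i : ip (u l i) (perp o l i) = 1 - ip (u o i) (u l i) ^+ 2.
Proof. by rewrite /perp ipDr ipNr ipZr (uu fU) (ipC (u l i)) expr2. Qed.

(* In two modes where [xx l] is not parallel to [xx o], a vector tangent to the rank-one
   cone at both points (modulo [xx l]) is determined by two inner products. *)
Lemma two_modes o l (v p : vfam R n) mu (i i' : 'I_k) :
  i != m0 -> i' != m0 -> i != i' ->
  ip (u o i) (u l i) ^+ 2 != 1 -> ip (u o i') (u l i') ^+ 2 != 1 ->
  (forall r, r != m0 -> ip (u l r) (v r) = 0) ->
  ip (u o i) (v i) = 0 -> ip (u o i') (v i') = 0 ->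
  (forall a, TM l v a = mu * Atau a (xx l) + TM o p a) -> forall r, r != m0 -> v r = 0.
Proof.
move=> im im' ii' c1 c2 hv ho ho' E.
have c1' : 1 - ip (u o i) (u l i) ^+ 2 != 0 by rewrite subr_eq0 eq_sym.
have c2' : 1 - ip (u o i') (u l i') ^+ 2 != 0 by rewrite subr_eq0 eq_sym.
have key r (y : vfam R n) (C : R) : r != m0 -> y r = v r -> C != 0 ->
    \prod_(r' | r' != r) ip (xx l r') (y r') = C -> TM o p (rho y) = 0 -> v r = 0.
  move=> rm yr C0 hC T0; have := E (rho y).
  rewrite T0 addr0 [Atau _ _]Atau_rho (@prod_ip0 _ _ _ _ _ r) ?mulr0; last first.
    by rewrite xxE // yr hv.
  rewrite /TM (bigD1 r) //= [X in _ + X]big1 ?addr0 => [|r' /andP[rm' rr']]; last first.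
    rewrite Atau_rho; apply: (@prod_ip0 _ _ _ _ _ r).
    by rewrite rep_other ?xxE ?yr ?hv // eq_sym.
  rewrite Atau_rho (bigD1 r) //= rep_same yr => /eqP; rewrite mulf_eq0.
  rewrite (eq_bigr (fun r' => ip (xx l r') (y r'))) => [|r' rr']; last by rewrite rep_other.
  by rewrite hC (negPf C0) orbF => /eqP/ip_eq0.
have one (r r' : 'I_k) : r != m0 -> r' != m0 -> r != r' -> 1 - ip (u o r') (u l r') ^+ 2 != 0 ->
    ip (u o r) (v r) = 0 -> v r = 0.
  move=> rm rm' rr' cr hor.
  apply: (key r (rep (rep (xx l) (perp o l) r') v r) (1 - ip (u o r') (u l r') ^+ 2)) => //.
  - by rewrite rep_same.
  - rewrite (bigD1 r') /=; last by rewrite eq_sym.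
    rewrite big1 ?mulr1 => [|q /andP[qr qr']]; last by rewrite !rep_other // xx1.
    by rewrite rep_other ?rep_same ?xxE ?perp_l // eq_sym.
  - apply: (TM_rho0 _ rm rm' rr'); rewrite ?rep_same //.
    by rewrite rep_other ?rep_same ?perp_o // eq_sym.
have vi : v i = 0 by apply: (one i i').
have vi' : v i' = 0 by apply: (one i' i) => //; rewrite eq_sym.
move=> r rm; have [->//|ri] := eqVneq r i; have [->//|ri'] := eqVneq r i'.
apply: (key r (rep (rep (rep (xx l) (perp o l) i) (perp o l) i') v r)
  ((1 - ip (u o i) (u l i) ^+ 2) * (1 - ip (u o i') (u l i') ^+ 2))) => //.
- by rewrite rep_same.
- exact: mulf_neq0.
- rewrite (bigD1 i) /=; last by rewrite eq_sym.
  rewrite (bigD1 i') /=; last by rewrite ![i' == _]eq_sym ri'.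
  rewrite big1 ?mulr1 => [|q /andP[/andP[qr qi] qi']]; last by rewrite !rep_other // xx1.
  rewrite (rep_other _ _ (i := r) (l := i)) 1?eq_sym // (rep_other _ _ (i := i') (l := i)) //.
  rewrite (rep_other _ _ (i := r) (l := i')) 1?eq_sym // !rep_same !xxE //.
  by rewrite !perp_l.
apply: (TM_rho0 _ im im' ii').
  rewrite (rep_other _ _ (i := r) (l := i)) 1?eq_sym // (rep_other _ _ (i := i') (l := i)) //.
  by rewrite rep_same perp_o.
by rewrite (rep_other _ _ (i := r) (l := i')) 1?eq_sym // rep_same perp_o.
Qed.

Lemma parallel_der xi (o l : 'I_t) (i : 'I_k) : i != m0 -> ip (u o i) (u l i) ^+ 2 = 1 ->
  dm xi o -> map_mx (da xi) (u l i) = 0.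
Proof.
move=> im c1 /(_ i im) ho.
have e : u l i = ip (u l i) (u o i) *: u o i by apply: unit_parallel; rewrite ?(uu fU) // ipC.
rewrite ipC in c1; move/eqP: c1; rewrite sqrf_eq1 => /orP[] /eqP c1.
  by rewrite e c1 scale1r.
rewrite e c1 scaleN1r; apply/matrixP => a b.
by have /matrixP/(_ a b) := ho; rewrite !mxE derN // => ->; rewrite oppr0.
Qed.

(** If [xx l] and [xx o] fail to be parallel in at most one mode, only that mode has to be killed.
    Otherwise [two_modes] applies: the coefficients up to a common factor and two inner products,
    [#|S|.+1] functionals in all. *)
Lemma pivot_kill o l (S : {set 'I_t}) (c : 'rV[R]_t) p Kp :
  (forall a, Atau a (xx l) = \sum_(j in S) c ord0 j * Atau a (xx j) + TM o p a) ->
  (forall i, i != m0 -> ((n i).-1 <= Kp)%N) -> (#|S|.+1 <= Kp)%N ->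
  kill Kp (fun xi : X => dm xi o /\ forall j, j \in S -> dm xi j) (fun xi => dm xi l).
Proof.
move=> E hn hS.
pose par (i : 'I_k) := ip (u o i) (u l i) ^+ 2 == 1.
case: (pselect (exists i i' : 'I_k, [/\ i != m0, i' != m0, i != i', ~~ par i & ~~ par i'])); last first.
  move=> np.
  have [i1 i1m hp] : exists2 i1, i1 != m0 & forall i, i != m0 -> i != i1 -> par i.
    case: (pselect (exists2 i, i != m0 & ~~ par i)) => [[i im pi]|nq]; last first.
      exists m1 => // i im _; apply/negPn/negP => pi; apply: nq; by exists i.
    exists i => // i' im' ii'; apply/negPn/negP => pi'; apply: np; exists i, i'.
    by rewrite eq_sym in ii'.
  apply: (kill_le (hn _ i1m)).
  have := @unit_kill _ _ _ (u l i1) (fun xi : X => map_mx (da xi) (u l i1)) (fun xi : X => dm xi o /\ forall j, j \in S -> dm xi j).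
  move=> /(_ (uu fU _ _) (fun a => slin_map_da _ _ dl _ _ _)) K.
  apply: kill_weaken (K _) => //; last by move=> xi _; apply: der_unit => //; apply: (uu fU).
  move=> xi [ho _] h1 i im; have [->//|ii] := eqVneq i i1.
  by apply: parallel_der ho => //; apply/eqP/hp.
move=> [i [i' [im im' ii' pi pi']]].
(* Some coefficient is nonzero: the test tensor below annihilates the tangent space at [xx o] but
   not [xx l]. *)
have [j0 j0S cj0] : exists2 j, j \in S & c ord0 j != 0.
  apply: contrapT => hc.
  have := E (rho (rep (rep (xx l) (perp o l) i) (perp o l) i')).
  rewrite (TM_rho0 _ im im' ii'); last 2 first.
    by rewrite rep_other // rep_same perp_o.
    by rewrite rep_same perp_o.
  rewrite big1 => [|j jS]; last first.
    by apply/eqP; rewrite mulf_eq0; apply/orP; left; apply/negPn/negP => cj; apply: hc; exists j.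
  rewrite addr0 Atau_rho (bigD1 i) //= (bigD1 i') 1?eq_sym //=.
  rewrite big1 ?mulr1 => [|q /andP[qi qi']]; last by rewrite !rep_other // xx1.
  rewrite (rep_other _ _ (i := i') (l := i)) // !rep_same !xxE // !perp_l => /eqP.
  by rewrite mulf_eq0 !subr_eq0 ![1 == _]eq_sym -/(par i) -/(par i') (negPf pi) (negPf pi').
pose H := (fun xi : X => dm xi o /\ forall j, j \in S -> dm xi j).
have K1 := @kill_fin _ _ _ (mem (S :\ j0)) (fun j xi => da xi (c ord0 j) * c ord0 j0 - c ord0 j * da xi (c ord0 j0))
   H (fun j => slin_dc _ _ _ _).
have sl r : slin (fun xi : X => ip (u o r) (map_mx (da xi) (u l r))).
  move=> b x y; rewrite -ipZr -ipDr; congr ip; apply/matrixP => e f.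
  by rewrite mxE slin_da // !mxE.
have K2 := kill_seq (kill_seq K1 (kill1 _ (sl i))) (kill1 _ (sl i')).
apply: (@kill_le _ _ _ _ _ _ _ (kill_weaken _ _ K2)) => //.
  by move: hS; rewrite (cardsD1 j0 S) j0S add1n !addn1.
move=> xi [ho hSd] [[hc h1] h2].
set mu := da xi (c ord0 j0) / c ord0 j0.
have Ec j : j \in S -> da xi (c ord0 j) = mu * c ord0 j.
  move=> jS; have [->|jj] := eqVneq j j0; first by rewrite /mu divfK.
  have /eqP : da xi (c ord0 j) * c ord0 j0 - c ord0 j * da xi (c ord0 j0) = 0.
    by apply: hc; rewrite !inE jj jS.
  rewrite subr_eq0 => /eqP e.
  by apply: (mulIf cj0); rewrite e /mu; field.
have D := der_relation hSd ho E.
(* The relation is subtracted [mu] times, at the price of shifting the tangent vector by [- mu]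
   times [p]. *)
apply: (@two_modes o l (dfam (da xi) (u l)) (fun r => (- mu) *: p r + dfam (da xi) p r) mu i i') => //.
- by move=> r rm; exact: du_orth.
move=> a; rewrite TM_plin D E mulrDr addrA; congr (_ + _).
rewrite mulNr addrK mulr_sumr; apply: eq_bigr => j jS; by rewrite Ec // mulrA.
Qed.

(** * One orthonormal mode: a basis of the columns, its pivots, and the count *)

Section Count.
Hypothesis hD : (n m0 <= \sum_(i | i != m0) (n i).-1)%N.
Hypothesis hE : forall i, i != m0 -> (2 <= \sum_(i' | (i' != m0) && (i' != i)) (n i').-1)%N.

Let D := (\sum_(i | i != m0) (n i).-1)%N.
(** What a pivot column saves: it costs [D - E] functionals instead of [D]. The value [t.-1] drives
    the general count, the value 2 the case of a basis with two elements. *)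
Let E := maxn 2 t.-1.

Lemma mode_bound i : i != m0 -> ((n i).-1 + E <= D)%N.
Proof.
move=> im; rewrite /D (bigD1 i) //= leq_add2l /E geq_max hE //=.
have [i2 [i2m i2i]] : exists i2, i2 != m0 /\ i2 != i.
  have [->|i1] := eqVneq i m1; first by exists m2.
  by exists m1; rewrite [m1 == i]eq_sym.
rewrite (bigD1 i2) ?i2m //=; apply: leq_trans (leq_addr _ _).
by rewrite -!subn1 leq_sub2r.
Qed.

Definition Rel (x : 'rV[R]_t) := forall a, comb x a = 0.
Definition supp (Q : {set 'I_t}) (x : 'rV[R]_t) := forall j, j \notin Q -> x ord0 j = 0.
Definition indep (Q : {set 'I_t}) := forall x, supp Q x -> Rel x -> x = 0.

Lemma comb_supp Q x a : supp Q x -> comb x a = \sum_(j in Q) x ord0 j * Atau a (xx j).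
Proof.
move=> sx; rewrite /comb (bigID (mem Q)) /= [X in _ + X]big1 ?addr0 // => j jQ.
by rewrite sx // mul0r.
Qed.

Lemma dependent_column (Q : {set 'I_t}) l : indep Q -> l \notin Q -> ~ indep (l |: Q) ->
  exists2 c, supp Q c & forall a, Atau a (xx l) = \sum_(j in Q) c ord0 j * Atau a (xx j).
Proof.
move=> iQ lQ /existsNP[x /not_implyP[sx /not_implyP[rx x0]]].
have xl : x ord0 l != 0.
  apply: contra_notN x0 => /eqP xl; apply: iQ => // j jQ.
  have [->//|jl] := eqVneq j l; apply: sx; by rewrite !inE negb_or jl.
exists (- (x ord0 l)^-1 *: (x - x ord0 l *: delta_mx ord0 l)).
  move=> j jQ; rewrite !mxE /=; have [->|jl] := eqVneq j l; first by rewrite mulr1 subrr mulr0.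
  by rewrite mulr0 subr0 (sx j) ?mulr0 // !inE negb_or jl.
move=> a; have := rx a; rewrite (comb_supp _ sx) big_setU1 //= => /eqP; rewrite addr_eq0 => /eqP e.
apply: (mulfI xl); rewrite e mulr_sumr -sumrN; apply: eq_bigr => j jQ.
rewrite !mxE /=; have -> : j == l = false by apply/negbTE; apply: contraNneq lQ => <-.
by rewrite mulr0 subr0; field.
Qed.

(* A column [o] of maximal contact, and a basis [Q] of the columns containing it. *)
Lemma choose_basis : exists (o : 'I_t) (Q : {set 'I_t}) (f : nat), [/\ o \in Q, indep Q,
  forall l, l \notin Q -> exists2 c, supp Q c & forall a, Atau a (xx l) = \sum_(j in Q) c ord0 j * Atau a (xx j),
  forall l, exists2 B : 'M[R]_t, (\rank B <= f.+1)%N & forall x, (L l x /\ supp Q x) <-> (x <= B)%MS &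
  exists2 B : 'M[R]_t, \rank B = f.+1 & forall x, (L o x /\ supp Q x) <-> (x <= B)%MS].
Proof.
have /choice[LB hLB] l : exists B : 'M[R]_t, forall x, L l x <-> (x <= B)%MS.
  by apply: subspace_matrix; [exact: L_0|move=> c x y; exact: L_lin].
pose Mx : 'M[R]_(t, #|{: idx n}|) := \matrix_(j, z) rho (xx j) (enum_val z).
have MxE x : Rel x <-> x *m Mx = 0.
  have E1 z : (x *m Mx) ord0 z = comb x (dlt R (enum_val z)).
    by rewrite mxE; apply: eq_bigr => j _; rewrite mxE Atau_dlt.
  split=> [rx|e a]; first by apply/rowP => z; rewrite E1 rx mxE.
  rewrite /comb; under eq_bigr => j _ do rewrite AtauE mulr_sumr.
  rewrite exchange_big big1 // => z _.
  have /rowP/(_ (enum_rank z)) := e; rewrite mxE [(0 : 'rV_ _) _ _]mxE.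
  move=> /(congr1 ( *%R (a z))); rewrite mulr0 mulr_sumr => e'; apply: etrans e'; apply: eq_bigr => j _.
  by rewrite mxE enum_rankK; ring.
(* [zr l] is the dimension of the intersection of the span of all [xx j] with the tangent space at
   [xx l]. It involves no basis, so [o] can be chosen before [Q] is built around it. *)
pose zr l := \rank (LB l *m Mx).
have [o omax] : exists o, forall l, (zr l <= zr o)%N.
  exists [arg max_(o > Ordinal t0) zr o]; case: arg_maxnP => //= o _ hh l; exact: hh.
have ind1 : indep [set o].
  move=> x sx rx; apply/rowP => j; rewrite mxE.
  have [->|jo] := eqVneq j o; last by apply: sx; rewrite inE.
  have := rx (rho (xx o)); rewrite (comb_supp _ sx) big_set1 Atau_rho big1 ?mulr1 // => i _.
  exact: xx1.
have : `[< indep [set o] >] by apply/asboolP.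
move=> /(maxset_exists (P := fun Q : {set 'I_t} => `[< indep Q >]))[Q /maxsetP[/asboolP iQ mQ]].
rewrite finset.sub1set => oQ.
have dQ l : l \notin Q -> exists2 c, supp Q c & forall a, Atau a (xx l) = \sum_(j in Q) c ord0 j * Atau a (xx j).
  move=> lQ; apply: (dependent_column iQ lQ) => il.
  have := mQ (l |: Q); rewrite finset.subsetUr => /(_ (asboolT il) isT) QE.
  by move: lQ; rewrite -QE setU11.
have /choice[ZB hZB] l : exists B : 'M[R]_t, forall x, (L l x /\ supp Q x) <-> (x <= B)%MS.
  apply: subspace_matrix.
    by split; [exact: L_0|move=> j _; rewrite mxE].
  move=> c x y [Lx sx] [Ly sy]; split; first exact: L_lin.
  by move=> j jQ; rewrite !mxE sx // sy // mulr0 addr0.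
have ZM l : \rank (ZB l *m Mx) = \rank (ZB l).
  suff k0 : \rank (ZB l :&: kermx Mx)%MS = 0%N.
    by rewrite -[RHS](mxrank_mul_ker (ZB l) Mx) k0 addn0.
  apply/eqP; rewrite mxrank_eq0; apply/eqP/row_matrixP => i; rewrite row0.
  have hr : (row i (ZB l :&: kermx Mx)%MS <= ZB l :&: kermx Mx)%MS by exact: row_sub.
  move: hr; rewrite sub_capmx => /andP[/(proj2 (hZB l _))[_ sx] /sub_kermxP hx].
  by apply: iQ => //; apply/MxE.
have zl l : (\rank (ZB l) <= zr l)%N.
  rewrite -ZM /zr; apply: mxrankS; apply: submxMr; apply/row_subP => i.
  by apply/(hLB l); have [] := proj2 (hZB l _) (row_sub i (ZB l)).
(* Each [xx l] is rewritten through the basis [Q]; this leaves the combined tensor unchanged, so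
   membership in [L o] is kept. *)
have zo : (zr o <= \rank (ZB o))%N.
  rewrite -ZM /zr; apply: mxrankS; apply/row_subP => i; rewrite row_mul.
  set x := row i (LB o); have Lx : L o x by apply/(hLB o); exact: row_sub.
  have red (l : 'I_t) : exists c : 'rV[R]_t, supp Q c /\ Rel (delta_mx ord0 l - c).
    case: (boolP (l \in Q)) => lQ.
      exists (delta_mx ord0 l); split; last by move=> a; rewrite subrr comb0.
      by move=> j jQ; rewrite mxE /= (_ : j == l = false) //; apply/negbTE; apply: contraNneq jQ => ->.
    have [c sc ce] := dQ l lQ; exists c; split => // a.
    rewrite -scaleN1r addrC combD comb_delta ce (comb_supp _ sc) mulN1r; by rewrite addNr.
  have {red} /choice[cc hcc] := red.
  pose x' := \sum_l x ord0 l *: cc l.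
  have Rx : Rel (x - x').
    move=> a; have -> : x - x' = \sum_l x ord0 l *: (delta_mx ord0 l - cc l).
      rewrite /x' {1}[x]row_sum_delta -sumrB; by apply: eq_bigr => l _; rewrite scalerBr.
    elim: (index_enum _) => [|l r IH]; first by rewrite big_nil comb0.
    by rewrite big_cons combD IH; have [_ ->] := hcc l; rewrite mulr0 addr0.
  have sx' : supp Q x'.
    move=> j jQ; rewrite /x' summxE big1 // => l _; rewrite mxE.
    by have [/(_ j jQ) -> _] := hcc l; rewrite mulr0.
  have -> : x *m Mx = x' *m Mx.
    by apply/eqP; rewrite -subr_eq0 -mulmxBl; apply/eqP/MxE.
  apply: submxMr; apply: (proj1 (hZB o x')); split => //.
  have [p hp] := Lx; exists p => a; rewrite -hp -[x in RHS](subrK x') -[x - x']scale1r.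
  by rewrite combD Rx mulr0 add0r.
have zo0 : (0 < \rank (ZB o))%N.
  rewrite lt0n mxrank_eq0; apply/eqP => z0.
  have : ((delta_mx ord0 o : 'rV[R]_t) <= ZB o)%MS.
    apply: (proj1 (hZB o _)); split; first exact: L_delta.
    by move=> j jQ; rewrite mxE /= (_ : j == o = false) //; apply/negbTE; apply: contraNneq jQ => ->.
  rewrite z0 submx0 => /eqP/rowP/(_ o); rewrite !mxE !eqxx => /eqP; by rewrite oner_eq0.
exists o, Q, (\rank (ZB o)).-1; split => //.
  move=> l; exists (ZB l); last exact: hZB.
  by rewrite prednK //; apply: leq_trans (zl l) (leq_trans (omax l) zo).
by exists (ZB o); [rewrite prednK|exact: hZB].
Qed.

(** Reduce a basis of the space to the identity on pivot positions. The row of a pivot [l] expresses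
    [xx l] by non-pivots modulo the tangent space at [xx o]; the coordinate at [o] is absorbed, as
    [xx o] is itself tangent there. *)
Lemma pivot_columns o (Q : {set 'I_t}) f (B : 'M[R]_t) : \rank B = f.+1 ->
  (forall x, (L o x /\ supp Q x) <-> (x <= B)%MS) ->
  exists Piv : {set 'I_t}, [/\ Piv \subset Q :\ o, (f <= #|Piv|)%N &
    forall l, l \in Piv -> exists (c : 'rV[R]_t) p, forall a,
      Atau a (xx l) = \sum_(j in (Q :\ o) :\: Piv) c ord0 j * Atau a (xx j) + TM o p a].
Proof.
move=> rB hB.
have [Bb fB eB] : exists2 Bb : 'M[R]_(\rank B, t), row_free Bb & (Bb :=: B)%MS.
  by exists (row_base B); [exact: row_base_free|exact: eq_row_base].
pose A := Bb^T.
have fA : row_full A by rewrite /row_full mxrank_tr.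
pose g := fullrankfun fA.
have gi : injective g by exact: fullrankfun_inj.
pose N := rowsub g A.
have Nu : N \in unitmx by exact: fullrowsub_unit.
(* The reduced basis: by [CE] it is the identity on the columns selected by [g]. *)
pose C := invmx N^T *m Bb.
have CE : C *m (colsub g 1%:M) = 1%:M.
  rewrite /C -mulmxA (_ : Bb *m colsub g 1%:M = N^T).
    by rewrite mulVmx // unitmx_tr.
  apply/matrixP => i j; rewrite !mxE (bigD1 (g j)) //= !mxE eqxx mulr1 big1 ?addr0 // => l lj.
  by rewrite !mxE (negPf lj) mulr0.
have CsB : (C <= B)%MS by rewrite -eB; exact: submxMl.
clearbody C.
have Cg a b : C a (g b) = (a == b)%:R.
  have := CE.
  move=> /matrixP/(_ a b); rewrite !mxE (bigD1 (g b)) //= !mxE eqxx mulr1 big1 ?addr0 // => l lb.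
  by rewrite !mxE (negPf lb) mulr0.
have CB a : L o (row a C) /\ supp Q (row a C).
  apply: (proj2 (hB _)); exact: submx_trans (row_sub _ _) CsB.
have gQ a : g a \in Q.
  apply/negPn/negP => gaQ; have [_ /(_ _ gaQ)] := CB a.
  by rewrite mxE Cg eqxx => /eqP; rewrite oner_eq0.
(* If [o] is among the pivot positions it is dropped, which leaves at least [f] of the [f.+1]
   positions. *)
pose Piv := [set g a | a in [set: 'I_(\rank B)]] :\ o.
exists Piv; split.
- apply/fintype.subsetP => l; rewrite !inE => /andP[-> /imsetP[a _ ->]]; exact: gQ.
- have := cardsD1 o [set g a | a in [set: 'I_(\rank B)]].
  rewrite card_imset // cardsT card_ord -/Piv => e; rewrite -ltnS -rB e.
  by case: (o \in _); rewrite ?add1n ?add0n ?leqnSn.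
move=> l; rewrite !inE => /andP[lo /imsetP[a _ la]].
have [[p hp] sx] := CB a.
exists (- row a C), (fun i => p i + (if i == m1 then (- C a o) *: u o i else 0)) => b.
have -> : TM o (fun i => p i + (if i == m1 then (- C a o) *: u o i else 0)) b = TM o p b - C a o * Atau b (xx o).
  rewrite -mulNr -TM_self -[TM o p b]mul1r -TM_plin; apply: eq_bigr => i _.
  by apply: Atau_ext => r; rewrite /rep scale1r.
rewrite -hp (comb_supp _ sx).
have oQl : l \in Q by rewrite la; exact: gQ.
rewrite [X in _ + (X - _)](bigID (fun j => (j == o) || (j \in Piv))) /=.
have -> : \sum_(i in Q | (i == o) || (i \in Piv)) row a C ord0 i * Atau b (xx i) =
    (C a o * (o \in Q)%:R) * Atau b (xx o) + Atau b (xx l).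
  have lP : l \in Piv by rewrite !inE lo; apply/imsetP; exists a.
  rewrite (bigD1 l) /=; last by rewrite oQl lP orbT.
  rewrite mxE la Cg eqxx mul1r addrC; congr (_ + _).
  case: (boolP (o \in Q)) => oQ; last first.
    rewrite mulr0 mul0r big1 // => i /andP[/andP[iQ /orP[/eqP io|iP]] il]; first by rewrite io (negPf oQ) in iQ.
    move: iP; rewrite !inE => /andP[_ /imsetP[c _ ic]]; rewrite mxE ic Cg.
    have -> : a == c = false by apply/negbTE; apply: contraNneq il => ac; rewrite ic -ac.
    by rewrite mul0r.
  rewrite mulr1 (bigD1 o) /=; last by rewrite oQ eqxx /= eq_sym -la.
  rewrite mxE big1 ?addr0 // => i /andP[/andP[/andP[iQ]]] /orP[/eqP -> _|iP il io]; first by rewrite eqxx.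
  move: iP; rewrite !inE => /andP[_ /imsetP[c _ ic]]; rewrite mxE ic Cg.
  have -> : a == c = false by apply/negbTE; apply: contraNneq il => ac; rewrite ic -ac.
  by rewrite mul0r.
have -> : (C a o * (o \in Q)%:R) = C a o.
  case: (boolP (o \in Q)) => oQ; first by rewrite mulr1.
  by rewrite mulr0; have := sx _ oQ; rewrite mxE.
have -> : \sum_(i in Q | ~~ ((i == o) || (i \in Piv))) row a C ord0 i * Atau b (xx i) =
    \sum_(j in (Q :\ o) :\: Piv) row a C ord0 j * Atau b (xx j).
  apply: eq_bigl => j.
  rewrite finset.in_setD [j \in Q :\ o]in_setD1; move: (j \in Piv) => P; rewrite negb_or.
  by case: (j == o); case: (j \in Q); case: P.
rewrite [X in X + _](_ : _ = - \sum_(j in (Q :\ o) :\: Piv) row a C ord0 j * Atau b (xx j)).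
  by ring.
by rewrite -sumrN; apply: eq_bigr => j _; rewrite !mxE mulNr.
Qed.

(** Costs per column: [D] for a non-pivot of [Q], [D - E] for a pivot, [#|Q|.-1] outside [Q]; then
    one for each [lm j]. Pivots presuppose the non-pivots, and the columns outside [Q] presuppose
    both. *)
Lemma kill_param1 o (Q : {set 'I_t}) (Piv : {set 'I_t}) :
  o \in Q -> Piv \subset Q :\ o ->
  (forall l, l \in Piv -> exists (c : 'rV[R]_t) p, forall a,
      Atau a (xx l) = \sum_(j in (Q :\ o) :\: Piv) c ord0 j * Atau a (xx j) + TM o p a) ->
  (forall l, l \notin Q -> exists2 c, supp Q c & forall a, Atau a (xx l) = \sum_(j in Q) c ord0 j * Atau a (xx j)) ->
  kill ((#|Q| - #|Piv|) * D + (#|Piv| * (D - E) + (#|~: Q| * #|Q|.-1 + t))) (fun=> True)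
    (fun xi : X => (forall i : 'I_k, ~ (i < 1)%N -> dUzero U lm d xi i) /\ forall j, da xi (lm j) = 0).
Proof.
move=> oQ sP hP hQ.
have sPQ : Piv \subset Q by apply: fintype.subset_trans sP (subD1set _ _).
have K1 : kill ((#|Q| - #|Piv|) * D) (fun=> True) (fun xi : X => forall l, l \in Q :\: Piv -> dm xi l).
  have -> : ((#|Q| - #|Piv|) * D = \sum_(l in Q :\: Piv) D)%N.
    by rewrite sum_nat_const cardsD (finset.setIidPr sPQ).
  apply: (@kill_family_cond _ _ _ _ _ (fun l xi => dm xi l)) => l _.
  apply: (@kill_family_cond _ _ _ _ _ (fun i (xi : X) => map_mx (da xi) (u l i) = 0)) => i im.
  apply: unit_kill; [exact: (uu fU)|by move=> a; exact: (slin_map_da U lm dl)|].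
  by move=> xi _; apply: der_unit => //; apply: (uu fU).
have K2 : kill (#|Piv| * (D - E)) (fun xi : X => True /\ forall l, l \in Q :\: Piv -> dm xi l)
    (fun xi : X => forall l, l \in Piv -> dm xi l).
  rewrite -sum_nat_const.
  apply: (@kill_family_cond _ _ _ _ _ (fun l xi => dm xi l)) => l lP.
  have [c [p E1]] := hP _ lP.
  have lQ : l \in Q by exact: (fintype.subsetP sPQ).
  apply: kill_weaken (pivot_kill (Kp := (D - E)%N) E1 _ _) => //.
  - move=> xi [_ hx]; split; last first.
      by move=> j jS; apply: hx; move: jS; rewrite !inE => /andP[-> /andP[_ ->]].
    apply: hx; rewrite !inE oQ andbT; apply/negP => /(fintype.subsetP sP).
    by rewrite !inE eqxx.
  - move=> i im; rewrite leq_subRL.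
      by rewrite addnC mode_bound.
    by apply: leq_trans (mode_bound im); exact: leq_addl.
  have := mode_bound (isT : m1 != m0).
  have h1 : (#|(Q :\ o) :\: Piv|.+2 <= t)%N.
    have : (#|Q| <= t)%N by rewrite -[leqRHS]card_ord; exact: max_card.
    have := cardsD1 o Q; have := cardsD1 l (Q :\ o).
    rewrite oQ (fintype.subsetP sP _ lP) => -> ->.
    rewrite !add1n; apply: leq_trans; rewrite !ltnS; apply: subset_leq_card; apply/fintype.subsetP => j.
    rewrite finset.in_setD !in_setD1 => /andP[jP /andP[-> ->]]; rewrite !andbT.
    by apply: contraNneq jP => ->.
  have := tn m1; have := leq_maxr 2 t.-1; rewrite -/E.
  move: #|_| h1 => q1; move: (n m1) (D) (E) => n1 D1 E1'; lia.
have K3 : kill (#|~: Q| * #|Q|.-1) (fun xi : X => (True /\ (forall l, l \in Q :\: Piv -> dm xi l)) /\ forall l, l \in Piv -> dm xi l)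
    (fun xi : X => forall l, l \in ~: Q -> dm xi l).
  rewrite -sum_nat_const.
  apply: (@kill_family_cond _ _ _ _ _ (fun l xi => dm xi l)) => l; rewrite inE => lQ.
  have [c _ E1] := hQ _ lQ.
  apply: kill_weaken (dep_kill E1) => // xi [[_ h1] h2] j jQ.
  by case: (boolP (j \in Piv)) => jP; [exact: h2|apply: h1; rewrite inE jP].
have K4 : kill t (fun=> True) (fun xi : X => forall j, da xi (lm j) = 0).
  have := @kill_fin _ _ _ predT (fun j xi => da xi (lm j)) (fun=> True) (fun j => slin_da _ _ dl _).
  by rewrite card_ord; apply: kill_weaken => // xi _ hx j; apply: hx.
have K := kill_seq K1 (kill_seq K2 (kill_seq K3 (kill_weaken (fun _ _ => I) (fun _ _ q => q) K4))).
apply: kill_weaken K => // xi _ [h1 [h2 [h3 h4]]]; split => // i /negP; rewrite mode0 => im.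
apply/matrixP => a j; have hj : dm xi j.
  case: (boolP (j \in Q)) => jQ; last by apply: h3; rewrite inE.
  by case: (boolP (j \in Piv)) => jP; [exact: h2|apply: h1; rewrite inE jP].
by have /matrixP/(_ a ord0) := hj i im; rewrite !mxE.
Qed.

Lemma rw_zero xi l : rw xi l = 0 <-> forall j, om xi l j = 0.
Proof.
split=> [e j|e]; last by apply/rowP => j; rewrite !mxE e mulr0.
by have /rowP/(_ j)/eqP := e; rewrite !mxE mulf_eq0 (negPf (lm0 j)) => /eqP.
Qed.

Lemma om_diag xi l : Tan xi -> om xi l l = 0.
Proof. move=> T; have := om_skew l l T; lra. Qed.

(** For a column outside [Q]: first its component normal to the columns of [U m0], then the
    off-diagonal entries of its row outside [Q]; the rest of the row lies in a space of dimension at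
    most [f.+1]. The normal components of the columns in [Q] follow by independence. *)
Lemma kill_outer (Q : {set 'I_t}) f (W : 'M[R]_(n m0, n m0 - t)) :
  W^T *m U m0 = 0 -> indep Q ->
  (forall l, exists2 B : 'M[R]_t, (\rank B <= f.+1)%N & forall x, (L l x /\ supp Q x) <-> (x <= B)%MS) ->
  kill (#|~: Q| * ((n m0 - t) + (#|~: Q| + f))) (fun xi : X => Ker xi)
    (fun xi : X => (forall l, l \notin Q -> rw xi l = 0) /\ forall j, W^T *m h xi j m0 = 0).
Proof.
move=> WU iQ hB.
have Wip b (v : 'cV[R]_(n m0)) : ip v (col b W) = (W^T *m v) b ord0.
  by rewrite !mxE; apply: eq_bigr => a _; rewrite !mxE mulrC.
apply: (@kill_weaken _ _ _ (fun xi => Ker xi) _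
   (fun xi : X => forall l, l \in ~: Q -> W^T *m h xi l m0 = 0 /\ rw xi l = 0)) => //.
  move=> xi K hxi; split=> [l lQ|j]; first by apply: (hxi l _).2; rewrite inE.
  apply/matrixP => b z; rewrite (ord1 z) [RHS]mxE -Wip.
  have wu j' : ip (u j' m0) (col b W) = 0.
    by rewrite Wip /colfam mulmx_col WU mxE.
  have x0 := iQ _ _ (normal_rel K wu).
  have /x0/rowP/(_ j)/eqP : supp Q (\row_j (lm j * ip (h xi j m0) (col b W))).
    move=> l lQ; rewrite mxE Wip (hxi l _).1 ?inE //; by rewrite mxE mulr0.
  by rewrite !mxE mulf_eq0 (negPf (lm0 j)) => /eqP.
rewrite -sum_nat_const.
apply: (@kill_family_cond _ _ _ _ _ (fun l xi => W^T *m h xi l m0 = 0 /\ rw xi l = 0)) => l lQ.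
have K1 : kill (n m0 - t) (fun xi : X => Ker xi) (fun xi => W^T *m h xi l m0 = 0).
  have := @kill_fin _ _ _ predT (fun b xi => ip (col b W) (h xi l m0)) (fun xi => Ker xi) _.
  rewrite card_ord; move=> K; apply: kill_weaken (K _) => //.
    move=> xi _ hx; apply/matrixP => b z; rewrite (ord1 z) [RHS]mxE -Wip ipC; exact: hx.
  by move=> b c x y; rewrite -ipZr -ipDr; congr ip; rewrite /colfam Hof_lin;
     apply/matrixP => e1 e2; rewrite !mxE.
have K2 : kill #|~: Q|.-1 (fun xi : X => Ker xi /\ W^T *m h xi l m0 = 0) (fun xi => supp Q (rw xi l)).
  have -> : #|~: Q|.-1 = #|[pred j | j \in (~: Q) :\ l]|.
    by rewrite (cardsD1 l (~: Q)) lQ.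
  have := @kill_fin _ _ _ [pred j | j \in (~: Q) :\ l] (fun j xi => rw xi l ord0 j)
    (fun xi => Ker xi /\ W^T *m h xi l m0 = 0) (fun j => @slin_rw l j).
  apply: kill_weaken => // xi [[T _] _] hx j jQ.
  have [->|jl] := eqVneq j l; first by rewrite mxE om_diag // mulr0.
  by apply: hx; rewrite /= in_setD1 jl inE.
have [B rB BE] := hB l.
have K3 : kill f.+1 (fun xi : X => (Ker xi /\ W^T *m h xi l m0 = 0) /\ supp Q (rw xi l)) (fun xi => rw xi l = 0).
  apply: (kill_le rB); apply: kill_rowspace => [a|xi [[K _] sx]]; first exact: slin_rw.
  by apply/BE; split => //; exact: row_L.
have := kill_seq K1 (kill_seq K2 K3).
have k1 : (0 < #|~: Q|)%N by apply/card_gt0P; exists l.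
have -> : (#|~: Q| + f = #|~: Q|.-1 + f.+1)%N by lia.
by apply: kill_weaken => // xi _ [h1 [_ h2]].
Qed.

(** Once the outer rows vanish, skewness supports the row in [Q] with diagonal entry 0. Since
    [delta_mx ord0 y] belongs to the space of dimension at most [f.+1], the condition on the
    diagonal lowers the bound to [f]. *)
Lemma row_kill (Q : {set 'I_t}) f y : y \in Q ->
  (forall l, exists2 B : 'M[R]_t, (\rank B <= f.+1)%N & forall x, (L l x /\ supp Q x) <-> (x <= B)%MS) ->
  kill f (fun xi : X => Ker xi /\ forall l, l \notin Q -> rw xi l = 0) (fun xi => rw xi y = 0).
Proof.
move=> yQ hB; have [B rB BE] := hB y.
have [B' BE'] : exists B' : 'M[R]_t, forall x : 'rV[R]_t, (x <= B)%MS /\ x ord0 y = 0 <-> (x <= B')%MS.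
  apply: (@subspace_matrix R t (fun x => (x <= B)%MS /\ x ord0 y = 0)); first by rewrite sub0mx mxE.
  move=> c x z [Bx x0] [Bz z0]; rewrite !mxE x0 z0 mulr0 addr0; split => //.
  by apply: addmx_sub => //; apply: scalemx_sub.
have dB : ((delta_mx ord0 y : 'rV[R]_t) <= B)%MS.
  apply/BE; split; first exact: L_delta.
  by move=> j jQ; rewrite mxE /= (_ : j == y = false) //; apply/negbTE; apply: contraNneq jQ => ->.
have rB' : (\rank B' <= f)%N.
  rewrite -ltnS; apply: leq_trans rB; apply: rank_ltmx; rewrite ltmxE; apply/andP; split.
    by apply/row_subP => i; apply: (proj1 (proj2 (BE' _) (row_sub i B'))).
  apply/negP => /(submx_trans dB)/BE'[_]; rewrite mxE !eqxx => /eqP; by rewrite oner_eq0.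
apply: (kill_le rB'); apply: kill_rowspace => [a|xi [K hQ]]; first exact: slin_rw.
apply/BE'; split; last by rewrite mxE om_diag ?mulr0 //; case: K.
apply/BE; split; first exact: row_L.
move=> j /hQ /rw_zero/(_ y) e; rewrite mxE om_skew; last by case: K.
by rewrite e oppr0 mulr0.
Qed.

Lemma ker_rows (W : 'M[R]_(n m0, n m0 - t)) xi :
  (forall v : 'cV[R]_(n m0), (U m0)^T *m v = 0 -> W^T *m v = 0 -> v = 0) ->
  Ker xi -> (forall l, rw xi l = 0) -> (forall j, W^T *m h xi j m0 = 0) -> xi = 0.
Proof.
move=> hW K h1 h2; apply: ker_zero1 => // j; apply: hW => //.
apply/matrixP => l z; rewrite (ord1 z) [RHS]mxE; have /rw_zero/(_ j) <- := h1 l.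
by rewrite /om /ip mxE; apply: eq_bigr => a _; rewrite !mxE.
Qed.

Lemma kill_inner1 y :
  kill 0 (fun xi : X => Ker xi /\ forall l, l \notin [set y] -> rw xi l = 0) (fun xi => forall l, rw xi l = 0).
Proof.
apply: kill0 => xi [[T _] h1] l; have [->|ly] := eqVneq l y; last by apply: h1; rewrite inE.
apply/rw_zero => j; have [->|jy] := eqVneq j y; first exact: om_diag.
have := h1 j; rewrite inE jy => /(_ isT) /rw_zero/(_ y) e.
by rewrite om_skew // e oppr0.
Qed.

(** After the other rows, the skew matrix has a single free entry left, at [(l2, l1)]. It vanishes
    for free unless [xx l1] is tangent at [xx l2]. *)
Lemma kill_inner2 (Q : {set 'I_t}) f l1 l2 c2 : l1 \in Q -> l2 \in Q -> l1 != l2 ->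
  (forall l, exists2 B : 'M[R]_t, (\rank B <= f.+1)%N & forall x, (L l x /\ supp Q x) <-> (x <= B)%MS) ->
  (L l2 (delta_mx ord0 l1) -> c2 = 1%N) ->
  kill ((#|Q| - 2) * f + c2) (fun xi : X => Ker xi /\ forall l, l \notin Q -> rw xi l = 0)
     (fun xi => forall l, rw xi l = 0).
Proof.
move=> l1Q l2Q l12 hB hc.
have K1 : kill ((#|Q| - 2) * f) (fun xi : X => Ker xi /\ forall l, l \notin Q -> rw xi l = 0)
   (fun xi => forall y, y \in Q :\ l1 :\ l2 -> rw xi y = 0).
  have -> : (#|Q| - 2 = #|Q :\ l1 :\ l2|)%N.
    by have := cardsD1 l1 Q; have := cardsD1 l2 (Q :\ l1); rewrite l1Q in_setD1 l2Q eq_sym l12 /=; lia.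
  rewrite -sum_nat_const; apply: (@kill_family_cond _ _ _ _ _ (fun y xi => rw xi y = 0)) => y yQ.
  by apply: row_kill => //; move: yQ; rewrite !in_setD1 => /and3P[].
have K2 : kill c2 (fun xi : X => (Ker xi /\ forall l, l \notin Q -> rw xi l = 0) /\
    forall y, y \in Q :\ l1 :\ l2 -> rw xi y = 0) (fun xi => om xi l2 l1 = 0).
  have rE xi : (Ker xi /\ forall l, l \notin Q -> rw xi l = 0) /\
    (forall y, y \in Q :\ l1 :\ l2 -> rw xi y = 0) -> rw xi l2 = (lm l1 * om xi l2 l1) *: delta_mx ord0 l1.
    move=> [[[T _] h1] h2]; apply/rowP => j; rewrite !mxE /=.
    have [->|j1] := eqVneq j l1; first by rewrite mulr1.
    rewrite mulr0; have [->|j2] := eqVneq j l2; first by rewrite om_diag // mulr0.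
    rewrite om_skew // (_ : om xi j l2 = 0) ?oppr0 ?mulr0 //.
    case: (boolP (j \in Q)) => jQ; last by have /rw_zero := h1 j jQ.
    by have := h2 j; rewrite !in_setD1 j1 j2 jQ => /(_ isT) /rw_zero.
  case: (pselect (L l2 (delta_mx ord0 l1))) => hL.
    rewrite hc //; apply: kill1 => c x y; exact: slin_h.
  apply: (kill_le (leq0n _)); apply: kill0 => xi Hx.
  apply/eqP; apply: contra_notT hL => o0.
  have := row_L l2 (proj1 (proj1 Hx)); rewrite (rE _ Hx) => hL.
  have a0 : lm l1 * om xi l2 l1 != 0 by rewrite mulf_neq0.
  have := L_lin ((lm l1 * om xi l2 l1)^-1) hL (L_0 l2).
  by rewrite addr0 scalerA mulVf // scale1r.
have := kill_seq K1 K2; apply: kill_weaken => // xi [[T _] h1] [h2 h3].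
have h4 l : l != l1 -> rw xi l = 0.
  move=> ll1; case: (boolP (l \in Q)) => lQ; last exact: h1.
  have [l2E|ll2] := eqVneq l l2; last by apply: h2; rewrite !in_setD1 ll1 ll2.
  apply/rw_zero => j; rewrite l2E; have [->//|j1] := eqVneq j l1.
  have [->|j2] := eqVneq j l2; first exact: om_diag.
  rewrite om_skew //; have -> : om xi j l2 = 0; last by rewrite oppr0.
  case: (boolP (j \in Q)) => jQ; last by have /rw_zero := h1 j jQ.
  by have := h2 j; rewrite !in_setD1 j1 j2 jQ => /(_ isT) /rw_zero.
move=> l; have [->|] := eqVneq l l1; last exact: h4.
apply/rw_zero => j; have [->|j1] := eqVneq j l1; first exact: om_diag.
by rewrite om_skew //; have /rw_zero -> := h4 _ j1; rewrite oppr0.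
Qed.

(** [q] and [kap] count the columns inside and outside [Q], and [P] the pivots. With slack variables
    the products cancel, and what remains says that the saving [E'] on at least [f] pivots is paid
    for by the kernel bounds. *)
Lemma count_arith t' q kap P f D' E' n0 c :
  (t' = q + kap -> P <= q.-1 -> f <= P -> 0 < q -> E' <= D' -> n0 <= D' -> t' <= n0 -> t'.-1 <= E' ->
  D' * t' + t' <= (q - P) * D' + (P * (D' - E') + (kap * q.-1 + t')) + (kap * ((n0 - t') + (kap + f)) + c) ->
  kap + f * E' <= kap * f + c)%N.
Proof.
move=> tE Pq fP q0 ED nD tn' tE' hh.
have [x xE] : exists x, (q = P + x.+1)%N by exists (q.-1 - P)%N; lia.
have [y yE] : exists y, (D' = E' + y)%N by exists (D' - E')%N; lia.
have [z zE] : exists z, (P = f + z)%N by exists (P - f)%N; lia.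
have [w wE] : exists w, (n0 = t' + w)%N by exists (n0 - t')%N; lia.
have [v vE] : exists v, (D' = n0 + v)%N by exists (D' - n0)%N; lia.
have e1 : (q - P = x.+1)%N by lia.
have e2 : (D' - E' = y)%N by lia.
have e3 : (n0 - t' = w)%N by lia.
have e4 : (q.-1 = P + x)%N by lia.
rewrite e1 e2 e3 e4 in hh.
have h1 : (D' * t' = D' * P + D' * x.+1 + D' * kap)%N by rewrite tE xE !mulnDr.
have h2 : (D' * P = E' * P + y * P)%N by rewrite {1}yE mulnDl.
have h3 : (D' * kap = kap * (P + x + kap + w) + kap * v.+1)%N.
  by rewrite -mulnDr mulnC; congr (_ * _)%N; lia.
have h4 : (E' * P = E' * f + E' * z)%N by rewrite zE mulnDr.
move: hh; rewrite h1 h2 h3 h4 !mulnDr mulnS [(P * y)%N]mulnC [(x.+1 * D')%N]mulnC [(E' * f)%N]mulnC; lia.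
Qed.

Lemma ker_trivial_1 xi : Ker xi -> xi = 0.
Proof.
have [o [Q [f [oQ iQ hQ hB [B rB BE]]]]] := choose_basis.
have [Piv [sP fP hP]] := pivot_columns rB BE.
have Km := kill_param1 oQ sP hP hQ.
have st : stiefel (U m0) by have [+ _] := fU m0; apply.
have [W WU hW] := complement_mx st.
have Ko := kill_outer WU iQ hB.
have tE : (t = #|Q| + #|~: Q|)%N by rewrite cardsC card_ord.
have q0 : (0 < #|Q|)%N by apply/card_gt0P; exists o.
have Pq : (#|Piv| <= #|Q|.-1)%N.
  by have := subset_leq_card sP; have := cardsD1 o Q; rewrite oQ => ->.
have ED : (E <= D)%N by apply: leq_trans (mode_bound (isT : m1 != m0)); exact: leq_addl.
have tE1 : (t.-1 <= E)%N by exact: leq_maxr.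
have E2 : (2 <= E)%N by exact: leq_maxl.
(* If the count forces both [#|~: Q|] and [c] to be 0, the kernel is cut out by no functionals and
   hence is trivial. *)
have key c : kill c (fun xi : X => Ker xi /\ forall l, l \notin Q -> rw xi l = 0) (fun xi => forall l, rw xi l = 0) ->
  ((#|~: Q| + f * E <= #|~: Q| * f + c)%N -> (#|~: Q| = 0)%N /\ c = 0%N) -> forall xi, Ker xi -> xi = 0.
  move=> Kc hc.
  have Kg : kill (#|~: Q| * ((n m0 - t) + (#|~: Q| + f)) + c) (fun xi : X => Ker xi) (fun xi => xi = 0).
    have Kc' : kill c (fun xi : X => Ker xi /\ ((forall l, l \notin Q -> rw xi l = 0) /\ forall j, W^T *m h xi j m0 = 0))
       (fun xi => forall l, rw xi l = 0).
      by apply: kill_weaken Kc => // x [K [h1 _]].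
    apply: kill_weaken (kill_seq Ko Kc') => // x K [[_ h2] h1]; exact: ker_rows K h1 h2.
  have cnt := counting k3 fU tn dd dl horth Km Kg.
  have cE : (\sum_(i : 'I_k | ~~ (i < 1)%N) (n i).-1 = D)%N by apply: eq_bigl => i; rewrite mode0.
  rewrite -big_distrl /= cE in cnt.
  have [k0 c0] := hc (count_arith tE Pq fP q0 ED hD (tn m0) tE1 cnt).
  by rewrite k0 c0 mul0n in Kg; exact: kill0_inv Kg.
move: xi; have [q1|q1] := eqVneq #|Q| 1%N.
  move: q1 => /eqP/cards1P[y yE]; apply: (key 0%N); first by rewrite yE; exact: kill_inner1.
  have f0 : f = 0%N by move: Pq; rewrite yE cards1; move: fP; clear; lia.
  by rewrite f0; clear; lia.
have q2 : (2 <= #|Q|)%N by move: q0 q1; clear; lia.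
(* If some basis column is not tangent at another one, the last entry of the skew matrix costs
   nothing. *)
have [|hT] := pselect (exists l1 l2, [/\ l1 \in Q, l2 \in Q, l1 != l2 & ~ L l2 (delta_mx ord0 l1)]).
  move=> [l1 [l2 [l1Q l2Q l12 hL]]].
  apply: key (kill_inner2 (c2 := 0) l1Q l2Q l12 hB _) _ => //.
  move: tE tE1 E2 q2 fP Pq; rewrite addn0; clear; move: #|Q| #|~: Q| #|Piv| (E) => q kap P E' -> h1 h2 h3 h4 h5 h6.
  have [fz|f0] := posnP f; first by move: h6; rewrite fz !muln0; lia.
  have : (f * E' >= f * (q + kap).-1)%N by rewrite leq_mul2l h1 orbT.
  have -> : ((q + kap).-1 = (q - 2) + 1 + kap)%N by lia.
  move: h6; rewrite !mulnDr muln1 [(f * (q - 2))%N]mulnC [(f * kap)%N]mulnC; lia.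
(* Otherwise every basis column is tangent at [xx o], so all vectors supported in [Q] lie in [L o];
   the large [f] outweighs the one extra functional. *)
have fq : (#|Q| <= f.+1)%N.
  rewrite -rB; pose N : 'M[R]_(#|Q|, t) := rowsub (fun i => enum_val i) 1%:M.
  have fN : row_free N.
    apply/row_freeP; exists N^T; apply/matrixP => a b; rewrite !mxE (bigD1 (enum_val a)) //= !mxE eqxx mul1r.
    rewrite big1 ?addr0 => [|j ja]; last by rewrite !mxE eq_sym (negPf ja) mul0r.
    by rewrite (inj_eq enum_val_inj) eq_sym.
  rewrite -(eqP fN); apply: mxrankS; apply/row_subP => a.
  have -> : row a N = delta_mx ord0 (enum_val a).
    by apply/rowP => j; rewrite !mxE eqxx /= eq_sym.
  have aQ := enum_valP a.
  apply/BE; split.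
    have [->|ao] := eqVneq (enum_val a) o; first exact: L_delta.
    by apply: contrapT => hL; apply: hT; exists (enum_val a), o.
  by move=> j jQ; rewrite mxE /= (_ : j == enum_val a = false) //; apply/negbTE; apply: contraNneq jQ => ->.
have [l1 l1Q lo1] : exists2 l1, l1 \in Q & l1 != o.
  have /card_gt0P[l] : (0 < #|Q :\ o|)%N by move: q2; rewrite (cardsD1 o Q) oQ add1n.
  by rewrite in_setD1 => /andP[]; exists l.
apply: key (kill_inner2 (c2 := 1) l1Q oQ lo1 hB _) _ => //.
move: tE tE1 E2 q2 fP Pq fq; clear; move: #|Q| #|~: Q| #|Piv| (E) => q kap P E' -> h1 h2 h3 h4 h5 h6 h7.
have f0 : (0 < f)%N by lia.
have : (f * E' >= f * (q + kap).-1)%N by rewrite leq_mul2l h1 orbT.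
have e : ((q + kap).-1 = (q - 2) + 1 + kap)%N by lia.
rewrite e !mulnDr muln1 [(f * (q - 2))%N]mulnC [(f * kap)%N]mulnC => h8.
(* For two basis columns [f] is 1, and the bound 2 on [E'] decides. *)
have [q3|q3] := leqP q 2; last by lia.
have -> : (q - 2 = 0)%N by lia.
have fE : (f = 1)%N by lia.
move: h8; rewrite fE; lia.
Qed.

End Count.

End One.

(** * Nondegenerate critical points *)

Lemma sum_predn (I : finType) (P : pred I) (F : I -> nat) : (forall i, 0 < F i)%N ->
  (\sum_(i | P i) (F i).-1 + #|P| = \sum_(i | P i) F i)%N.
Proof.
move=> hF; rewrite -sum1_card -big_split; apply: eq_bigr => i _ /=.
by rewrite addn1 prednK.
Qed.

Definition size_condition k (n : 'I_k -> nat) : Prop :=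
  (forall i0 : 'I_k, val i0 = 0%N ->
        (n i0 + k - 1 <= \sum_(i : 'I_k | (0 < val i)%N) n i)%N) /\
  (forall i2 : 'I_k, (0 < val i2)%N ->
        (n i2 + k <= \sum_(i : 'I_k | (0 < val i)%N) n i)%N).

Section SizeCondition.
Variables (k : nat) (n : 'I_k -> nat) (m0 : 'I_k).
Hypotheses (hn : forall i, (0 < n i)%N) (m0E : val m0 = 0%N) (hS : size_condition n).

Let pos_mode (i : 'I_k) : (0 < val i)%N = (i != m0).
Proof. by rewrite lt0n -m0E. Qed.

Lemma size_condition_sum : (n m0 <= \sum_(i | i != m0) (n i).-1)%N.
Proof.
have [/(_ _ m0E) + _] := hS; rewrite (eq_bigl _ _ pos_mode).
have := sum_predn (fun i => i != m0) hn; rewrite cardC1 card_ord => <-.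
have := ltn_ord m0; move: (\sum_(_ | _) _)%N => S; lia.
Qed.

Lemma size_condition_pair i : i != m0 -> (2 <= \sum_(i' | (i' != m0) && (i' != i)) (n i').-1)%N.
Proof.
move=> im; have [_ /(_ i)] := hS; rewrite pos_mode => /(_ im); rewrite (eq_bigl _ _ pos_mode).
have := sum_predn (fun i => i != m0) hn; rewrite cardC1 card_ord => <-.
rewrite (bigD1 i) //=; have := ltn_ord i; have := hn i; move: (\sum_(_ | _) _)%N => S; lia.
Qed.
End SizeCondition.

Lemma Hess_nondegenerate (R : realType) k (n : 'I_k -> nat) s t (A : tensor R n) (U : mats R n t) P Z :
  (3 <= k)%N -> (1 <= s <= k)%N -> (forall i, 0 < n i)%N -> (forall i, t <= n i)%N ->
  (s = 1%N -> size_condition n) -> ~ special A ->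
  feasible s U -> multiplier s P -> (forall i, Vmat A U i *m Lam A U = U i *m P i) ->
  (forall j, lam A U j != 0) ->
  tangent s U Z -> (forall H, tangent s U H -> Hess A U P Z H = 0) -> forall i, Z i = 0.
Proof.
move=> k3 /andP[s1 sk] n0 tn hs /derivation_family[d [dd dA dl]] fU hP hK lm0 tZ hZ i.
case: (posnP t) => [t0|t0].
  by apply/matrixP => a j; exfalso; have := leq_ltn_trans (leq0n _) (ltn_ord j); rewrite t0.
(* [Z] together with the variation of [lam] that it induces. *)
pose xi : dirs R n t := [ffun c => match c with
  | inl (existT i (a, j)) => Z i a j
  | inr j => Dtau A (colfam U j) (colfam Z j) end].
have HE : Hof xi = Z by apply: functional_extensionality_dep => i'; apply/matrixP => a j; rewrite mxE ffunE.
have bE : bof xi = fun j => Dtau A (colfam U j) (colfam Z j).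
  by apply: functional_extensionality_dep => j; rewrite /bof ffunE.
have horth a : (forall i, map_mx (d a) (U i) = 0) -> (forall j, d a (lam A U j) = 0) ->
  forall H b, tangent s U H -> Theta U (lam A U) H b a = 0.
  by apply: Theta_orth.
have K : tangent s U (Hof xi) /\ forall a, Theta U (lam A U) (Hof xi) (bof xi) a = 0.
  by rewrite HE bE; split => //; apply: (Hess_kernel hP hK fU dd dA tZ hZ).
suff xi0 : xi = 0 by rewrite -HE xi0; apply/matrixP => a j; rewrite !mxE ffunE.
have [s3|] := leqP 3 s; first by apply: (ker_trivial_ge3 k3 fU lm0) K; rewrite s3.
move=> s3; have [s2|s1'] := eqVneq s 2%N.
  by move: fU horth K; rewrite s2 => fU horth; apply: (ker_trivial_2 k3 fU lm0 tn dd dl horth).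
have {s3 s1'} sE : s = 1%N by lia.
have hS := hs sE; move: fU horth K; rewrite sE => fU horth.
apply: (ker_trivial_1 (k3 := k3) fU lm0 tn t0 dd dl horth).
- exact: size_condition_sum.
- exact: size_condition_pair.
Qed.

(** * Limits along an ultrafilter *)

Section Limit.
Local Open Scope classical_set_scope.
Local Open Scope ring_scope.
Variable R : realType.
Implicit Types (u v : nat -> R) (a b l : R).

Definition bdd u := exists M, forall p, `|u p| <= M.

(* A notion of limit for which every bounded sequence converges. *)
Record generalized_limit (tends : (nat -> R) -> R -> Prop) : Prop := GeneralizedLimit {
  tends_cst : forall a, tends (fun=> a) a;
  tendsD : forall u v a b, tends u a -> tends v b -> tends (fun p => u p + v p) (a + b);
  tendsM : forall u v a b, tends u a -> tends v b -> tends (fun p => u p * v p) (a * b);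
  tends_uniq : forall u a b, tends u a -> tends u b -> a = b;
  tends_bdd : forall u, bdd u -> exists a, tends u a;
  tends_null : forall u, (forall e, 0 < e -> exists m, forall p, (m <= p)%N -> `|u p| <= e) -> tends u 0;
  tends_cluster : forall u a e m, tends u a -> 0 < e -> exists2 p, (m <= p)%N & `|u p - a| <= e }.

(** An ultrafilter finer than [\oo] assigns limits to all bounded sequences at once, so that no
    subsequences have to be extracted. *)
Lemma generalized_limit_exists : exists tends, generalized_limit tends.
Proof.
have [G [GU GE]] := ultraFilterLemma (F := nbhs \oo%classic) _.
have GP : ProperFilter G by exact: ultra_proper.
exists (fun u l => (u @ G --> l)%classic).
split.
- move=> a; exact: cvg_cst.
- move=> u v a b; exact: cvgD.
- move=> u v a b; exact: cvgM.
- move=> u a b ua ub; have := cvg_lim (@norm_hausdorff _ _) ua; have := cvg_lim (@norm_hausdorff _ _) ub.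
  by move=> -> ->.
- move=> u [M hM].
  have := @segment_compact R (- M) M; rewrite compact_ultra => /(_ (u @ G)%classic).
  have uU : UltraFilter (u @ G)%classic.
    split; first exact: fmap_proper_filter.
    move=> H HP uH; rewrite eqEsubset; split => // A HA.
    have [//|/= nA] := in_ultra_setVsetC (u @^-1` A) GU.
    have : H (A `&` ~` A) by apply: filterI => //; exact: uH.
    by rewrite setICr => /filter_not_empty.
  case=> // [|l [_ hl]]; last by exists l.
  change (G (u @^-1` [set` `[(- M), M]])); apply: filterE => p /=; rewrite in_itv /= -ler_norml; exact: hM.
- move=> u hu; apply/cvgrPdist_le => e e0.
  have [m hm] := hu e e0.
  apply: GE; exists m => // p /= mp; rewrite sub0r normrN; exact: hm.
- move=> u a e m /cvgrPdist_le h e0.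
  have h1 := h e e0.
  have h2 : G [set p | (m <= p)%N]%classic by apply: GE; exists m.
  have [p [/= p1 p2]] := filter_ex (filterI h1 h2).
  by exists p => //; rewrite distrC.
Qed.

Section Rules.
Variables (tends : (nat -> R) -> R -> Prop).
Hypothesis hT : generalized_limit tends.

Lemma tends_ext u v a b : (forall p, u p = v p) -> a = b -> tends u a -> tends v b.
Proof. by move=> h ->; rewrite (functional_extensionality_dep h). Qed.

Lemma tendsZ c u a : tends u a -> tends (fun p => c * u p) (c * a).
Proof. by move=> ua; apply: (tendsM hT) => //; exact: tends_cst. Qed.

Lemma tendsN u a : tends u a -> tends (fun p => - u p) (- a).
Proof. by move=> /(tendsZ (-1)); apply: tends_ext => [p|]; rewrite mulN1r. Qed.

Lemma tendsB u v a b : tends u a -> tends v b -> tends (fun p => u p - v p) (a - b).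
Proof. by move=> ua vb; apply: (tendsD hT) => //; exact: tendsN. Qed.

Lemma tends_sum (I : Type) (r : seq I) (P : pred I) (u : I -> nat -> R) (a : I -> R) :
  (forall i, P i -> tends (u i) (a i)) -> tends (fun p => \sum_(i <- r | P i) u i p) (\sum_(i <- r | P i) a i).
Proof.
move=> h; elim: r => [|i r IH].
  by apply: tends_ext (tends_cst hT 0) => [p|]; rewrite big_nil.
case: (boolP (P i)) => Pi.
  by apply: tends_ext (tendsD hT (h _ Pi) IH) => [p|]; rewrite big_cons Pi.
by apply: tends_ext IH => [p|]; rewrite big_cons (negPf Pi).
Qed.

Lemma tends_prod (I : Type) (r : seq I) (P : pred I) (u : I -> nat -> R) (a : I -> R) :
  (forall i, P i -> tends (u i) (a i)) -> tends (fun p => \prod_(i <- r | P i) u i p) (\prod_(i <- r | P i) a i).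
Proof.
move=> h; elim: r => [|i r IH].
  by apply: tends_ext (tends_cst hT 1) => [p|]; rewrite big_nil.
case: (boolP (P i)) => Pi.
  by apply: tends_ext (tendsM hT (h _ Pi) IH) => [p|]; rewrite big_cons Pi.
by apply: tends_ext IH => [p|]; rewrite big_cons (negPf Pi).
Qed.

Lemma tends_ge0 u a m : (forall p, (m <= p)%N -> 0 <= u p) -> tends u a -> 0 <= a.
Proof.
move=> h ua; rewrite leNgt; apply/negP => a0.
have a2 : 0 < - a / 2 by lra.
have [p /h p0] := tends_cluster hT m ua a2.
rewrite ler_norml => /andP[_]; lra.
Qed.

Lemma tends_le u a b m : (forall p, (m <= p)%N -> b <= u p) -> tends u a -> b <= a.
Proof.
move=> h ua; rewrite -subr_ge0; apply: (tends_ge0 (m := m) (u := fun p => u p - b)).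
  by move=> p /h; rewrite subr_ge0.
by apply: tendsB => //; exact: tends_cst.
Qed.

Lemma tends_inv_bound u c : 0 <= c -> (forall p, `|u p| <= c / p.+1%:R) -> tends u 0.
Proof.
move=> c0 h; apply: (tends_null hT) => e e0.
have [m hm] : exists m : nat, c / e < m%:R.
  by exists (Num.bound (c / e)); apply: archi_boundP; apply: divr_ge0 => //; exact: ltW.
exists m => p mp; apply: le_trans (h p) _.
rewrite ler_pdivrMr ?ltr0Sn // mulrC -ler_pdivrMr //; apply: ltW; apply: lt_le_trans hm _.
by rewrite ler_nat; apply: leq_trans mp (leqnSn _).
Qed.

Lemma tends_null_sqr u : tends (fun p => u p ^+ 2) 0 -> bdd u -> tends u 0.
Proof.
move=> u2 /(tends_bdd hT)[a ua].
have /eqP := tends_uniq hT u2 (tendsM hT ua ua); rewrite eq_sym mulf_eq0 orbb => /eqP a0.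
by rewrite -a0.
Qed.

Definition tendsm m q (M : nat -> 'M[R]_(m, q)) (L : 'M[R]_(m, q)) :=
  forall i j, tends (fun p => M p i j) (L i j).

Lemma tendsm_mul m q r (M : nat -> 'M[R]_(m, q)) (N : nat -> 'M[R]_(q, r)) L K :
  tendsm M L -> tendsm N K -> tendsm (fun p => M p *m N p) (L *m K).
Proof.
move=> h1 h2 i j; apply: (@tends_ext (fun p => \sum_l M p i l * N p l j) _ (\sum_l L i l * K l j)).
- by move=> p; rewrite mxE.
- by rewrite mxE.
- by apply: tends_sum => l _; apply: (tendsM hT).
Qed.

Lemma tendsm_cst m q (L : 'M[R]_(m, q)) : tendsm (fun=> L) L.
Proof. by move=> i j; exact: tends_cst. Qed.

Lemma tendsm_tr m q (M : nat -> 'M[R]_(m, q)) L : tendsm M L -> tendsm (fun p => (M p)^T) L^T.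
Proof. by move=> h i j; apply: tends_ext (h j i) => [p|]; rewrite mxE. Qed.

Lemma tendsmD m q (M N : nat -> 'M[R]_(m, q)) L K :
  tendsm M L -> tendsm N K -> tendsm (fun p => M p + N p) (L + K).
Proof. by move=> h1 h2 i j; apply: tends_ext (tendsD hT (h1 i j) (h2 i j)) => [p|]; rewrite mxE. Qed.

Lemma tendsmZ m q (u : nat -> R) a (M : nat -> 'M[R]_(m, q)) L :
  tends u a -> tendsm M L -> tendsm (fun p => u p *: M p) (a *: L).
Proof. by move=> h1 h2 i j; apply: tends_ext (tendsM hT h1 (h2 i j)) => [p|]; rewrite mxE. Qed.

Lemma tendsm_uniq m q (M : nat -> 'M[R]_(m, q)) L K : tendsm M L -> tendsm M K -> L = K.
Proof. by move=> h1 h2; apply/matrixP => i j; exact: (tends_uniq hT (h1 i j)). Qed.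

Lemma tendsm_bdd m q (M : nat -> 'M[R]_(m, q)) c : (forall p i j, `|M p i j| <= c) -> exists L, tendsm M L.
Proof.
move=> h.
have /choice[L hL] (ij : 'I_m * 'I_q) : exists a, tends (fun p => M p ij.1 ij.2) a.
  by apply: (tends_bdd hT); exists c => p.
by exists (\matrix_(i, j) L (i, j)) => i j; rewrite mxE; exact: (hL (i, j)).
Qed.

End Rules.
End Limit.

(** * Polar factors *)

Section Polar.
Variable R : realType.

(** First-order optimality without derivatives; the test value is [b / c] with [c] above [a]. *)
Lemma quad_le0 (a b : R) : (forall h, h * b <= h ^+ 2 * a) -> b = 0.
Proof.
move=> h; apply/eqP; rewrite -sqrf_eq0; apply/eqP/le_anti; rewrite sqr_ge0 andbT.
pose c := `|a| + 1.
have c0 : 0 < c by rewrite /c; have := normr_ge0 a; lra.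
have ac : a < c by rewrite /c; have := ler_norm a; lra.
have := h (b / c); have -> : (b / c) ^+ 2 * a = b ^+ 2 * (a / c ^+ 2) by field; lra.
have -> : b / c * b = b ^+ 2 / c by field; lra.
move=> h1; have h2 : b ^+ 2 * ((c - a) / c ^+ 2) <= 0.
  by have -> : (c - a) / c ^+ 2 = 1 / c - a / c ^+ 2 :> R; [field; lra|rewrite mulrBr mul1r; lra].
have p : 0 < (c - a) / c ^+ 2 by apply: divr_gt0; [lra|apply: exprn_gt0].
by rewrite pmulr_lle0 in h2.
Qed.

Lemma mip_rows m t (M N : 'M[R]_(m, t)) : mip M N = \sum_a \sum_j M a j * N a j.
Proof.
rewrite mip_col exchange_big; apply: eq_bigr => j _; apply: eq_bigr => a _; by rewrite !mxE.
Qed.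

(* Rotating two rows of a maximizer [Q] cannot increase [<Q, X>]. *)
Lemma polar_row_sym m t (Q X : 'M[R]_(m, t)) p q : polar Q X ->
  \sum_j X p j * Q q j = \sum_j X q j * Q p j.
Proof.
move=> [sQ mQ]; have [->//|pq] := eqVneq p q.
pose G c s : 'M[R]_(m, t) := \matrix_(a, j) if a == p then c * Q p j - s * Q q j
  else if a == q then s * Q p j + c * Q q j else Q a j.
have split2 (F : 'I_m -> R) : \sum_a F a = F p + F q + \sum_(a | (a != p) && (a != q)) F a.
  by rewrite (bigD1 p) //= (bigD1 q) 1?eq_sym //= addrA.
have Gp c s j : G c s p j = c * Q p j - s * Q q j by rewrite mxE eqxx.
have Gq c s j : G c s q j = s * Q p j + c * Q q j by rewrite mxE eq_sym (negPf pq) eqxx.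
have Go c s a j : a != p -> a != q -> G c s a j = Q a j by move=> /negPf ap /negPf aq; rewrite mxE ap aq.
have sG c s : c ^+ 2 + s ^+ 2 = 1 -> stiefel (G c s).
  move=> cs; rewrite /stiefel -sQ; apply/matrixP => i j; rewrite !mxE !split2.
  rewrite ![(G c s)^T _ _]mxE !Gp !Gq ![Q^T _ _]mxE; congr (_ + _).
    transitivity ((c ^+ 2 + s ^+ 2) * (Q p i * Q p j + Q q i * Q q j)); first by ring.
    by rewrite cs mul1r.
  by apply: eq_bigr => a /andP[ap aq]; rewrite ![_^T _ _]mxE !Go.
pose al := \sum_j (Q p j * X p j + Q q j * X q j).
pose be := \sum_j (Q p j * X q j - Q q j * X p j).
have E c s : mip (G c s) X - mip Q X = (c - 1) * al + s * be.
  rewrite !mip_rows !split2.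
  have -> : \sum_(a | (a != p) && (a != q)) \sum_j G c s a j * X a j =
      \sum_(a | (a != p) && (a != q)) \sum_j Q a j * X a j.
    by apply: eq_bigr => a /andP[ap aq]; apply: eq_bigr => j _; rewrite Go.
  rewrite [X in X - _](_ : _ = (\sum_j G c s p j * X p j + \sum_j G c s q j * X q j)
    + \sum_(a | (a != p) && (a != q)) \sum_j Q a j * X a j) //.
  rewrite [LHS](_ : _ = \sum_j G c s p j * X p j + \sum_j G c s q j * X q j
    - (\sum_j Q p j * X p j + \sum_j Q q j * X q j)); last by ring.
  rewrite /al /be !mulr_sumr -!big_split /= -sumrB; apply: eq_bigr => j _.
  by rewrite Gp Gq; ring.
have be0 : be = 0.
  apply: (@quad_le0 al) => x.
  have d0 : 0 < 1 + x ^+ 2 by have := sqr_ge0 x; lra.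
  (* Rational parametrization of the circle: comparison with [Q] becomes a quadratic inequality in
     [x]. *)
  have cs : ((1 - x ^+ 2) / (1 + x ^+ 2)) ^+ 2 + (2 * x / (1 + x ^+ 2)) ^+ 2 = 1 by field; lra.
  have := mQ _ (sG _ _ cs); rewrite -subr_le0 -/(mip _ _) -/(mip _ _) E.
  have -> : ((1 - x ^+ 2) / (1 + x ^+ 2) - 1) * al + 2 * x / (1 + x ^+ 2) * be
    = (x * be - x ^+ 2 * al) * (2 / (1 + x ^+ 2)) by field; lra.
  by rewrite pmulr_lle0 ?divr_gt0 // subr_le0.
apply/eqP; rewrite eq_sym -subr_eq0 -sumrB; apply/eqP; apply: etrans be0; apply: eq_bigr => j _; ring.
Qed.

Lemma polar_factor m t (Q X : 'M[R]_(m, t)) : polar Q X ->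
  (Q^T *m X)^T = Q^T *m X /\ X = Q *m (Q^T *m X).
Proof.
move=> hQ; have [sQ _] := hQ.
have E : X *m Q^T = Q *m X^T.
  apply/matrixP => p q; have := polar_row_sym p q hQ; rewrite !mxE => h.
  transitivity (\sum_j X p j * Q q j); first by apply: eq_bigr => j _; rewrite mxE.
  by rewrite h; apply: eq_bigr => j _; rewrite mxE mulrC.
have EX : X = Q *m (X^T *m Q) by rewrite mulmxA -E -mulmxA sQ mulmx1.
have ES : Q^T *m X = X^T *m Q by rewrite {1}EX mulmxA sQ mul1mx.
by split; [rewrite trmx_mul trmxK ES|rewrite ES].
Qed.

(** The infimum [mu] of the Rayleigh quotient is attained at a limit [w] and is an eigenvalue:
    [S - mu] is positive semidefinite and its form vanishes at [w], so [w] lies in its kernel. Hence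
    [mu] is not below [eps]. *)
Lemma rayleigh t (S : 'M[R]_t) eps : S^T = S -> ~ mineig_lt S eps ->
  forall x : 'rV[R]_t, eps * (x *m x^T) ord0 ord0 <= (x *m S *m x^T) ord0 ord0.
Proof.
move=> hS hm.
pose nn (x : 'rV[R]_t) := (x *m x^T) ord0 ord0.
pose q (x : 'rV[R]_t) := (x *m S *m x^T) ord0 ord0.
have nnE x : nn x = \sum_j x ord0 j ^+ 2.
  by rewrite /nn mxE; apply: eq_bigr => j _; rewrite mxE expr2.
have nn0 x : 0 <= nn x by rewrite nnE; apply: sumr_ge0 => j _; exact: sqr_ge0.
have nn_eq0 x : nn x = 0 -> x = 0.
  rewrite nnE => /eqP; rewrite psumr_eq0 => [/allP h|j _]; last exact: sqr_ge0.
  apply/rowP => j; have := h j (mem_index_enum _); by rewrite sqrf_eq0 mxE => /eqP.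
have nnZ c x : nn (c *: x) = c ^+ 2 * nn x.
  by rewrite /nn linearZ /= -scalemxAl -scalemxAr scalerA !mxE expr2.
have qZ c x : q (c *: x) = c ^+ 2 * q x.
  by rewrite /q linearZ /= -scalemxAl -scalemxAl -scalemxAr scalerA !mxE expr2.
have ent1 x j : nn x = 1 -> `|x ord0 j| <= 1.
  rewrite nnE => e; rewrite -(@expr_le1 _ 2) // real_normK ?num_real // -e (bigD1 j) //= lerDl.
  by apply: sumr_ge0 => i _; exact: sqr_ge0.
have qE x : q x = \sum_j \sum_l x ord0 l * S l j * x ord0 j.
  by rewrite /q mxE; apply: eq_bigr => j _; rewrite !mxE mulr_suml.
move=> x; rewrite -/(nn x) -/(q x).
have [x0|x0] := eqVneq x 0; first by rewrite x0 /nn /q !mul0mx !mxE mulr0.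
have nx : 0 < nn x.
  by rewrite lt_neqAle nn0 andbT eq_sym; apply: contraNneq x0 => /nn_eq0 ->.
pose y0 := (Num.sqrt (nn x))^-1 *: x.
have y01 : nn y0 = 1 by rewrite nnZ exprVn sqr_sqrtr // mulVf // gt_eqF.
pose E : set R := [set r | exists2 y, nn y = 1 & r = q y]%classic.
have hE : has_inf E.
  split; first by exists (q y0), y0.
  exists (- \sum_j \sum_l `|S l j|) => r [y y1 ->]; rewrite qE -sumrN; apply: ler_sum => j _.
  rewrite -sumrN; apply: ler_sum => l _.
  rewrite lerNl; apply: le_trans (ler_norm _) _; rewrite normrN !normrM -mulrA mulrCA.
  by apply: ler_piMr => //; apply: mulr_ile1; rewrite ?normr_ge0 ?ent1.
pose mu := inf E.
have muq y : mu * nn y <= q y.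
  have [->|y00] := eqVneq y 0; first by rewrite /nn /q !mul0mx !mxE mulr0.
  have ny : 0 < nn y.
    by rewrite lt_neqAle nn0 andbT eq_sym; apply: contraNneq y00 => /nn_eq0 ->.
  have : mu <= q ((Num.sqrt (nn y))^-1 *: y).
    apply: ge_inf; first by case: hE.
    by exists ((Num.sqrt (nn y))^-1 *: y) => //; rewrite nnZ exprVn sqr_sqrtr // mulVf // gt_eqF.
  by rewrite qZ exprVn sqr_sqrtr // mulrC ler_pdivlMr.
have [tends hT] := generalized_limit_exists R.
have /choice[z hz] (p : nat) : exists z, nn z = 1 /\ q z < mu + p.+1%:R^-1.
  have p0 : 0 < (p.+1%:R^-1 : R) by rewrite invr_gt0 ltr0Sn.
  have [r [z z1 ->] hr] := inf_adherent p0 hE.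
  by exists z.
have [w hw] : exists w, tendsm tends z w.
  apply: (tendsm_bdd hT (c := 1)) => p i j; rewrite (ord1 i); apply: ent1; by case: (hz p).
have w1 : nn w = 1.
  have := tendsm_mul hT hw (tendsm_tr hw) => /(_ ord0 ord0).
  have : tends (fun p => (z p *m (z p)^T) ord0 ord0) 1.
    apply: tends_ext (tends_cst hT 1) => // p; by case: (hz p).
  by move=> h1 h2; exact: (tends_uniq hT h2 h1).
have qw : q w = mu.
  have h1 := tendsm_mul hT (tendsm_mul hT hw (tendsm_cst hT S)) (tendsm_tr hw) ord0 ord0.
  have h2 : tends (fun p => q (z p) - mu) 0.
    apply: (tends_inv_bound hT (c := 1)) => // p; have [z1 zq] := hz p.
    rewrite ger0_norm ?div1r; first by rewrite lerBlDl ltW.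
    by rewrite subr_ge0; have := muq (z p); rewrite z1 mulr1.
  have := tends_uniq hT h2 (tendsB hT h1 (tends_cst hT mu)).
  by move=> /eqP; rewrite eq_sym subr_eq0 => /eqP.
have eig : eigenvalue S mu.
  apply/eigenvalueP; exists w; last first.
    by apply: contra_eq_neq w1 => ->; rewrite /nn mul0mx mxE eq_sym oner_neq0.
  pose T := S - mu%:M; pose B (x y : 'rV[R]_t) := (x *m T *m y^T) ord0 ord0.
  have mD (M N : 'M[R]_1) : (M + N) ord0 ord0 = M ord0 ord0 + N ord0 ord0 by rewrite mxE.
  have mN (M : 'M[R]_1) : (- M) ord0 ord0 = - M ord0 ord0 by rewrite mxE.
  have mZ a (M : 'M[R]_1) : (a *: M) ord0 ord0 = a * M ord0 ord0 by rewrite mxE.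
  have Blin c x1 y1 x2 y2 : B (x1 + c *: y1) (x2 + c *: y2) =
      B x1 x2 + c * B x1 y2 + c * B y1 x2 + c ^+ 2 * B y1 y2.
    rewrite /B; move: (T) => N; rewrite [(x2 + _)^T]linearD /= [(c *: y2)^T]linearZ /= !mulmxDl !mulmxDr -!scalemxAl -!scalemxAr.
    rewrite !(mD, mZ); ring.
  have Bsym x1 y1 : B x1 y1 = B y1 x1.
    rewrite /B; have -> : y1 *m T *m x1^T = (x1 *m T *m y1^T)^T; last by rewrite [RHS]mxE.
    have TT : T^T = T by apply/matrixP => i j; rewrite !mxE -[in LHS]hS mxE eq_sym.
    by rewrite !trmx_mul trmxK TT mulmxA.
  have BE x1 : B x1 x1 = q x1 - mu * nn x1.
    rewrite /B /T mulmxBr mulmxBl mul_mx_scalar -scalemxAl.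
    by rewrite mD mN mZ.
  have Bw y1 : B w y1 = 0.
    apply: (@quad_le0 (B y1 y1 / 2)) => c.
    have : 0 <= B (w + (- c) *: y1) (w + (- c) *: y1) by rewrite BE subr_ge0.
    rewrite Blin (Bsym y1 w) (BE w) qw w1 sqrrN; lra.
  have : nn (w *m T) = 0 by exact: Bw.
  by move=> /nn_eq0 /eqP; rewrite /T mulmxBr mul_mx_scalar subr_eq0 => /eqP.
rewrite -subr_ge0; apply: le_trans (_ : (mu - eps) * nn x <= _).
  apply: mulr_ge0 => //; rewrite subr_ge0 leNgt; apply/negP => h; by apply: hm; exists mu.
by have := muq x; rewrite mulrBl; lra.
Qed.

Lemma mip_psd m t (S : 'M[R]_t) eps (D : 'M[R]_(m, t)) : S^T = S -> ~ mineig_lt S eps ->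
  eps * mip D D <= mip (D *m S) D.
Proof.
move=> hS hm; rewrite !mip_rows mulr_sumr; apply: ler_sum => a _.
have rE (M : 'M[R]_(m, t)) : (row a M *m (row a D)^T) ord0 ord0 = \sum_j M a j * D a j.
  by rewrite mxE; apply: eq_bigr => j _; rewrite !mxE.
by have := rayleigh hS hm (row a D); rewrite -(row_mul a D S) !rE.
Qed.

Lemma mip_stiefel m t (Q : 'M[R]_(m, t)) : stiefel Q -> mip Q Q = t%:R.
Proof. by move=> sQ; rewrite /mip sQ mxtrace1. Qed.

(** In the regularized branch, comparing the maximizer with [X] gives the increase, and [eps X] is
    split between the multiplier and the error term, with [th = eps]. Otherwise [th = 0], and the
    increase comes from the eigenvalues of [W^T V], all at least [eps]. *)
Lemma polar_block m t (X W V : 'M[R]_(m, t)) eps : 0 < eps -> stiefel X ->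
  (exists Q, polar Q V /\ (mineig_lt (Q^T *m V) eps -> polar W (V + eps *: X)) /\
     (~ mineig_lt (Q^T *m V) eps -> W = Q)) ->
  [/\ stiefel W, eps / 2 * mip (W - X) (W - X) <= mip V (W - X) &
    exists P th, [/\ P^T = P, 0 <= th <= eps & V = W *m P + th *: (W - X)]].
Proof.
move=> e0 sX [Q [pQ [h1 h2]]].
case: (pselect (mineig_lt (Q^T *m V) eps)) => [/h1 pW|hm].
  have [sW mW] := pW; have [symS VE] := polar_factor pW.
  split => //.
    have := mW _ sX; rewrite -/(mip _ _) -/(mip _ _) !mipDr !mipZr !mipNr !mipDl !mipNl.
    rewrite (mip_stiefel sX) (mip_stiefel sW) (mipC X W) (mipC V W) (mipC V X); nra.
  exists (W^T *m (V + eps *: X) - eps%:M), eps; split.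
  - by apply/matrixP => i j; rewrite mxE [in LHS]mxE [in RHS]mxE -[in LHS]symS !mxE eq_sym.
  - by rewrite lexx (ltW e0).
  - rewrite mulmxBr -VE mul_mx_scalar scalerBr addrA subrK addrK //.
have WQ := h2 hm; rewrite -WQ in pQ hm.
have [sW _] := pQ; have [symS VE] := polar_factor pQ.
split => //; last by exists (W^T *m V), 0; split; rewrite ?lexx ?(ltW e0) ?scale0r ?addr0.
move: (W^T *m V) symS VE hm => S symS VE hm.
have := mip_psd (W - X) symS hm.
(* Both [W] and [X] are orthonormal, so the two square terms equal the trace of [S]. *)
suff -> : mip ((W - X) *m S) (W - X) = 2 * mip V (W - X) by lra.
have e1 : mip (X *m S) W = mip (W *m S) X.
  by rewrite !mip_mulr symS -[LHS]mxtrace_tr !trmx_mul trmxK symS mxtrace_mulC.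
have e2 : mip (X *m S) X = mip (W *m S) W by rewrite !mip_mulr sX sW.
by rewrite [in RHS]VE mulmxBl !mipDl !mipDr !mipNl !mipNr e1 e2; ring.
Qed.

(** Normalizing [v] maximizes the absolute value of its linear form on the sphere. The bound [kappa]
    on the old value keeps [v] away from 0 and makes the gain dominate a multiple of the squared
    step. *)
Lemma als_block m (x v : 'cV[R]_m) kappa : 0 < kappa -> ip x x = 1 -> kappa <= `|ip v x| ->
  let w := Num.sg (ip v x) *: ((vnorm v)^-1 *: v) in
  [/\ ip w w = 1, `|ip v x| <= `|ip v w|,
     kappa ^+ 2 / 2 * ip (w - x) (w - x) <= ip v w ^+ 2 - ip v x ^+ 2 &
     ip v x *: v = (`|ip v x| * vnorm v) *: w].
Proof.
move=> k0 x1 kl; set l := ip v x in kl *.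
have l0 : 0 < `|l| by exact: lt_le_trans k0 kl.
have lne : l != 0 by rewrite -normr_gt0.
set N := vnorm v.
have N2 : N ^+ 2 = ip v v by rewrite /N vnorm_ip sqr_sqrtr // ip_ge0.
have N0 : 0 <= N by rewrite /N vnorm_ip sqrtr_ge0.
have CS : `|l| <= N.
  rewrite -(@ler_pXn2r _ 2) ?nnegrE // N2 real_normK ?num_real //.
  have := ip_ge0 (v - l *: x); rewrite !(ipDl, ipDr, ipNl, ipNr, ipZl, ipZr) (ipC x v) -/l x1 expr2; lra.
have Np : 0 < N by exact: lt_le_trans l0 CS.
have sg2 : Num.sg l * Num.sg l = 1 by rewrite -expr2 sqr_sg lne.
have lE : l * Num.sg l = `|l| by rewrite [RHS]normrEsg mulrC.
have vw : ip v (Num.sg l *: (N^-1 *: v)) = Num.sg l * N.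
  by rewrite !ipZr -N2; field; rewrite gt_eqF.
move=> w; rewrite {}/w; split.
- rewrite !ipZl !ipZr -N2 -[RHS]sg2; field; by rewrite gt_eqF.
- by rewrite vw normrM normr_sg lne mul1r ger0_norm.
- have -> : ip (Num.sg l *: (N^-1 *: v) - x) (Num.sg l *: (N^-1 *: v) - x) = 2 - 2 * (`|l| / N).
    rewrite !(ipDl, ipDr, ipNl, ipNr, ipZl, ipZr) (ipC x v) -/l x1 -N2.
    rewrite (_ : Num.sg l * (N^-1 * (Num.sg l * (N^-1 * N ^+ 2))) = Num.sg l * Num.sg l); last first.
      by field; rewrite gt_eqF.
    rewrite sg2 (_ : Num.sg l * (N^-1 * l) = `|l| / N); last by rewrite -lE; ring.
    ring.
  rewrite vw exprMn (expr2 (Num.sg l)) sg2 mul1r -[l ^+ 2]real_normK ?num_real //.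
  have -> : kappa ^+ 2 / 2 * (2 - 2 * (`|l| / N)) = kappa ^+ 2 * ((N - `|l|) / N) by field; rewrite gt_eqF.
  rewrite mulrA ler_pdivrMr // subr_sqr.
  have kN : kappa <= N by exact: le_trans kl CS.
  have d0 : 0 <= N - `|l| by rewrite subr_ge0.
  rewrite -[leRHS]mulrA [leLHS]mulrC; apply: ler_wpM2l => //.
  have : kappa * kappa <= N * N by apply: ler_pM => //; exact: ltW.
  have : 0 <= `|l| * N by apply: mulr_ge0 => //; exact: ltW.
  rewrite expr2 mulrDl; lra.
- rewrite !scalerA; congr (_ *: _); rewrite -lE; transitivity (l * (Num.sg l * Num.sg l)); first by rewrite sg2 mulr1.
  by field; rewrite gt_eqF.
Qed.

End Polar.

(** * Difference quotients of multilinear forms *)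

Section Telescope.
Variables (R : realType) (k : nat) (n : 'I_k -> nat).
Implicit Types (A : tensor R n) (x y d : vfam R n).

Definition mixv (m : nat) y x : vfam R n := fun l => if (l < m)%N then y l else x l.

Lemma Atau_telescope A y x :
  Atau A y - Atau A x = \sum_(i < k) Atau A (rep (mixv i y x) (fun l => y l - x l) i).
Proof.
have E (i : 'I_k) : Atau A (rep (mixv i y x) (fun l => y l - x l) i) =
    Atau A (mixv i.+1 y x) - Atau A (mixv i y x).
  rewrite Atau_rep ipDr ipNr -!Atau_rep; congr (_ - _); apply: Atau_ext => l; rewrite /rep /mixv.
    have [->|li] := eqVneq l i; first by rewrite ltnSn.
    by rewrite [in RHS]ltnS [in RHS]leq_eqVlt; move: li; rewrite -val_eqE /= => /negPf ->.
  by have [->|li] := eqVneq l i; first by rewrite ltnn.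
rewrite (eq_bigr _ (fun i _ => E i)).
rewrite -(big_mkord xpredT (fun i => Atau A (mixv i.+1 y x) - Atau A (mixv i y x))) telescope_sumr //.
by congr (_ - _); apply: Atau_ext => l; rewrite /mixv ?ltn_ord.
Qed.

Lemma Atau_bound A x (b : 'I_k -> R) : (forall l a, `|x l a ord0| <= b l) ->
  `|Atau A x| <= (\sum_z `|A z|) * \prod_l b l.
Proof.
move=> h; rewrite mulr_suml; apply: le_trans (ler_norm_sum _ _ _) _; apply: ler_sum => z _.
rewrite normrM; apply: ler_wpM2l => //; rewrite normr_prod; apply: ler_prod => l _.
by rewrite normr_ge0 h.
Qed.

Lemma Atau_bound_rep2 A x d d' i i' (b : R) : i != i' -> (forall l a, `|x l a ord0| <= 1) ->
  (forall l a, `|d l a ord0| <= b) -> (forall l a, `|d' l a ord0| <= b) ->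
  `|Atau A (rep (rep x d i) d' i')| <= (\sum_z `|A z|) * (b * b).
Proof.
move=> ii hx hd hd'.
have -> : b * b = \prod_l (if (l == i) || (l == i') then b else 1).
  rewrite (bigD1 i) //= eqxx (bigD1 i') /=; last by rewrite eq_sym.
  rewrite eqxx orbT big1 ?mulr1 // => l /andP[/negPf -> /negPf ->] //.
apply: Atau_bound => l a; rewrite /rep; case: (eqVneq l i') => [e|_]; first by rewrite orbT.
by rewrite orbF; case: eqP.
Qed.

Section Tends.
Variables (tends : (nat -> R) -> R -> Prop).
Hypothesis hT : generalized_limit tends.

Definition tendsv (x : nat -> vfam R n) x0 := forall l a, tends (fun p => x p l a ord0) (x0 l a ord0).

Lemma tends_Atau A (x : nat -> vfam R n) x0 : tendsv x x0 -> tends (fun p => Atau A (x p)) (Atau A x0).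
Proof.
move=> h; apply: (tends_sum hT) => z _; apply: (tendsZ hT).
by apply: (tends_prod hT) => l _; exact: h.
Qed.

Lemma tends_Atau_i A (x : nat -> vfam R n) x0 i a : tendsv x x0 ->
  tends (fun p => Atau_i A (x p) i a ord0) (Atau_i A x0 i a ord0).
Proof.
move=> h; pose c (x : vfam R n) := \sum_(z : idx n | z i == a) A z * \prod_(l : 'I_k | l != i) x l (z l) ord0.
apply: (@tends_ext _ _ (fun p => c (x p)) _ (c x0)) => [p||]; [by rewrite mxE|by rewrite mxE|].
apply: (tends_sum hT) => z _; apply: (tendsZ hT).
by apply: (tends_prod hT) => l _; exact: h.
Qed.

Lemma tendsv_rep (x d : nat -> vfam R n) x0 d0 i : tendsv x x0 -> tendsv d d0 -> tendsv (fun p => rep (x p) (d p) i) (rep x0 d0 i).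
Proof. by move=> h1 h2 l a; rewrite /rep; case: (l == i); [exact: h2|exact: h1]. Qed.

Lemma tendsv_mix m (x y : nat -> vfam R n) x0 : tendsv x x0 -> tendsv y x0 -> tendsv (fun p => mixv m (y p) (x p)) x0.
Proof. by move=> h1 h2 l a; rewrite /mixv; case: (l < m)%N; [exact: h2|exact: h1]. Qed.

Lemma tendsv_cst x : tendsv (fun=> x) x. Proof. by move=> l a; exact: tends_cst. Qed.

(** Telescoping over the modes makes the quotient a sum of multilinear values, which pass to the
    limit. *)
Lemma Atau_quotient A (x d : nat -> vfam R n) x0 d0 (r : nat -> R) : (forall p, r p != 0) ->
  (forall p l, x p l - x0 l = r p *: d p l) -> tendsv x x0 -> tendsv d d0 ->
  tends (fun p => (Atau A (x p) - Atau A x0) / r p) (Dtau A x0 d0).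
Proof.
move=> r0 hx tx td.
apply: (@tends_ext _ _ (fun p => \sum_(i < k) Atau A (rep (mixv i (x p) x0) (d p) i)) _ (Dtau A x0 d0)) => //.
  move=> p; rewrite Atau_telescope mulr_suml; apply: eq_bigr => i _.
  by rewrite !Atau_rep hx ipZr; field.
apply: (tends_sum hT) => i _; apply: tends_Atau; apply: tendsv_rep => //.
by apply: tendsv_mix => //; exact: tendsv_cst.
Qed.

End Tends.
End Telescope.

(** * One step of the algorithm *)

Lemma increasing_gap t t' (f : 'I_t -> 'I_t') : (forall a b : 'I_t, (a < b)%N -> (f a < f b)%N) ->
  forall a b : 'I_t, (a <= b)%N -> (f a + (b - a) <= f b)%N.
Proof.
move=> hf a [b hb]; elim: b hb => [|b IH] hb ab.
  have -> : a = Ordinal hb by apply: val_inj => /=; move: ab => /=; lia.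
  by rewrite subnn addn0.
move: ab => /=; rewrite leq_eqVlt => /orP[/eqP e|ab].
  by have -> : a = Ordinal hb; [exact: val_inj|rewrite subnn addn0].
have h1 := IH (ltnW hb) ab; have := hf (Ordinal (ltnW hb)) (Ordinal hb) (ltnSn b).
move: h1 => /=; lia.
Qed.

(** Hence a step that keeps the number of columns deletes none. *)
Lemma increasing_id t (f : 'I_t -> 'I_t) : (forall a b : 'I_t, (a < b)%N -> (f a < f b)%N) -> forall a, f a = a.
Proof.
move=> hf a; have t0 : (0 < t)%N by exact: leq_ltn_trans (ltn_ord a).
have tl : (t.-1 < t)%N by rewrite prednK.
have h1 := increasing_gap hf (leq0n a : (Ordinal t0 <= a)%N).
have al : (a <= Ordinal tl)%N by rewrite /= -ltnS prednK.
have h2 := increasing_gap hf al.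
have h3 := ltn_ord (f (Ordinal tl)).
apply: val_inj => /=; move: h1 h2 h3 al => /=; lia.
Qed.

Lemma increasing_inj t t' (f : 'I_t -> 'I_t') : (forall a b : 'I_t, (a < b)%N -> (f a < f b)%N) -> injective f.
Proof.
move=> hf a b e; apply: val_inj => /=; case: (ltngtP a b) => // /hf; by rewrite e ltnn.
Qed.

Lemma colsub_stiefel (R : realType) m t t' (f : 'I_t' -> 'I_t) (Q : 'M[R]_(m, t)) :
  injective f -> stiefel Q -> stiefel (colsub f Q).
Proof.
move=> fi sQ; apply/matrixP => a b; have /matrixP/(_ (f a) (f b)) := sQ; rewrite !mxE (inj_eq fi) => <-.
by apply: eq_bigr => c _; rewrite !mxE.
Qed.

Section Step.
Variables (R : realType) (k : nat) (n : 'I_k -> nat) (A : tensor R n) (s : nat).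

Definition sqn t (D : mats R n t) : R := \sum_i mip (D i) (D i).

Lemma frob_sqn t (D : mats R n t) : frob D = Num.sqrt (sqn D).
Proof.
congr Num.sqrt; apply: eq_bigr => i _; rewrite mip_rows; apply: eq_bigr => a _; apply: eq_bigr => j _.
by rewrite expr2.
Qed.

Lemma sqn_ge0 t (D : mats R n t) : 0 <= sqn D.
Proof. by apply: sumr_ge0 => i _; exact: mip_ge0. Qed.

Section Mix.
Variables (t : nat) (Y X : mats R n t).
Notation la m j := (Atau A (mixv m (colfam Y j) (colfam X j))).
Notation v i j := (Atau_i A (xmix Y X i j) i).

Lemma lamix_old (i : 'I_k) j : la i j = ip (v i j) (col j (X i)).
Proof. by rewrite (Atau_slot _ _ i) /mixv ltnn. Qed.

Lemma lamix_new (i : 'I_k) j : la i.+1 j = ip (v i j) (col j (Y i)).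
Proof.
rewrite (Atau_slot _ _ i) {2}/mixv ltnSn; congr ip; apply: Atau_i_ext => l li.
by rewrite /mixv /xmix ltnS leq_eqVlt; move: li; rewrite -val_eqE /= => /negPf ->.
Qed.

Lemma lamix0 j : la 0 j = lam A X j. Proof. by apply: Atau_ext => l. Qed.
Lemma lamixk j : la k j = lam A Y j. Proof. by apply: Atau_ext => l; rewrite /mixv ltn_ord. Qed.

Lemma col_VLmix i j : col j (Vmix A Y X i *m Lmix A Y X i) = la i j *: v i j.
Proof. by apply/matrixP => a b; rewrite /Lmix mul_mx_diag !mxE !ord1 mulrC. Qed.

Definition als_update := forall i : 'I_k, ~ (i < s)%N -> forall j : 'I_t,
  let y := xmix Y X i j in
  col j (Y i) = Num.sg (Atau A y) *: ((vnorm (Atau_i A y i))^-1 *: Atau_i A y i).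

Variable kappa : R.
Hypotheses (k0 : 0 < kappa) (hs : (s <= k)%N) (hX : forall i : 'I_k, ~ (i < s)%N -> oblique (X i)).
Hypotheses (hY : als_update) (hk : forall j, kappa <= `|la s j|).

(** Truncation provides the bound after the first [s] modes; no later update decreases the absolute
    value. *)
Lemma lamix_bound m j : (s <= m)%N -> (m <= k)%N -> kappa <= `|la m j|.
Proof.
elim: m => [|m IH] sm mk; first by have : s = 0%N by [lia|]; move=> <-.
move: sm; rewrite leq_eqVlt => /orP[/eqP <- //|]; rewrite ltnS => sm.
have kl := IH sm (ltnW mk); apply: le_trans kl _.
pose i := Ordinal mk; have is_ : ~ (i < s)%N by apply/negP; rewrite -leqNgt.
have -> : la m j = la i j by [].
have x1 : ip (col j (X i)) (col j (X i)) = 1 by apply/vnorm1; exact: hX.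
have kl : kappa <= `|ip (v i j) (col j (X i))| by rewrite -lamix_old; exact: IH (ltnW mk).
have [_ + _ _] := als_block k0 x1 kl.
rewrite -lamix_old (lamix_new i) (hY is_ j) -/(la i j).
have -> : Atau A (xmix Y X i j) = la i j by [].
by [].
Qed.

Lemma als_facts (i : 'I_k) j : ~ (i < s)%N ->
  [/\ ip (col j (Y i)) (col j (Y i)) = 1,
     kappa ^+ 2 / 2 * ip (col j (Y i) - col j (X i)) (col j (Y i) - col j (X i)) <= la i.+1 j ^+ 2 - la i j ^+ 2 &
     la i j *: v i j = (`|la i j| * vnorm (v i j)) *: col j (Y i)].
Proof.
move=> is_.
have x1 : ip (col j (X i)) (col j (X i)) = 1 by apply/vnorm1; exact: hX.
have kl : kappa <= `|ip (v i j) (col j (X i))|.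
  by rewrite -lamix_old; apply: lamix_bound; [by rewrite leqNgt; exact/negP|exact: ltnW].
have [h1 _ h3 h4] := als_block k0 x1 kl.
rewrite (lamix_new i) (hY is_ j).
have -> : Atau A (xmix Y X i j) = ip (v i j) (col j (X i)) by rewrite -lamix_old.
by rewrite ?lamix_old.
Qed.
End Mix.

(** The diagonal entry tested by the truncation is the value of the form after the first [s] modes
    have been updated. *)
Lemma lamix_cut t t' (f : 'I_t' -> 'I_t) (W X : mats R n t) (Y : mats R n t') kappa (i : 'I_k) j :
  i.+1 = s -> (forall i : 'I_k, (i < s)%N -> Y i = colsub f (W i)) ->
  ~ `|((W i)^T *m Vmix A W X i) (f j) (f j)| < kappa ->
  kappa <= `|Atau A (mixv s (colfam Y j) (colfam (fun l => colsub f (X l)) j))|.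
Proof.
move=> si hY /negP; rewrite -leNgt => h; apply: le_trans h _.
have -> : ((W i)^T *m Vmix A W X i) (f j) (f j) = ip (Atau_i A (xmix W X i (f j)) i) (col (f j) (W i)).
  by rewrite mxE; apply: eq_bigr => a _; rewrite !mxE mulrC.
rewrite -lamix_new si (_ : Atau _ _ = Atau A (mixv s (colfam Y j) (colfam (fun l => colsub f (X l)) j))) //.
apply: Atau_ext => l; rewrite /mixv; case: ifP => ls; rewrite /colfam ?(hY _ ls);
  by apply/matrixP => a b; rewrite !mxE.
Qed.

Lemma iapd_polar_stiefel t eps (W X : mats R n t) (i : 'I_k) :
  (exists Q : 'M[R]_(n i, t),
         polar Q (Vmix A W X i *m Lmix A W X i) /\
         (mineig_lt (Q^T *m (Vmix A W X i *m Lmix A W X i)) eps ->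
            polar (W i) (Vmix A W X i *m Lmix A W X i + eps *: X i)) /\
         (~ mineig_lt (Q^T *m (Vmix A W X i *m Lmix A W X i)) eps -> W i = Q)) -> stiefel (W i).
Proof.
move=> [Q [[sQ _] [h1 h2]]].
case: (pselect (mineig_lt (Q^T *m (Vmix A W X i *m Lmix A W X i)) eps)) => [/h1[]//|/h2 -> //].
Qed.

Variables (eps kappa : R).
Hypotheses (e0 : 0 < eps) (k0 : 0 < kappa) (hs : (1 <= s <= k)%N).

Let s1 : (s.-1 < k)%N. Proof. by case/andP: hs; case: (s). Qed.
Let ls : 'I_k := Ordinal s1.
Let lsE : ls.+1 = s. Proof. by rewrite /= prednK //; case/andP: hs. Qed.
Let sk : (s <= k)%N. Proof. by case/andP: hs. Qed.

Lemma step_feasible tX tY (X : mats R n tX) (Y : mats R n tY) :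
  feasible s X -> iapd_step A s eps kappa X Y -> feasible s Y /\ (tY <= tX)%N.
Proof.
move=> fX [W [hW [f [hf [hcut [hY1 hY2]]]]]].
have fi := increasing_inj hf.
split; last by have := leq_card f fi; rewrite !card_ord.
pose X' : mats R n tY := fun l => colsub f (X l).
have oX (i : 'I_k) : ~ (i < s)%N -> oblique (X' i).
  move=> is_ j; have [_ /(_ is_ (f j)) <-] := fX i; congr vnorm.
  by apply/matrixP => a b; rewrite !mxE.
have hk j : kappa <= `|Atau A (mixv s (colfam Y j) (colfam X' j))|.
  apply: (lamix_cut (i := ls) (W := W)) => //.
  by move=> h; have [/(_ (ex_intro _ j erefl)) + _] := hcut (f j); apply; exists ls.
move=> i; split=> [is_|is_ j].
  by rewrite hY1 //; apply: colsub_stiefel => //; apply: iapd_polar_stiefel; exact: hW.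
by apply/vnorm1; have [] := als_facts k0 sk oX hY2 hk j is_.
Qed.

(* The facts about one iteration without truncation on which convergence rests. *)
Record iteration t (X Y : mats R n t) : Prop := Iteration {
  iter_old : feasible s X;
  iter_new : feasible s Y;
  iter_lam : forall j, kappa <= `|lam A Y j|;
  iter_increase : Num.min eps (kappa ^+ 2 / 2) * sqn (fun i => Y i - X i) <= fobj A Y - fobj A X;
  iter_critical : exists P th, [/\ multiplier s P, forall i, 0 <= th i <= eps &
    forall i, Vmix A Y X i *m Lmix A Y X i = Y i *m P i + th i *: (Y i - X i)] }.

Lemma step_iteration t (X Y : mats R n t) : feasible s X -> iapd_step A s eps kappa X Y -> iteration X Y.
Proof.
move=> fX hstep; have [fY _] := step_feasible fX hstep.
move: hstep => [W [hW [f [hf [hcut [hY1 hY2]]]]]].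
have fE := increasing_id hf.
have csE m (M : 'M[R]_(m, t)) : colsub f M = M by apply/matrixP => a b; rewrite mxE fE.
have hk j : kappa <= `|Atau A (mixv s (colfam Y j) (colfam X j))|.
  have -> : X = fun l => colsub f (X l) by apply: functional_extensionality_dep => l; rewrite csE.
  apply: (lamix_cut (i := ls) (W := W)) => //.
  by move=> h; have [/(_ (ex_intro _ j erefl)) + _] := hcut (f j); apply; exists ls.
have WY (i : 'I_k) : (i < s)%N -> W i = Y i by move=> is_; rewrite hY1 // csE.
have oX (i : 'I_k) : ~ (i < s)%N -> oblique (X i) by have [_] := fX i.
have hup : als_update Y X.
  move=> i is_ j /=; have := hY2 i is_ j.
  by have -> : (fun l => colsub f (X l)) = X by apply: functional_extensionality_dep => l; rewrite csE.
have xE (i : 'I_k) j : (i < s)%N -> xmix W X i j = xmix Y X i j.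
  move=> is_; apply: functional_extensionality_dep => l; rewrite /xmix; case: ifP => // li.
  by rewrite WY //; exact: ltn_trans li is_.
have VE (i : 'I_k) : (i < s)%N -> Vmix A W X i *m Lmix A W X i = Vmix A Y X i *m Lmix A Y X i.
  move=> is_; congr (_ *m _).
    by apply/matrixP => a b; rewrite !mxE xE.
  by congr diag_mx; apply/rowP => b; rewrite !mxE xE.
have blk (i : 'I_k) : (i < s)%N ->
  eps / 2 * mip (Y i - X i) (Y i - X i) <= mip (Vmix A Y X i *m Lmix A Y X i) (Y i - X i) /\
  exists P th, [/\ P^T = P, 0 <= th <= eps & Vmix A Y X i *m Lmix A Y X i = Y i *m P + th *: (Y i - X i)].
  move=> is_; have [sX _] := fX i.
  have [Q hQ] := hW i is_; rewrite VE // WY // in hQ.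
  by have [_ h1 h2] := polar_block e0 (sX is_) (ex_intro _ Q hQ).
pose la m j := Atau A (mixv m (colfam Y j) (colfam X j)).
split => //.
- by move=> j; rewrite -(lamixk Y X); apply: (lamix_bound k0 sk oX hup hk).
- have E : fobj A Y - fobj A X = \sum_(i < k) \sum_j (la i.+1 j ^+ 2 - la i j ^+ 2).
    rewrite exchange_big -sumrB; apply: eq_bigr => j _ /=.
    rewrite -(big_mkord xpredT (fun i => la i.+1 j ^+ 2 - la i j ^+ 2)) telescope_sumr //.
    by rewrite /la lamix0 lamixk.
  rewrite E mulr_sumr; apply: ler_sum => i _.
  case: (boolP (i < s)%N) => is_.
    have [h1 _] := blk i is_.
    (* By convexity of the square, the gain of [la ^+ 2] is at least [2 * la] times the gain of
       [la]; these products sum to the inner product bounded in [blk]. *)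
    apply: (@le_trans _ _ (2 * mip (Vmix A Y X i *m Lmix A Y X i) (Y i - X i))).
      apply: le_trans (_ : eps * mip (Y i - X i) (Y i - X i) <= _); last by lra.
      by apply: ler_wpM2r; [exact: mip_ge0|rewrite ge_min lexx].
    rewrite mip_col mulr_sumr; apply: ler_sum => j _.
    rewrite col_VLmix ipZl linearB /= ipDr ipNr -lamix_new -lamix_old -/(la _ _) -/(la _ _).
    have := sqr_ge0 (la i.+1 j - la i j); nra.
  apply: (@le_trans _ _ (kappa ^+ 2 / 2 * mip (Y i - X i) (Y i - X i))).
    by apply: ler_wpM2r; [exact: mip_ge0|rewrite ge_min lexx orbT].
  rewrite mip_col mulr_sumr; apply: ler_sum => j _.
  rewrite linearB /=; by have [_ + _] := als_facts k0 sk oX hup hk j (negP is_).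
have /choice[PT hPT] (i : 'I_k) : exists PT : 'M[R]_t * R,
   [/\ ((i < s)%N -> (PT.1)^T = PT.1) /\ (~ (i < s)%N -> exists p, PT.1 = diag_mx p), 0 <= PT.2 <= eps &
     Vmix A Y X i *m Lmix A Y X i = Y i *m PT.1 + PT.2 *: (Y i - X i)].
  case: (boolP (i < s)%N) => is_.
    by have [_ [P [th [h1 h2 h3]]]] := blk i is_; exists (P, th); split => //; split => // /(_ is_).
  exists (diag_mx (\row_j (`|la i j| * vnorm (Atau_i A (xmix Y X i j) i))), 0); split.
  - by split => // _; eexists; reflexivity.
  - by rewrite lexx ltW.
  rewrite scale0r addr0; apply/matrixP => a j.
  have [_ _ h] := als_facts k0 sk oX hup hk j (negP is_).
  transitivity (col j (Vmix A Y X i *m Lmix A Y X i) a ord0); first by rewrite [RHS]mxE.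
  by rewrite col_VLmix h mul_mx_diag !mxE mulrC.
exists (fun i => (PT i).1), (fun i => (PT i).2); split.
- by move=> i; have [] := hPT i.
- by move=> i; have [] := hPT i.
- by move=> i; have [] := hPT i.
Qed.

End Step.

(** * Limit points and error bounds *)

Section LimitPoint.
Variables (R : realType) (k : nat) (n : 'I_k -> nat) (A : tensor R n) (s : nat) (t : nat).
Variables (tends : (nat -> R) -> R -> Prop).
Hypothesis hT : generalized_limit tends.

Definition tends_mats (X : nat -> mats R n t) (U : mats R n t) := forall i, tendsm tends (fun p => X p i) (U i).

Lemma tendsv_col X U j : tends_mats X U -> tendsv tends (fun p => colfam (X p) j) (colfam U j).
Proof. by move=> h l a; apply: tends_ext (h l a j) => [p|]; rewrite mxE. Qed.

Lemma tends_fobj X U : tends_mats X U -> tends (fun p => fobj A (X p)) (fobj A U).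
Proof.
move=> h; apply: (tends_sum hT) => j _; apply: (tendsM hT); apply: (tends_Atau hT); exact: tendsv_col.
Qed.

Lemma tends_sqn X U : tends_mats X U -> tends (fun p => sqn (X p)) (sqn U).
Proof.
move=> h; apply: (tends_sum hT) => i _; apply: (tends_sum hT) => j _.
by apply: (tendsm_mul hT); [apply: tendsm_tr; exact: h|exact: h].
Qed.

Lemma tendsv_xmix X Y U i j : tends_mats X U -> tends_mats Y U ->
  tendsv tends (fun p => xmix (Y p) (X p) i j) (colfam U j).
Proof. by move=> hX hY; apply: (@tendsv_mix _ _ _ tends i); exact: tendsv_col. Qed.

Lemma tends_VLmix X Y U i : tends_mats X U -> tends_mats Y U ->
  tendsm tends (fun p => Vmix A (Y p) (X p) i *m Lmix A (Y p) (X p) i) (Vmat A U i *m Lam A U).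
Proof.
move=> hX hY a j; have hv := tendsv_xmix i j hX hY.
have h := tendsM hT (tends_Atau_i hT A a hv) (tends_Atau hT A hv).
apply: tends_ext h => [p|].
  by rewrite /Lmix mul_mx_diag !mxE.
by rewrite /Lam mul_mx_diag !mxE.
Qed.

Lemma feasible_limit Y U : tends_mats Y U -> (forall p, feasible s (Y p)) -> feasible s U.
Proof.
move=> hY fY i; split=> is_.
  apply: (tendsm_uniq hT (tendsm_mul hT (tendsm_tr (hY i)) (hY i))).
  move=> a b; apply: tends_ext (tends_cst hT ((1%:M : 'M[R]_t) a b)) => // p.
  by have [/(_ is_) <- _] := fY p i.
move=> j; apply/vnorm1; have hv := tendsv_col j hY.
have h1 : tends (fun p => ip (colfam (Y p) j i) (colfam (Y p) j i)) (ip (col j (U i)) (col j (U i))).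
  by apply: (tends_sum hT) => a _; apply: (tendsM hT); exact: hv.
apply: (tends_uniq hT h1); apply: tends_ext (tends_cst hT 1) => // p.
by have [_ /(_ is_ j)/vnorm1 ->] := fY p i.
Qed.

Lemma lam_limit Y U j kappa : 0 < kappa -> tends_mats Y U -> (forall p, kappa <= `|lam A (Y p) j|) ->
  kappa <= `|lam A U j|.
Proof.
have sq (x : R) : 0 < kappa -> (kappa <= `|x|) = (kappa * kappa <= x * x).
  move=> k0; have x0 := normr_ge0 x; apply/idP/idP => h.
    by have := ler_pM (ltW k0) (ltW k0) h h; rewrite -[`|x| * _]expr2 real_normK ?num_real.
  rewrite leNgt; apply/negP => xk; have := ltr_pM x0 x0 xk xk.
  by rewrite -[`|x| * _]expr2 real_normK ?num_real // expr2; lra.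
move=> k0 hY hk; rewrite sq //.
have h1 := tends_Atau hT A (tendsv_col j hY).
by apply: (tends_le hT (m := 0) _ (tendsM hT h1 h1)) => p _; rewrite -sq //; exact: hk.
Qed.

(** The multipliers converge because the iterates determine them: [P] is [Y^T] times the left-hand
    side minus the error term, or the diagonal of this product in an oblique mode. *)
Lemma critical_limit eps X Y U P th : tends_mats X U -> tends_mats Y U ->
  (forall p, feasible s (Y p)) ->
  (forall p, [/\ multiplier s (P p), forall i, 0 <= th p i <= eps &
    forall i, Vmix A (Y p) (X p) i *m Lmix A (Y p) (X p) i = Y p i *m P p i + th p i *: (Y p i - X p i)]) ->
  exists Ps, [/\ multiplier s Ps, forall i, tendsm tends (fun p => P p i) (Ps i) &
    forall i, Vmat A U i *m Lam A U = U i *m Ps i].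
Proof.
move=> hX hY fY hP.
have h0 i : tendsm tends (fun p => th p i *: (Y p i - X p i)) 0.
  have [th0 hth] : exists a, tends (fun p => th p i) a.
    apply: (tends_bdd hT); exists eps => p; have [_ /(_ i)/andP[a b] _] := hP p; by rewrite ger0_norm.
  move=> a b; have h := tendsM hT hth (tendsB hT (hY i a b) (hX i a b)); apply: tends_ext h => [p|]; rewrite !mxE //.
  by rewrite subrr mulr0.
pose D p i := Vmix A (Y p) (X p) i *m Lmix A (Y p) (X p) i - th p i *: (Y p i - X p i).
have DE p i : D p i = Y p i *m P p i by have [_ _ /(_ i) e] := hP p; rewrite /D e addrK.
have hD i : tendsm tends (fun p => D p i) (Vmat A U i *m Lam A U).
  move=> a b; have h := tendsB hT (tends_VLmix hX hY a b) (h0 i a b); apply: tends_ext h => [p|]; last by rewrite [X in _ - X]mxE subr0.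
  by rewrite [RHS]mxE [X in _ = _ + X]mxE.
pose Q i := (U i)^T *m (Vmat A U i *m Lam A U).
have hQ i : tendsm tends (fun p => (Y p i)^T *m D p i) (Q i).
  by apply: (tendsm_mul hT) => //; exact: tendsm_tr.
pose Ps (i : 'I_k) : 'M[R]_t := if (i < s)%N then Q i else diag_mx (\row_j Q i j j).
have hPs i : tendsm tends (fun p => P p i) (Ps i).
  rewrite /Ps; case: ifPn => is_ a b.
    apply: tends_ext (hQ i a b) => // p.
    by have [/(_ is_) st _] := fY p i; rewrite DE mulmxA st mul1mx.
  have hd p : P p i a b = (a == b)%:R * ((Y p i)^T *m D p i) a a.
    have [/(_ i)[_ /(_ (negP is_))[q qE]] _ _] := hP p.
    have [_ /(_ (negP is_) a)/vnorm1 ob] := fY p i.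
    rewrite DE mulmxA qE mul_mx_diag !mxE.
    rewrite (_ : \sum_j _ = 1) ?mul1r; last by rewrite -[RHS]ob; apply: eq_bigr => c _; rewrite !mxE.
    by case: eqP => [->|_]; rewrite ?mul1r ?mul0r.
  have h := tendsZ hT (a == b)%:R (hQ i a a); apply: tends_ext h => [p|]; first by rewrite hd.
  by rewrite !mxE; case: eqP => [->|_]; rewrite ?mul1r ?mul0r.
exists Ps; split => //.
  move=> i; split=> is_.
    apply: (tendsm_uniq hT (tendsm_tr (hPs i))) => a b; apply: tends_ext (hPs i a b) => // p.
    by have [/(_ i)[/(_ is_) e _] _ _] := hP p; rewrite -[in LHS]e.
  by rewrite /Ps; case: ifP => // _; eexists; reflexivity.
move=> i; apply: (tendsm_uniq hT (hD i)) => a b.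
by apply: tends_ext (tendsm_mul hT (hY i) (hPs i) a b) => // p; rewrite DE.
Qed.

End LimitPoint.

Section ErrorBound.
Variables (R : realType) (k : nat) (n : 'I_k -> nat) (A : tensor R n) (s : nat) (t : nat).

Lemma entry_sqn (D : mats R n t) i a j : D i a j ^+ 2 <= sqn D.
Proof.
rewrite /sqn (bigD1 i) //= mip_rows (bigD1 a) //= (bigD1 j) //= -expr2 -!addrA lerDl.
apply: addr_ge0; first by apply: sumr_ge0 => l _; rewrite -expr2 sqr_ge0.
apply: addr_ge0; last by apply: sumr_ge0 => l _; exact: mip_ge0.
by apply: sumr_ge0 => l _; apply: sumr_ge0 => b _; rewrite -expr2 sqr_ge0.
Qed.

Lemma sqnZ c (D : mats R n t) : sqn (fun i => c *: D i) = c ^+ 2 * sqn D.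
Proof. by rewrite /sqn mulr_sumr; apply: eq_bigr => i _; rewrite mipZl mipZr; ring. Qed.

Lemma multiplierB (P Q : 'I_k -> 'M[R]_t) : multiplier s P -> multiplier s Q -> multiplier s (fun i => P i - Q i).
Proof.
move=> hP hQ i; have [p1 p2] := hP i; have [q1 q2] := hQ i; split=> [is_|is_].
  by rewrite linearB /= p1 // q1.
have [p ->] := p2 is_; have [q ->] := q2 is_; exists (p - q); by rewrite linearB.
Qed.

Variables (tends : (nat -> R) -> R -> Prop).
Hypothesis hT : generalized_limit tends.

Lemma tends_sqr_bound (u : nat -> R) : (forall p, u p ^+ 2 <= 1 / p.+1%:R) -> tends u 0.
Proof.
move=> h.
have p1 p : 1 / p.+1%:R <= 1 :> R by rewrite ler_pdivrMr ?ltr0Sn // mul1r ler1n.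
apply: (tends_null_sqr hT).
  by apply: (tends_inv_bound hT (c := 1)) => // p; rewrite ger0_norm ?sqr_ge0 // h.
exists 1 => p; rewrite -(@expr_le1 _ 2) // real_normK ?num_real //; exact: le_trans (h p) (p1 p).
Qed.

Lemma tends_mip m (M : nat -> 'M[R]_(m, t)) L H : tendsm tends M L -> tends (fun p => mip (M p) H) (mip L H).
Proof.
move=> h; apply: (tends_sum hT) => j _; apply: (tendsm_mul hT); first exact: tendsm_tr.
exact: tendsm_cst.
Qed.

Section BlowUp.
Variables (X Y : nat -> mats R n t) (U : mats R n t) (r : nat -> R) (Z : mats R n t).
Hypothesis r0 : forall p, r p != 0.
Hypothesis hr : tends r 0.
Let D p : mats R n t := fun i => (r p)^-1 *: (Y p i - U i).
Let E p : mats R n t := fun i => (r p)^-1 *: (X p i - U i).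
Hypotheses (hX : tends_mats tends X U) (hY : tends_mats tends Y U).
Hypotheses (hD : tends_mats tends D Z) (hE : tends_mats tends E Z).

Let YE p i : Y p i = U i + r p *: D p i.
Proof. by rewrite /D scalerA divff // scale1r addrC subrK. Qed.

(** The constraints are quadratic; after division by [r] their second-order part still carries a
    factor [r]. *)
Lemma tangent_limit : feasible s U -> (forall p, feasible s (Y p)) -> tangent s U Z.
Proof.
move=> fU fY i; split=> is_.
  have h1 := tendsmD hT (tendsm_mul hT (tendsm_cst hT (U i)^T) (@hD i))
     (tendsm_mul hT (tendsm_tr (@hD i)) (tendsm_cst hT (U i))).
  have h2 : tendsm tends (fun p => (- r p) *: ((D p i)^T *m D p i)) 0.
    have h := tendsmZ hT (tendsN hT hr) (tendsm_mul hT (tendsm_tr (@hD i)) (@hD i)).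
    by move: h; rewrite oppr0 scale0r.
  apply: (tendsm_uniq hT h1) => a b; apply: tends_ext (h2 a b) => // p; congr (fun_of_matrix _ a b).
  have [/(_ is_) sU _] := fU i; have [/(_ is_) sY _] := fY p i.
  move: sY; rewrite /stiefel YE [(U i + _)^T]linearD /= [(r p *: _)^T]linearZ /= mulmxDl !mulmxDr sU.
  rewrite -!scalemxAl -!scalemxAr => sY.
  apply/esym/(scalerI (r0 p)); rewrite scaleNr scalerN scalerDr; apply/eqP; rewrite -addr_eq0; apply/eqP.
  by apply: (addrI 1%:M); rewrite addr0 -[RHS]sY !addrA.
move=> j; have hv := tendsv_col j hD.
have h1 : tends (fun p => ip (colfam U j i) (colfam (D p) j i)) (ip (col j (U i)) (col j (Z i))).
  by apply: (tends_sum hT) => a _; apply: (tendsZ hT); exact: hv.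
have h2 : tends (fun p => (- r p / 2) * ip (colfam (D p) j i) (colfam (D p) j i)) 0.
  have h : tends (fun p => ip (colfam (D p) j i) (colfam (D p) j i)) (ip (col j (Z i)) (col j (Z i))).
    by apply: (tends_sum hT) => a _; apply: (tendsM hT); exact: hv.
  have h' := tendsM hT (tendsZ hT (-1 / 2) hr) h; apply: tends_ext h' => [p|]; last by rewrite mulr0 mul0r.
  by congr (_ * _); lra.
apply: (tends_uniq hT h1); apply: tends_ext h2 => // p.
have [_ /(_ is_ j)/vnorm1 sU] := fU i; have [_ /(_ is_ j)/vnorm1] := fY p i.
rewrite YE linearD linearZ /= !(ipDl, ipDr, ipZl, ipZr) sU (ipC (col j (D p i))) => e.
apply: (mulfI (r0 p)); rewrite /colfam; lra.
Qed.

Lemma VLmix_quotient H : tends (fun p => \sum_i (mip (Vmix A (Y p) (X p) i *m Lmix A (Y p) (X p) i) (H i)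
     - mip (Vmat A U i *m Lam A U) (H i)) / r p)
   (\sum_j (Dtau A (colfam U j) (colfam Z j) * Dtau A (colfam U j) (colfam H j) +
    lam A U j * \sum_i \sum_(l | l != i)
      Atau A (rep (rep (colfam U j) (colfam Z j) l) (colfam H j) i))).
Proof.
pose a p i j := Atau A (xmix (Y p) (X p) i j).
pose b p i j := Atau A (rep (xmix (Y p) (X p) i j) (colfam H j) i).
pose b0 i j := Atau A (rep (colfam U j) (colfam H j) i).
pose q i j := Dtau A (colfam U j) (colfam Z j) * b0 i j + lam A U j *
  \sum_(l | l != i) Atau A (rep (rep (colfam U j) (colfam Z j) l) (colfam H j) i).
have hq i j : tends (fun p => (a p i j * b p i j - lam A U j * b0 i j) / r p) (q i j).
  pose d p := mixv i (colfam (D p) j) (colfam (E p) j).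
  have td : tendsv tends d (colfam Z j) by apply: tendsv_mix; exact: tendsv_col.
  have tx := tendsv_xmix i j hX hY.
  have hx p l : xmix (Y p) (X p) i j l - colfam U j l = r p *: d p l.
    rewrite /d /xmix /mixv /colfam; case: ifP => _; rewrite /D /E linearZ /= linearB /=;
      by rewrite scalerA divff // scale1r.
  have h1 := Atau_quotient hT A r0 hx tx td.
  have tH := tendsv_cst hT (colfam H j).
  have h2 := tends_Atau hT A (tendsv_rep i tx tH).
  have td0 := tendsv_rep i td (tendsv_cst hT (fun l => 0)).
  have hx' p l : rep (xmix (Y p) (X p) i j) (colfam H j) i l - rep (colfam U j) (colfam H j) i l =
      r p *: rep (d p) (fun=> 0) i l.
    by rewrite /rep; case: eqP => // _; rewrite subrr scaler0.
  have h3 := Atau_quotient hT A r0 hx' (tendsv_rep i tx tH) td0.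
  have h := tendsD hT (tendsM hT h1 h2) (tendsZ hT (lam A U j) h3).
  apply: tends_ext h => [p|]; first by rewrite /a /b /b0 /lam; field; exact: r0.
  rewrite /q; congr (_ + _ * _); rewrite /Dtau (bigD1 i) //= (@Atau_slot0 _ _ _ _ _ i); last first.
    by rewrite !rep_same.
  rewrite add0r; apply: eq_bigr => l li; apply: Atau_ext => m; rewrite [RHS]rep_rep_comm //.
  by rewrite /rep; case: (eqVneq m l) => // ->; rewrite (negPf li).
have h : tends (fun p => \sum_i \sum_j (a p i j * b p i j - lam A U j * b0 i j) / r p) (\sum_i \sum_j q i j).
  by apply: (tends_sum hT) => i _; apply: (tends_sum hT) => j _.
apply: tends_ext h => [p|].
  apply: eq_bigr => i _; rewrite !mip_col -sumrB mulr_suml; apply: eq_bigr => j _.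
  by rewrite col_VLmix col_VLam !ipZl -/(colfam H j i) -!Atau_rep.
rewrite exchange_big; apply: eq_bigr => j _ /=; rewrite big_split /= -!mulr_sumr //.
Qed.

(** Divided by [r], the difference of the multipliers could blow up, but [U (P - Ps)] is normal and
    pairs to zero with [H]. So no rate of convergence of the multipliers is required. *)
Lemma Hess_limit P th Ps eps H :
  (forall p, [/\ multiplier s (P p), forall i, 0 <= th p i <= eps &
    forall i, Vmix A (Y p) (X p) i *m Lmix A (Y p) (X p) i = Y p i *m P p i + th p i *: (Y p i - X p i)]) ->
  multiplier s Ps -> (forall i, tendsm tends (fun p => P p i) (Ps i)) ->
  (forall i, Vmat A U i *m Lam A U = U i *m Ps i) -> tangent s U H -> Hess A U Ps Z H = 0.
Proof.
move=> hP hPs tP KU tH; apply/eqP; rewrite subr_eq0; apply/eqP.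
apply: (tends_uniq hT (VLmix_quotient H)).
have h i : tends (fun p => mip (D p i *m P p i) (H i) + th p i * mip (D p i - E p i) (H i)) (mip (Z i *m Ps i) (H i)).
  have [th0 hth] : exists a, tends (fun p => th p i) a.
    apply: (tends_bdd hT); exists eps => p; have [_ /(_ i)/andP[a b] _] := hP p; by rewrite ger0_norm.
  have h0 : tendsm tends (fun p => D p i - E p i) (Z i - Z i).
    by move=> a b; have h := tendsB hT (@hD i a b) (@hE i a b); apply: tends_ext h => [p|]; rewrite !mxE.
  have h := tendsD hT (tends_mip (H i) (tendsm_mul hT (@hD i) (tP i))) (tendsM hT hth (tends_mip (H i) h0)).
  by apply: tends_ext h => //; rewrite subrr /mip trmx0 mul0mx mxtrace0 mulr0 addr0.
have hs := tends_sum hT (index_enum _) (P := xpredT) (fun i _ => h i).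
apply: tends_ext hs => // p; apply: eq_bigr => i _.
have [mP _ ->] := hP p; rewrite KU.
have e0 : mip (U i *m P p i) (H i) = mip (U i *m Ps i) (H i).
  apply/eqP; rewrite -subr_eq0 -mipNl -mipDl -mulmxBr; apply/eqP.
  exact: (mip_multiplier i tH (multiplierB mP hPs)).
have -> : D p i - E p i = (r p)^-1 *: (Y p i - X p i).
  by rewrite /D /E -scalerBr opprB addrA subrK.
have -> : Y p i *m P p i = U i *m P p i + r p *: (D p i *m P p i) by rewrite {1}YE mulmxDl -scalemxAl.
rewrite !mipDl !mipZl e0; field; exact: r0.
Qed.

End BlowUp.
End ErrorBound.

Section Bounds.
Variables (R : realType) (k : nat) (n : 'I_k -> nat) (A : tensor R n) (s : nat) (t : nat).

(* Otherwise the normalized differences [(Y - U) / |Y - U|] cluster at a unit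
   tangent vector, and dividing the critical equations by [|Y - U|] puts it in the
   kernel of the Hessian. *)
Lemma error_bound eps kappa (U : mats R n t) :
  (3 <= k)%N -> (1 <= s <= k)%N -> (forall i, 0 < n i)%N -> (forall i, t <= n i)%N ->
  (s = 1%N -> size_condition n) -> ~ special A -> 0 < kappa ->
  feasible s U -> (forall j, kappa <= `|lam A U j|) ->
  exists2 C, 0 < C & exists2 rad, 0 < rad & forall X Y : mats R n t, iteration A s eps kappa X Y ->
    sqn (fun i => Y i - U i) <= rad -> sqn (fun i => Y i - U i) <= C * sqn (fun i => Y i - X i).
Proof.
move=> k3 hs n0 tn hsz hA k0 fU hk; apply: contrapT => hn.
have [tends hT] := generalized_limit_exists R.
(* Failure of the claim for [C = p + 1] and radius [1 / (p + 1)]. *)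
have /choice[XY hXY] (p : nat) : exists XY : mats R n t * mats R n t,
   [/\ iteration A s eps kappa XY.1 XY.2, sqn (fun i => XY.2 i - U i) <= 1 / p.+1%:R &
       p.+1%:R * sqn (fun i => XY.2 i - XY.1 i) < sqn (fun i => XY.2 i - U i)].
  apply: contrapT => hp; apply: hn; exists p.+1%:R; rewrite ?ltr0Sn //.
  exists (1 / p.+1%:R); first by rewrite divr_gt0 ?ltr0Sn.
  move=> X Y it le1; rewrite leNgt; apply/negP => lt1; by apply: hp; exists (X, Y).
pose X p := (XY p).1; pose Y p := (XY p).2.
have it p : iteration A s eps kappa (X p) (Y p) by case: (hXY p).
pose q p := sqn (fun i => Y p i - U i).
have q1 p : q p <= 1 / p.+1%:R by case: (hXY p).
have qYX p : p.+1%:R * sqn (fun i => Y p i - X p i) < q p by case: (hXY p).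
have q0 p : 0 < q p by apply: le_lt_trans (qYX p); apply: mulr_ge0; [exact: ler0n|exact: sqn_ge0].
have qYX' p : sqn (fun i => Y p i - X p i) <= 1 / p.+1%:R * q p.
  by rewrite mulrAC ler_pdivlMr ?ltr0Sn // mul1r mulrC ltW.
have qle1 p : q p <= 1.
  by apply: le_trans (q1 p) _; rewrite ler_pdivrMr ?ltr0Sn // mul1r ler1n.
have qYX1 p : sqn (fun i => Y p i - X p i) <= 1 / p.+1%:R.
  by apply: le_trans (qYX' p) _; apply: ler_piMr => //; rewrite divr_ge0 ?ler0n.
pose r p := Num.sqrt (q p).
have r2 p : r p ^+ 2 = q p by rewrite sqr_sqrtr // ltW.
have r0 p : r p != 0 by rewrite gt_eqF // sqrtr_gt0.
have hr : tends r 0 by apply: (tends_sqr_bound hT) => p; rewrite r2.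
pose D p : mats R n t := fun i => (r p)^-1 *: (Y p i - U i).
pose E p : mats R n t := fun i => (r p)^-1 *: (X p i - U i).
have D1 p : sqn (D p) = 1 by rewrite /D sqnZ exprVn r2 mulVf // gt_eqF.
have exZ i : exists L : 'M[R]_(n i, t), tendsm tends (fun p => D p i) L.
  apply: (tendsm_bdd hT (c := 1)) => p a j.
  rewrite -(@expr_le1 _ 2) // real_normK ?num_real // -(D1 p); exact: entry_sqn.
pose Z i := projT1 (cid (exZ i)).
have hD : tends_mats tends D Z by move=> i; exact: (projT2 (cid (exZ i))).
have hYX : tends_mats tends (fun p i => Y p i - X p i) (fun i => 0).
  move=> i a j; rewrite mxE; apply: (tends_sqr_bound hT) => p.
  by apply: le_trans (qYX1 p); exact: (entry_sqn (fun i => Y p i - X p i)).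
have hYU : tends_mats tends (fun p i => Y p i - U i) (fun i => 0).
  move=> i a j; rewrite mxE; apply: (tends_sqr_bound hT) => p.
  by apply: le_trans (q1 p); exact: (entry_sqn (fun i => Y p i - U i)).
have hDE : tends_mats tends (fun p i => (r p)^-1 *: (Y p i - X p i)) (fun i => 0).
  move=> i a j; rewrite mxE; apply: (tends_sqr_bound hT) => p.
  apply: le_trans (_ : sqn (fun i => (r p)^-1 *: (Y p i - X p i)) <= _).
    exact: (entry_sqn (fun i => (r p)^-1 *: (Y p i - X p i))).
  by rewrite sqnZ exprVn r2 mulrC ler_pdivrMr.
have hY : tends_mats tends Y U.
  move=> i a j; have h := tendsD hT (hYU i a j) (tends_cst hT (U i a j)).
  by apply: tends_ext h => [p|]; rewrite !mxE ?add0r ?subrK.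
have hX : tends_mats tends X U.
  move=> i a j; have h := tendsB hT (hY i a j) (hYX i a j).
  by apply: tends_ext h => [p|]; rewrite !mxE ?subr0 // subKr.
(* [E] has the same limit as [D], since [Y - X] is negligible against [Y - U]. *)
have hE : tends_mats tends E Z.
  move=> i a j; have h := tendsB hT (hD i a j) (hDE i a j).
  apply: tends_ext h => [p|]; rewrite !mxE ?subr0 //; ring.
have /choice[P /choice[th hP]] (p : nat) : exists P th, [/\ multiplier s P, forall i, 0 <= th i <= eps &
    forall i, Vmix A (Y p) (X p) i *m Lmix A (Y p) (X p) i = Y p i *m P i + th i *: (Y p i - X p i)].
  exact: iter_critical (it p).
have fY p := iter_new (it p).
have [Ps [mP tP KU]] := critical_limit hT hX hY fY hP.
have tZ : tangent s U Z by apply: (tangent_limit hT r0 hr hD fU fY).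
have hH H : tangent s U H -> Hess A U Ps Z H = 0 by apply: (Hess_limit hT r0 hX hY hD hE hP mP tP KU).
have lm0 j : lam A U j != 0 by rewrite -normr_gt0; apply: lt_le_trans k0 (hk j).
have Z0 := Hess_nondegenerate k3 hs n0 tn hsz hA fU mP KU lm0 tZ hH.
have := tends_sqn hT hD; rewrite [sqn Z]big1; last by move=> i _; rewrite Z0 /mip trmx0 mul0mx mxtrace0.
have h1 : tends (fun p => sqn (D p)) 1 by apply: tends_ext (tends_cst hT 1) => // p.
by move=> /(tends_uniq hT h1) /eqP; rewrite oner_eq0.
Qed.

Lemma feasible_entry (U : mats R n t) i a j : feasible s U -> `|U i a j| <= 1.
Proof.
move=> fU; have u1 : ip (col j (U i)) (col j (U i)) = 1.
  have [h1 h2] := fU i; case: (boolP (i < s)%N) => [/h1|/negP/h2 hh]; last exact/vnorm1/hh.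
  by move=> /matrixP/(_ j j); rewrite mulmx_diag_entry mxE eqxx.
rewrite -(@expr_le1 _ 2) // real_normK ?num_real // -u1 /ip (bigD1 a) //= !mxE -expr2 lerDl.
by apply: sumr_ge0 => b _; rewrite -expr2 sqr_ge0.
Qed.

(* On the feasible set the first-order term of [f] at a critical point is
   quadratic, because [<U P, D>] only sees the symmetric part of [U^T D]. *)
Lemma quadratic_bound (U : mats R n t) P : feasible s U -> multiplier s P ->
  (forall i, Vmat A U i *m Lam A U = U i *m P i) ->
  exists2 C, 0 < C & forall Y : mats R n t, feasible s Y ->
    fobj A U - fobj A Y <= C * sqn (fun i => Y i - U i).
Proof.
move=> fU mP KU.
pose K := \sum_z `|A z|.
have K0 : 0 <= K by apply: sumr_ge0 => z _; exact: normr_ge0.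
pose Pm := \sum_i \sum_a \sum_b `|P i a b|.
exists (1 + Pm + \sum_(j < t) (2 * `|lam A U j| * (K * (k * k)%:R))).
  apply: ltr_pwDl; last by apply: sumr_ge0 => j _; rewrite !mulr_ge0 ?normr_ge0 ?ler0n.
  by apply: ltr_pwDl => //; do 3!apply: sumr_ge0 => ? _; exact: normr_ge0.
move=> Y fY; set S := sqn _.
have S0 : 0 <= S by exact: sqn_ge0.
pose d j : vfam R n := fun l => colfam Y j l - colfam U j l.
have de j l a : `|d j l a ord0| <= Num.sqrt S.
  rewrite -[leLHS]ger0_norm // -sqrtr_sqr ler_wsqrtr // real_normK ?num_real //.
  have -> : d j l a ord0 = Y l a j - U l a j by rewrite !mxE.
  have := @entry_sqn R k n t (fun i => Y i - U i) l a j; by rewrite !mxE.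
have SS : Num.sqrt S * Num.sqrt S = S by rewrite -expr2 sqr_sqrtr.
have ent (V : mats R n t) (fV : feasible s V) j l a : `|colfam V j l a ord0| <= 1.
  by rewrite mxE; exact: feasible_entry.
(* The remainder telescopes twice: each term contains two differences, in distinct modes. *)
have rem j : `|lam A Y j - lam A U j - Dtau A (colfam U j) (d j)| <= K * (k * k)%:R * S.
  rewrite /lam Atau_telescope -sumrB; apply: le_trans (ler_norm_sum _ _ _) _.
  have -> : K * (k * k)%:R * S = \sum_(i < k) (K * k%:R * S).
    by rewrite sumr_const card_ord -[RHS]mulr_natl natrM; ring.
  apply: ler_sum => i _; rewrite !Atau_rep -(ipC (d j i)) -(ipC (d j i)).
  rewrite !(ipC (d j i)) -!Atau_rep.
  have -> : Atau A (rep (mixv i (colfam Y j) (colfam U j)) (fun l => colfam Y j l - colfam U j l) i)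
      - Atau A (rep (colfam U j) (d j) i) =
     \sum_(l < k) (if (l < i)%N then Atau A (rep (rep (mixv l (mixv i (colfam Y j) (colfam U j)) (colfam U j)) (d j) l) (d j) i) else 0).
    rewrite Atau_telescope; apply: eq_bigr => l _.
    case: ifP => li; last first.
      apply: (@Atau_slot0 _ _ _ _ _ l); rewrite rep_same /rep /mixv; case: eqP => [->|_]; last by rewrite li subrr.
      by rewrite subrr.
    have il : l != i by apply: contraTneq li => ->; rewrite ltnn.
    apply: Atau_ext => m; rewrite rep_rep_comm // /rep; have [->|ml] := eqVneq m l.
      by rewrite (negPf il) /mixv li.
    rewrite /mixv; have [->|mi] := eqVneq m i; last by [].
    by case: ifP.
  apply: le_trans (ler_norm_sum _ _ _) _.
  have -> : K * k%:R * S = \sum_(l < k) (K * S) by rewrite sumr_const card_ord -[RHS]mulr_natl; ring.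
  apply: ler_sum => l _; case: ifP => li; last by rewrite normr0 mulr_ge0.
  have il : l != i by apply: contraTneq li => ->; rewrite ltnn.
  rewrite -[in leRHS]SS; apply: Atau_bound_rep2 => // m a.
  by rewrite /mixv; case: ifP => _; [case: ifP => _|]; exact: ent.
have E1 : fobj A U - fobj A Y <= - (2 * \sum_j lam A U j * (lam A Y j - lam A U j)).
  rewrite /fobj mulr_sumr -sumrB -sumrN; apply: ler_sum => j _; have := sqr_ge0 (lam A Y j - lam A U j); nra.
have E2 : \sum_j lam A U j * Dtau A (colfam U j) (d j) = \sum_i mip (U i *m P i) (Y i - U i).
  under [RHS]eq_bigr => i _ do rewrite -KU.
  rewrite (mip_VLam A U (fun i => Y i - U i)); apply: eq_bigr => j _; congr (_ * _).
  apply: eq_bigr => i _; apply: Atau_ext => l; rewrite /rep; case: eqP => // _.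
  by apply/matrixP => a b; rewrite !mxE.
have PT i : (P i)^T = P i.
  have [p1 p2] := mP i; case: (boolP (i < s)%N) => [/p1 //|/negP /p2[p ->]]; exact: tr_diag_mx.
have unitP (V : mats R n t) i : feasible s V -> mip (V i *m P i) (V i) = \sum_j P i j j.
  move=> fV; rewrite mip_mulr PT; have [p1 p2] := fV i; have [_ q2] := mP i.
  case: (boolP (i < s)%N) => [/p1 ->|/negP is_]; first by rewrite mulmx1.
  have [p ->] := q2 is_; rewrite tr_diag_mul; apply: eq_bigr => j _.
  by rewrite mulmx_diag_entry (proj1 (vnorm1 _) (p2 is_ j)) mulr1 mxE eqxx mulr1n.
(* [<V P, V>] equals the trace of [P] for every feasible [V], which converts the linear term into a
   quadratic one. *)
have E3 i : - (2 * mip (U i *m P i) (Y i - U i)) = mip ((Y i - U i) *m P i) (Y i - U i).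
  have e1 : mip (Y i *m P i) (U i) = mip (U i *m P i) (Y i).
    by rewrite !mip_mulr PT -[LHS]mxtrace_tr !trmx_mul trmxK PT mxtrace_mulC.
  rewrite [(Y i - U i) *m _]mulmxBl !mipDr !mipDl !mipNr !mipNl e1 !unitP //; ring.
have E4 i : mip ((Y i - U i) *m P i) (Y i - U i) <= (\sum_a \sum_b `|P i a b|) * S.
  rewrite mip_mulr PT /mxtrace mulr_suml; apply: ler_sum => a _.
  rewrite mxE mulr_suml; apply: ler_sum => b _; apply: le_trans (ler_norm _) _.
  rewrite normrM; apply: ler_wpM2l => //.
  set Dl := Y i - U i.
  have cS c : ip (col c Dl) (col c Dl) <= S.
    rewrite /S /sqn (bigD1 i) //= mip_col (bigD1 c) //= -addrA lerDl.
    by apply: addr_ge0; apply: sumr_ge0 => l _; [exact: ip_ge0|exact: mip_ge0].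
  have -> : (Dl^T *m Dl) b a = ip (col b Dl) (col a Dl).
    by rewrite mxE; apply: eq_bigr => c _; rewrite !mxE.
  have := cS a; have := cS b.
  have := ip_ge0 (col b Dl - col a Dl); have := ip_ge0 (col b Dl + col a Dl).
  rewrite !(ipDl, ipDr, ipNl, ipNr) (ipC (col a Dl) (col b Dl)) => h1 h2 h3 h4.
  rewrite ler_norml; lra.
apply: le_trans E1 _.
have E5 j : - (2 * (lam A U j * (lam A Y j - lam A U j))) <=
   - (2 * (lam A U j * Dtau A (colfam U j) (d j))) + 2 * `|lam A U j| * (K * (k * k)%:R) * S.
  have h := rem j; set g := lam A Y j - _ - _ in h.
  have -> : lam A Y j - lam A U j = Dtau A (colfam U j) (d j) + g by rewrite /g; ring.
  rewrite mulrDr mulrDr opprD lerD2l.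
  apply: le_trans (ler_norm _) _; rewrite normrN !normrM [`|2|]ger0_norm // -!mulrA.
  by apply: ler_wpM2l => //; apply: ler_wpM2l => //; rewrite mulrA.
rewrite mulr_sumr -sumrN; apply: le_trans (ler_sum _ (fun j _ => E5 j)) _.
rewrite big_split /= sumrN -mulr_sumr E2 mulr_sumr -sumrN (eq_bigr _ (fun i _ => E3 i)).
apply: le_trans (lerD (ler_sum _ (fun i _ => E4 i)) (lexx _)) _.
rewrite -!mulr_suml -mulrDl; apply: ler_wpM2r => //; rewrite lerD2r /Pm; lra.
Qed.

End Bounds.

(** * Convergence *)

Lemma nonincreasing_stationary (T : nat -> nat) : (forall p, (T p.+1 <= T p)%N) ->
  exists p0, forall p, (p0 <= p)%N -> T p = T p0.
Proof.
move=> hT; have mono p q : (p <= q)%N -> (T q <= T p)%N.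
  by elim: q => [|q IH]; [rewrite leqn0 => /eqP ->|rewrite leq_eqVlt => /orP[/eqP ->//|/IH h]; exact: leq_trans (hT q) h].
suff gen m : forall p, (T p <= m)%N -> exists p0, forall p, (p0 <= p)%N -> T p = T p0 by exact: (gen (T 0%N) 0%N).
elim: m => [|m IH] p hp.
  by exists p => q /mono; move: hp; rewrite !leqn0 => /eqP ->; rewrite leqn0 => /eqP.
case: (pselect (forall q, (p <= q)%N -> T q = T p)) => [h|/existsNP[q /not_implyP[pq qp]]]; first by exists p.
by apply: (IH q); have := mono _ _ pq; move: hp qp; lia.
Qed.

Section Convergence.
Variables (R : realType) (k : nat) (n : 'I_k -> nat) (A : tensor R n) (s : nat) (t : nat).

Lemma fobj_bound (U : mats R n t) : feasible s U -> fobj A U <= t%:R * (\sum_z `|A z|) ^+ 2.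
Proof.
move=> fU; rewrite /fobj mulr_natl -[in leRHS](card_ord t) -sumr_const; apply: ler_sum => j _.
rewrite -[lam A U j ^+ 2]real_normK ?num_real //; apply: lerXn2r; rewrite ?nnegrE //.
  by apply: sumr_ge0 => z _; exact: normr_ge0.
have h : `|lam A U j| <= (\sum_z `|A z|) * \prod_(l : 'I_k) 1.
  by apply: (@Atau_bound _ _ _ _ _ (fun=> 1)) => l a; rewrite mxE; exact: (feasible_entry _ _ fU).
have e : \prod_(l : 'I_k) (1 : R) = 1 by apply: big1.
by move: h; rewrite e mulr1.
Qed.

Lemma sqn_triangle (X Y U : mats R n t) :
  sqn (fun i => Y i - U i) <= 2 * sqn (fun i => X i - U i) + 2 * sqn (fun i => Y i - X i).
Proof.
rewrite /sqn !mulr_sumr -big_split; apply: ler_sum => i _ /=.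
have -> : Y i - U i = (Y i - X i) + (X i - U i) by rewrite addrA subrK.
have := mip_ge0 ((Y i - X i) - (X i - U i)).
move: (Y i - X i) (X i - U i) => M N; rewrite !mipDl !mipDr !mipNl !mipNr (mipC N M); lra.
Qed.

Variables (eps kappa : R) (X : nat -> mats R n t).
Hypotheses (k3 : (3 <= k)%N) (hs : (1 <= s <= k)%N) (n0 : forall i, (0 < n i)%N) (tn : forall i, (t <= n i)%N).
Hypotheses (hsz : s = 1%N -> size_condition n) (hA : ~ special A) (e0 : 0 < eps) (k0 : 0 < kappa).
Hypothesis it : forall p, iteration A s eps kappa (X p) (X p.+1).

Let c := Num.min eps (kappa ^+ 2 / 2).
Let c0 : 0 < c. Proof. by rewrite lt_min e0 divr_gt0 // exprn_gt0. Qed.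
Let S p := sqn (fun i => X p.+1 i - X p i).
Let f p := fobj A (X p).

Let S0 p : 0 <= S p. Proof. exact: sqn_ge0. Qed.
Let incr p : c * S p <= f p.+1 - f p. Proof. exact: iter_increase (it p). Qed.

Let f_mono p q : (p <= q)%N -> f p <= f q.
Proof.
elim: q => [|q IH]; first by rewrite leqn0 => /eqP ->.
rewrite leq_eqVlt => /orP[/eqP ->//|/IH h]; apply: le_trans h _; rewrite -subr_ge0.
by apply: le_trans (incr q); apply: mulr_ge0 => //; exact: ltW.
Qed.

(** Monotonicity makes the values converge along the whole sequence, while the iterates are so far
    only known to cluster at [U]. *)
Lemma iteration_limit : exists U P, [/\ feasible s U, forall j, kappa <= `|lam A U j|, multiplier s P &
  forall i, Vmat A U i *m Lam A U = U i *m P i] /\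
  [/\ forall p, f p <= fobj A U,
      forall e, 0 < e -> exists m, forall p, (m <= p)%N -> fobj A U - f p <= e &
      forall e m, 0 < e -> exists2 p, (m <= p)%N & sqn (fun i => X p i - U i) <= e].
Proof.
have [tends hT] := generalized_limit_exists R.
have fX p : feasible s (X p) by exact: iter_old (it p).
have [l hl] : exists l, tends f l.
  apply: (tends_bdd hT); exists (t%:R * (\sum_z `|A z|) ^+ 2) => p; rewrite ger0_norm; first exact: fobj_bound.
  by apply: sumr_ge0 => j _; exact: sqr_ge0.
have fl p : f p <= l by apply: (tends_le hT (m := p) _ hl) => q; exact: f_mono.
have enull e : 0 < e -> exists m, forall p, (m <= p)%N -> l - f p <= e.
  move=> ep; have [m _ hm] := tends_cluster hT 0%N hl ep; exists m => p mp.
  by have := f_mono mp; have := fl m; move: hm; rewrite ler_norml => /andP[]; lra.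
have exU i : exists L : 'M[R]_(n i, t), tendsm tends (fun p => X p i) L.
  by apply: (tendsm_bdd hT (c := 1)) => p a j; exact: (feasible_entry _ _ (fX p)).
pose U i := projT1 (cid (exU i)).
have hX : tends_mats tends X U by move=> i; exact: (projT2 (cid (exU i))).
(* Consecutive iterates share their limit, as a squared step is bounded by the remaining increase of
   [f] divided by [c]. *)
have hY : tends_mats tends (fun p => X p.+1) U.
  move=> i a j.
  have h0 : tends (fun p => X p.+1 i a j - X p i a j) 0.
    apply: (tends_null hT) => e ep.
    have ce : 0 < c * e ^+ 2 by rewrite mulr_gt0 // exprn_gt0.
    have [m hm] := enull _ ce; exists m => p mp.
    have h1 := incr p; have h2 := hm p mp; have h3 := fl p.+1.
    have h4 : S p <= e ^+ 2 by rewrite -(ler_pM2l c0); lra.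
    have := @entry_sqn R k n t (fun i => X p.+1 i - X p i) i a j; rewrite !mxE -/(S p) => h5.
    rewrite -(@ler_pXn2r _ 2) ?nnegrE ?(ltW ep) // real_normK ?num_real //; exact: le_trans h5 h4.
  have h := tendsD hT (hX i a j) h0; apply: tends_ext h => [p|]; rewrite ?addr0 //; ring.
have fY p : feasible s (X p.+1) by exact: fX.
have /choice[P /choice[th hP]] (p : nat) : exists P th, [/\ multiplier s P, forall i, 0 <= th i <= eps &
    forall i, Vmix A (X p.+1) (X p) i *m Lmix A (X p.+1) (X p) i = X p.+1 i *m P i + th i *: (X p.+1 i - X p i)].
  exact: iter_critical (it p).
have [Ps [mP _ KU]] := critical_limit hT hX hY fY hP.
have lE : l = fobj A U by apply: (tends_uniq hT hl); exact: (tends_fobj A hT hX).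
exists U, Ps; split; split => //.
- exact: (feasible_limit hT hX).
- by move=> j; apply: (lam_limit hT k0 hY) => p; exact: (iter_lam (it p) j).
- by rewrite -lE.
- by rewrite -lE.
move=> e m ep.
have hD : tends_mats tends (fun p i => X p i - U i) (fun i => 0).
  move=> i a j; have h := tendsB hT (hX i a j) (tends_cst hT (U i a j)).
  by apply: tends_ext h => [p|]; rewrite !mxE ?subrr.
have := tends_sqn hT hD; rewrite [sqn (fun i => 0)]big1; last by move=> i _; rewrite /mip trmx0 mul0mx mxtrace0.
move=> h; have [p mp hp] := tends_cluster hT m h ep; exists p => //.
by move: hp; rewrite subr0 ger0_norm // sqn_ge0.
Qed.

Lemma iteration_converges : exists U, KKT A s U /\
  exists (C q : R) (p0 : nat), 0 < C /\ 0 < q < 1 /\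
    forall p, (p0 <= p)%N -> frob (fun i => X p i - U i) <= C * q ^+ p.
Proof.
have [U [P [[fU lU mP KU] [fl enull clust]]]] := iteration_limit.
exists U; split.
  (* In an oblique mode the multiplier must be [lam ^+ 2]: pair column [j] of the equation with the
     unit column of [U]. It is thus common to all these modes, as [KKT] demands. *)
  split => //; exists P, (\row_j lam A U j ^+ 2); split=> i is_.
    by split => //; have [h _] := mP i; exact: h.
  have [_ /(_ is_)[p pE]] := mP i; rewrite KU pE; congr (_ *m diag_mx _); apply/rowP => j; rewrite [RHS]mxE.
  have := congr1 (fun M => ip (col j M) (col j (U i))) (KU i); rewrite /= col_VLam ipZl -(Atau_slot A (colfam U j)).
  have [_ /(_ is_ j)/vnorm1 u1] := fU i.
  have -> : col j (U i *m P i) = p ord0 j *: col j (U i).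
    by rewrite pE; apply/matrixP => a b; rewrite mul_mx_diag !mxE mulrC.
  by rewrite ipZl u1 mulr1 => <-; rewrite expr2.
have [C1 C10 [rad rad0 EB]] := error_bound eps k3 hs n0 tn hsz hA k0 fU lU.
have [C2 C20 QB] := quadratic_bound fU mP KU.
pose e p := fobj A U - f p.
have ep0 p : 0 <= e p by rewrite subr_ge0.
have Se p : S p <= (e p - e p.+1) / c by rewrite ler_pdivlMr // mulrC; apply: le_trans (incr p) _; rewrite /e; lra.
(* Twice each of the two quantities is at most half of [rad], which is what [sqn_triangle] needs to
   keep the iterates in the ball. *)
have [m1 hm1] : exists m, forall p, (m <= p)%N -> S p <= rad / 4 /\ C1 * S p <= rad / 4.
  have d0 : 0 < c * (rad / 4) / (1 + C1) by rewrite divr_gt0 ?mulr_gt0 ?divr_gt0 //; lra.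
  have [m hm] := enull _ d0; exists m => p mp.
  have C11 : 0 < 1 + C1 by lra.
  have h : (1 + C1) * S p <= rad / 4.
    rewrite -(ler_pM2l c0) mulrCA -ler_pdivlMl // mulrC; have := incr p; have := hm p mp; have := ep0 p.+1.
    by rewrite /e; lra.
  have h1 : 0 <= C1 * S p by apply: mulr_ge0 => //; exact: ltW.
  by move: h; rewrite mulrDl mul1r; have := S0 p; lra.
(* The start lies beyond [m1], because the error bound at an iterate uses the step from its
   predecessor. *)
have [p2 p12 hp2] := clust rad m1.+1 rad0.
(* Inside the ball the error bound improves the squared distance to [C1 * S], so one further short
   step cannot leave it. *)
have stay p : (p2 <= p)%N -> sqn (fun i => X p i - U i) <= rad.
  elim: p => [|p IH]; first by rewrite leqn0 => /eqP e2; move: hp2; rewrite e2.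
  rewrite leq_eqVlt => /orP[/eqP e2|]; first by move: hp2; rewrite e2.
  rewrite ltnS => p2p; have hp := IH p2p.
  have [q qE] : exists q, p = q.+1 by exists p.-1; rewrite prednK //; lia.
  have [h1 h2] := hm1 q ltac:(lia); have [h3 h4] := hm1 p ltac:(lia).
  rewrite qE in hp; have h5 := EB _ _ (it q) hp; rewrite -/(S q) -qE in h5.
  have := sqn_triangle (X p) (X p.+1) U; rewrite -/(S p); lra.
have near p : (p2 <= p)%N -> sqn (fun i => X p.+1 i - U i) <= C1 * S p.
  by move=> pp; apply: EB (it p) _; apply: stay; exact: leqW.
pose K := C2 * C1 / c.
have K0 : 0 < K by rewrite divr_gt0 ?mulr_gt0.
(* The inequality [e p.+1 <= K * (e p - e p.+1)] solves to this contraction factor. *)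
pose Q := K / (1 + K).
have Q0 : 0 < Q by rewrite divr_gt0 //; lra.
have Q1 : Q < 1 by rewrite ltr_pdivrMr; lra.
have contr p : (p2 <= p)%N -> e p.+1 <= Q * e p.
  move=> pp; have h1 : e p.+1 <= K * (e p - e p.+1).
    apply: le_trans (QB _ (iter_new (it p))) _; apply: le_trans (ler_wpM2l (ltW C20) (near p pp)) _.
    apply: le_trans (ler_wpM2l (ltW C20) (ler_wpM2l (ltW C10) (Se p))) _.
    by rewrite /K le_eqVlt; apply/orP; left; apply/eqP; ring.
  by rewrite /Q mulrAC ler_pdivlMr; lra.
have geo m : e (m + p2)%N <= Q ^+ m * e p2.
  elim: m => [|m IH]; first by rewrite expr0 mul1r.
  rewrite addSn exprS -mulrA; apply: le_trans (contr _ (leq_addl _ _)) _.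
  by apply: ler_wpM2l => //; exact: ltW.
(* The squared distance is bounded by a multiple of [e], hence the square root; the summand 1 in [B]
   below keeps it positive. *)
pose q := Num.sqrt Q.
have q0 : 0 < q by rewrite sqrtr_gt0.
have q2 : q ^+ 2 = Q by rewrite sqr_sqrtr // ltW.
have q1 : q < 1 by rewrite -(@expr_lt1 _ 2) ?ltW // q2.
pose B := C1 / c * e p2 + 1.
have B0 : 0 < B.
  by apply: ltr_wpDl => //; apply: mulr_ge0 => //; rewrite divr_ge0 // ltW.
exists (Num.sqrt B / q ^+ p2.+1), q, p2.+1; split; first by rewrite divr_gt0 ?sqrtr_gt0 ?exprn_gt0.
split; first by rewrite q0 q1.
move=> p pp; have [m ->] : exists m, p = (m + p2).+1 by exists (p - p2.+1)%N; lia.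
have -> : Num.sqrt B / q ^+ p2.+1 * q ^+ (m + p2).+1 = Num.sqrt B * q ^+ m.
  by rewrite -addnS exprD; field; rewrite expf_neq0 // gt_eqF.
rewrite frob_sqn -[leRHS]ger0_norm; last by rewrite mulr_ge0 ?sqrtr_ge0 // exprn_ge0 // ltW.
rewrite -sqrtr_sqr ler_wsqrtr // exprMn sqr_sqrtr ?(ltW B0) // exprAC q2.
apply: le_trans (near _ (leq_addl _ _)) _.
apply: le_trans (ler_wpM2l (ltW C10) (Se _)) _.
apply: (@le_trans _ _ (C1 / c * e (m + p2)%N)).
  rewrite mulrA mulrAC; apply: ler_wpM2l; first by rewrite divr_ge0 // ltW.
  by have := ep0 (m + p2).+1; lra.
apply: le_trans (_ : C1 / c * (Q ^+ m * e p2) <= _).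
  by apply: ler_wpM2l => //; rewrite divr_ge0 // ltW.
rewrite mulrCA mulrC; apply: ler_wpM2r; first by rewrite exprn_ge0 // ltW.
by rewrite /B; lra.
Qed.

End Convergence.

(** * Iterates whose number of columns becomes constant *)

Section Cast.
Variables (R : realType) (k : nat) (n : 'I_k -> nat).

(** The sizes [T p] are only provably equal to the final one, so iterates are transported to a
    common type. *)
Definition castmats t t' (e : t = t') (U : mats R n t) : mats R n t' := fun i => castmx (erefl (n i), e) (U i).

Lemma castmats_id t (e : t = t) (U : mats R n t) : castmats e U = U.
Proof. by apply: functional_extensionality_dep => i; rewrite /castmats castmx_id. Qed.

Lemma iapd_step_cast A s eps kappa tX tY t (eX : tX = t) (eY : tY = t) (X : mats R n tX) (Y : mats R n tY) :
  iapd_step A s eps kappa X Y -> iapd_step A s eps kappa (castmats eX X) (castmats eY Y).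
Proof. by subst tX; subst tY; rewrite !castmats_id. Qed.

Lemma feasible_cast s tX t (e : tX = t) (X : mats R n tX) : feasible s X -> feasible s (castmats e X).
Proof. by case: _ / e; rewrite castmats_id. Qed.
End Cast.

Theorem theorem5p15 (R : realType) (k : nat) (n : 'I_k -> nat) (s r : nat) :
  (3 <= k)%N -> (1 <= s <= k)%N ->
  (forall i : 'I_k, 0 < n i)%N -> (0 < r)%N -> (forall i : 'I_k, r <= n i)%N ->
  (s = 1%N ->
     (forall i0 : 'I_k, val i0 = 0%N ->
        (n i0 + k - 1 <= \sum_(i : 'I_k | (0 < val i)%N) n i)%N) /\
     (forall i2 : 'I_k, (0 < val i2)%N ->
        (n i2 + k <= \sum_(i : 'I_k | (0 < val i)%N) n i)%N)) ->
  exists N : tensor R n -> Prop, tensor_null N /\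
  forall A : tensor R n, ~ N A ->
  forall (eps kappa : R) (T : nat -> nat) (U : forall p : nat, mats R n (T p)),
    0 < eps -> T 0%N = r -> feasible s (U 0%N) -> 0 < fobj A (U 0%N) ->
    0 < kappa -> kappa < Num.sqrt (fobj A (U 0%N) / r%:R) ->
    (forall p : nat, iapd_step A s eps kappa (U p) (U p.+1)) ->
    exists (t : nat) (Ustar : mats R n t), KKT A s Ustar /\
      exists (C q : R) (p0 : nat), 0 < C /\ 0 < q < 1 /\
        forall p : nat, (p0 <= p)%N ->
          exists e : T p = t,
            frob (fun i : 'I_k => castmx (erefl (n i), e) (U p i) - Ustar i) <= C * q ^+ p.
Proof.
move=> k3 hs n0 r0 rn hsz; exists (@special R k n); split.
  exact: (null_special [ffun i : 'I_k => Ordinal (n0 i)]).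
move=> A hA eps kappa T U e0 T0 fU0 _ k0 _ hstep.
have fU p : feasible s (U p) by elim: p => // p IH; have [] := step_feasible k0 hs IH (hstep p).
have Tle p : (T p.+1 <= T p)%N by have [] := step_feasible k0 hs (fU p) (hstep p).
(* Columns are deleted only finitely often; the analysis restarts at [p0], with at most [r]
   columns. *)
have [p0 hp0] := nonincreasing_stationary Tle.
have Tr p : (T p <= r)%N by rewrite -T0; elim: p => // p; exact: leq_trans (Tle p).
have TE q : T (q + p0)%N = T p0 by apply: hp0; exact: leq_addl.
pose X q := castmats (TE q) (U (q + p0)%N).
have it q : iteration A s eps kappa (X q) (X q.+1).
  apply: step_iteration => //; first exact: feasible_cast.
  exact: iapd_step_cast (hstep (q + p0)%N).
have tn i : (T p0 <= n i)%N by exact: leq_trans (Tr p0) (rn i).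
have [Us [hK [C [q [p1 [C0 [q01 hC]]]]]]] := iteration_converges k3 hs n0 tn hsz hA e0 k0 it.
have q0 : 0 < q by case/andP: q01.
(* Dividing by [q ^+ p0] undoes the shift of the index by [p0]. *)
exists (T p0), Us; split => //; exists (C / q ^+ p0), q, (p1 + p0)%N; split; first by rewrite divr_gt0 ?exprn_gt0.
split => // p pp; have [m mE] : exists m, p = (m + p0)%N by exists (p - p0)%N; lia.
rewrite {}mE in pp *; exists (TE m).
have -> : C / q ^+ p0 * q ^+ (m + p0) = C * q ^+ m by rewrite exprD; field; rewrite expf_neq0 // gt_eqF.
by apply: hC; rewrite leq_add2r in pp.
Qed.
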